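(* Let $\underline{t},\underline{s}\in\mathbb{R}^m$ with $|\underline{t}|=|\underline{s}|=1$, $\underline{t}\perp\underline{s}$, and let $\underline{\tau}=\underline{t}+i\underline{s}$. Let $f\in\mathscr{MB}(\mathbb{R}^m)$ and let $\mathcal{R}_{\underline{\tau}}[f]$ be its Bargmann-Radon transform. Then for all $\underline{u}\in\mathbb{R}^m$ $$\mathcal{R}_{\underline{\tau}}[f](\underline{u})=\frac{1}{(2\pi)^{m/2}}\int_{\mathbb{R}^m}e^{-|\underline{x}|^2/2}\,B_{\underline{\tau}}(\underline{u},\underline{x})\,f(\underline{x})\,d\underline{x},$$ where $$B_{\underline{\tau}}(\underline{u},\underline{x})=\sum_{\ell=0}^\infty\frac{(-1)^\ell}{\ell!\,4\cdot 2^\ell}\langle\underline{u},\underline{\tau}\rangle^\ell\,\underline{\tau}\,\underline{\tau}^\dagger\,\langle\underline{x},\underline{\tau}^\dagger\rangle^\ell=\frac{\underline{\tau}\,\underline{\tau}^\dagger}{4}\exp\left(-\frac12\langle\underline{u},\underline{\tau}\rangle\langle\underline{x},\underline{\tau}^\dagger\rangle\right).$$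
   Context: Let $m\ge 2$. $\mathbb{C}_m$ is the complex Clifford algebra with generators $\underline{e}_1,\dots,\underline{e}_m$, $\underline{e}_i\underline{e}_j+\underline{e}_j\underline{e}_i=-2\delta_{ij}$, and basis $\underline{e}_A$ ($\underline{e}_\emptyset=1$). A vector $z=(z_1,\dots,z_m)\in\mathbb{C}^m$ (in particular in $\mathbb{R}^m$) is identified with $\underline{z}=\sum_j z_j\underline{e}_j\in\mathbb{C}_m$; $\langle\underline{z},\underline{w}\rangle=\sum_j z_jw_j$ is complex bilinear, and $|\underline{x}|$ is the Euclidean norm for $\underline{x}\in\mathbb{R}^m$. The Hermitian conjugation $\dagger$ on $\mathbb{C}_m$ is the conjugate-linear anti-automorphism ($(\lambda\mu)^\dagger=\mu^\dagger\lambda^\dagger$) with $\underline{e}_j^\dagger=-\underline{e}_j$; thus for $\underline{\tau}=\underline{t}+i\underline{s}$ one has $\underline{\tau}^\dagger=-\underline{t}+i\underline{s}$. A continuously differentiable $f:\Omega\to\mathbb{C}_m$, $\Omega\subseteq\mathbb{R}^m$ open, is (left) monogenic if $\partial_{\underline{x}}f=\sum_{j=1}^m\underline{e}_j\partial_{x_j}f=0$. $\mathscr{MB}(\mathbb{R}^m)$ (monogenic Bargmann module) is the right $\mathbb{C}_m$-module of monogenic $f:\mathbb{R}^m\to\mathbb{C}_m$ with $f(\underline{x})e^{-|\underline{x}|^2/4}\in L^2(\mathbb{R}^m)$, with $\mathbb{C}_m$-valued inner product $$\langle f,g\rangle=\frac{1}{(2\pi)^{m/2}}\int_{\mathbb{R}^m}e^{-|\underline{x}|^2/2}f^\dagger(\underline{x})g(\underline{x})\,d\underline{x};$$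 the norm squared of $f$ is the scalar part of $\langle f,f\rangle$. For $\underline{\tau}=\underline{t}+i\underline{s}$ with $\underline{t},\underline{s}$ orthonormal in $\mathbb{R}^m$, $\mathscr{MB}(\underline{\tau})$ is the closure in $\mathscr{MB}(\mathbb{R}^m)$ of the right $\mathbb{C}_m$-module of all finite linear combinations $\sum_\ell\langle\underline{x},\underline{\tau}\rangle^\ell\,\underline{\tau}\,a_\ell$, $a_\ell\in\mathbb{C}_m$. The Bargmann-Radon transform $\mathcal{R}_{\underline{\tau}}[f]$ of $f\in\mathscr{MB}(\mathbb{R}^m)$ is the orthogonal projection of $f$ onto $\mathscr{MB}(\underline{\tau})$. *)

(* Defs.v *)
From HB Require Import structures.
From mathcomp Require Import all_boot all_order all_algebra.
From mathcomp Require Import ring complex.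
From mathcomp Require Import all_classical all_reals all_analysis.

Set Implicit Arguments.
Unset Strict Implicit.
Unset Printing Implicit Defensive.
Import Order.TTheory GRing.Theory Num.Theory.
Import numFieldNormedType.Exports.
Local Open Scope classical_set_scope.
Local Open Scope ring_scope.
Local Open Scope complex_scope.

Section SymmetricDifference.
Variable T : finType.
Implicit Types A B C : {set T}.

Definition symdiff A B : {set T} := (A :\: B) :|: (B :\: A).

Lemma in_symdiff A B x : (x \in symdiff A B) = (x \in A) (+) (x \in B).
Proof. by rewrite !inE; case: (x \in A); case: (x \in B). Qed.

Lemma symdiffA A B C : symdiff A (symdiff B C) = symdiff (symdiff A B) C.
Proof. by apply/setP => x; rewrite !in_symdiff addbA. Qed.

Lemma symdiffC A B : symdiff A B = symdiff B A.
Proof. by apply/setP => x; rewrite !in_symdiff addbC. Qed.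

Lemma symdiff0 A : symdiff A finset.set0 = A.
Proof. by apply/setP => x; rewrite in_symdiff inE addbF. Qed.

Lemma symdiffv A : symdiff A A = finset.set0.
Proof. by apply/setP => x; rewrite in_symdiff inE addbb. Qed.

Lemma symdiffK A B : symdiff A (symdiff A B) = B.
Proof. by rewrite symdiffA symdiffv symdiffC symdiff0. Qed.

Lemma odd_sum_symdiff A B (F : T -> nat) :
  odd (\sum_(i in symdiff A B) F i)%N =
  odd (\sum_(i in A) F i)%N (+) odd (\sum_(i in B) F i)%N.
Proof.
rewrite !(big_mkcond (fun i => i \in _)) !(big_morph odd oddD (erefl _)).
rewrite -big_split; apply: eq_bigr => i _; rewrite in_symdiff.
by case: (i \in A); case: (i \in B); rewrite /= ?addbb ?addbF.
Qed.

End SymmetricDifference.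

(* Moving e_B through e_A costs one sign per pair (i, j) in A x B with j < i,
   and each common index contributes e_i ^ 2 = -1; hence
   e_A e_B = (-1) ^ clinv A B e_(symdiff A B). *)
Definition clinv (m : nat) (A B : {set 'I_m}) : nat :=
  (\sum_(i in A) \sum_(j in B) (j <= i)%N)%N.

Section CliffordSign.
Variables (K : pzRingType) (m : nat).
Implicit Types A B C : {set 'I_m}.

Definition clsign A B : K := (-1) ^+ clinv A B.

Lemma clsign_symdiffl A B C :
  clsign (symdiff A B) C = clsign A C * clsign B C.
Proof.
by rewrite /clsign -signr_odd odd_sum_symdiff signr_addb !signr_odd.
Qed.

Lemma clinv_exchange A B :
  clinv A B = (\sum_(j in B) \sum_(i in A) (j <= i)%N)%N.
Proof. exact: exchange_big. Qed.

Lemma clsign_symdiffr A B C :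
  clsign A (symdiff B C) = clsign A B * clsign A C.
Proof.
rewrite /clsign !clinv_exchange -signr_odd odd_sum_symdiff signr_addb.
by rewrite !signr_odd.
Qed.

Lemma clsign0l A : clsign finset.set0 A = 1.
Proof. by rewrite /clsign /clinv big_set0. Qed.

Lemma clsign0r A : clsign A finset.set0 = 1.
Proof. by rewrite /clsign clinv_exchange big_set0. Qed.

Lemma clsign_sqr A B : clsign A B * clsign A B = 1.
Proof. by rewrite /clsign -expr2 sqrr_sign. Qed.

End CliffordSign.
Arguments clsign K {m} A B.

(* The complex Clifford algebra C_m: [a A] is the coefficient of e_A. *)
Definition clifford (R : rcfType) (m : nat) : Type :=
  {ffun {set 'I_m} -> R[i]}.

Section Clifford.
Variables (R : rcfType) (m : nat).
Local Notation Cl := (clifford R m).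

HB.instance Definition _ :=
  GRing.Lmodule.copy Cl {ffun {set 'I_m} -> R[i]}.

Implicit Types (a b c : Cl) (A B C : {set 'I_m}).

Definition clcoef a : {set 'I_m} -> R[i] := fun_of_fin (a : {ffun _ -> _}).
Definition mkcl (F : {set 'I_m} -> R[i]) : Cl := finfun F.

Lemma clcoefE F A : clcoef (mkcl F) A = F A.
Proof. by rewrite /clcoef /mkcl ffunE. Qed.

Lemma clP a b : clcoef a =1 clcoef b <-> a = b.
Proof. by split=> [ab|->//]; apply/ffunP. Qed.

Lemma clcoefD a b A : clcoef (a + b) A = clcoef a A + clcoef b A.
Proof. by rewrite /clcoef ffunE. Qed.

Lemma clcoef0 A : clcoef 0 A = 0.
Proof. by rewrite /clcoef ffunE. Qed.

Lemma clcoefZ k a A : clcoef (k *: a) A = k * clcoef a A.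
Proof. by rewrite /clcoef ffunE. Qed.

Lemma clcoef_sum I (r : seq I) (P : pred I) (F : I -> Cl) A :
  clcoef (\sum_(i <- r | P i) F i) A = \sum_(i <- r | P i) clcoef (F i) A.
Proof.
exact: (big_morph (clcoef ^~ A) (fun a b => clcoefD a b A) (clcoef0 A)).
Qed.

Definition cl_basis A : Cl := mkcl (fun B => (B == A)%:R).

Definition cl_one : Cl := cl_basis finset.set0.

Definition cl_mul a b : Cl :=
  mkcl (fun C => \sum_A clsign _ A (symdiff A C) *
                          (clcoef a A * clcoef b (symdiff A C))).

Let mulA : associative cl_mul.
Proof.
move=> a b c; apply/clP => D; rewrite !clcoefE.
under eq_bigr => A _ do rewrite clcoefE 2!big_distrr /=.
under [RHS]eq_bigr => A _ do rewrite clcoefE big_distrl big_distrr /=.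
rewrite [RHS]exchange_big /=; apply: eq_bigr => A _.
rewrite [RHS](reindex_inj (can_inj (@symdiffK _ A))) /=.
apply: eq_bigr => F _.
rewrite symdiffK clsign_symdiffl.
rewrite -symdiffA [symdiff F (symdiff A D)]symdiffA [symdiff F A]symdiffC.
rewrite -!symdiffA.
set G := symdiff A (symdiff F D).
have -> : symdiff A D = symdiff F G.
  by rewrite /G symdiffA [symdiff F A]symdiffC -symdiffA symdiffK.
by rewrite clsign_symdiffr; ring.
Qed.

Let mul1 : left_id cl_one cl_mul.
Proof.
move=> a; apply/clP => D; rewrite clcoefE (bigD1 finset.set0) //= big1 => [|A A0].
  by rewrite clsign0l clcoefE eqxx !mul1r addr0 symdiffC symdiff0.
by rewrite clcoefE (negbTE A0) mul0r mulr0.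
Qed.

Let mul_1 : right_id cl_one cl_mul.
Proof.
move=> a; apply/clP => D; rewrite clcoefE (bigD1 D) //= big1 => [|A AD].
  by rewrite symdiffv clsign0r clcoefE eqxx mulr1 mul1r addr0.
rewrite clcoefE; case: eqP => [e|_]; last by rewrite !mulr0.
by rewrite -(symdiffK A D) e symdiff0 eqxx in AD.
Qed.

Let mulDl : left_distributive cl_mul +%R.
Proof.
move=> a b c; apply/clP => D; rewrite clcoefD !clcoefE -big_split /=.
by apply: eq_bigr => A _; rewrite clcoefD; ring.
Qed.

Let mulDr : right_distributive cl_mul +%R.
Proof.
move=> a b c; apply/clP => D; rewrite clcoefD !clcoefE -big_split /=.
by apply: eq_bigr => A _; rewrite clcoefD; ring.
Qed.

Let one_neq0 : cl_one != 0.
Proof.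
apply/eqP => /clP /(_ finset.set0); rewrite clcoefE clcoef0 eqxx => /eqP.
by rewrite oner_eq0.
Qed.

HB.instance Definition _ :=
  GRing.Zmodule_isNzRing.Build Cl mulA mul1 mul_1 mulDl mulDr one_neq0.

Let scaleAl (k : R[i]) (a b : Cl) : k *: (a * b) = (k *: a) * b.
Proof.
apply/clP => D; rewrite clcoefZ !clcoefE big_distrr /=.
by apply: eq_bigr => A _; rewrite clcoefZ; ring.
Qed.

HB.instance Definition _ := GRing.Lmodule_isLalgebra.Build R[i] Cl scaleAl.

Let scaleAr (k : R[i]) (a b : Cl) : k *: (a * b) = a * (k *: b).
Proof.
apply/clP => D; rewrite clcoefZ !clcoefE big_distrr /=.
by apply: eq_bigr => A _; rewrite clcoefZ; ring.
Qed.

HB.instance Definition _ := GRing.Lalgebra_isAlgebra.Build R[i] Cl scaleAr.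

Lemma cl_basisM A B :
  cl_basis A * cl_basis B = clsign R[i] A B *: cl_basis (symdiff A B).
Proof.
apply/clP => D; rewrite clcoefZ !clcoefE (bigD1 A) //= big1 => [|E EA].
  rewrite !clcoefE eqxx mul1r addr0 (can2_eq (@symdiffK _ A) (@symdiffK _ A)).
  by case: eqP => [->|_]; rewrite ?symdiffK // !mulr0.
by rewrite !clcoefE (negbTE EA) mul0r mulr0.
Qed.

Lemma cl_basis_decomp a : a = \sum_A clcoef a A *: cl_basis A.
Proof.
apply/clP => D; rewrite clcoef_sum (bigD1 D) //= big1 => [|A AD].
  by rewrite clcoefZ clcoefE eqxx mulr1 addr0.
by rewrite clcoefZ clcoefE eq_sym (negbTE AD) mulr0.
Qed.

Definition cl_gen (j : 'I_m) : Cl := cl_basis (finset.set1 j).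

Lemma cl_gen_anticomm i j :
  cl_gen i * cl_gen j + cl_gen j * cl_gen i = (- 2 * (i == j)%:R : R[i])%:A.
Proof.
rewrite !cl_basisM [symdiff (finset.set1 j) _]symdiffC -scalerDl /clsign /clinv.
rewrite !big_set1 -(inj_eq val_inj) /=; case: (ltngtP i j) => [ij|ji|/val_inj ->].
- by rewrite expr0 expr1 addrN mulr0 !scale0r.
- by rewrite expr0 expr1 addNr mulr0 !scale0r.
- by rewrite symdiffv mulr1; congr (_ *: _); rewrite expr1; ring.
Qed.

Lemma cl_basis_prod A : cl_basis A = \prod_(j <- enum A) cl_gen j.
Proof.
have srt : sorted (fun i j : 'I_m => i < j)%N (enum A).
  rewrite /enum_mem; apply: sorted_filter.
    by move=> ? ? ?; exact: ltn_trans.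
  by have := iota_ltn_sorted 0 m; rewrite -val_enum_ord sorted_map enumT.
rewrite -[in LHS](set_enum A); elim: (enum A) srt => [_|j r IH /= jr].
  by rewrite big_nil (_ : [set x in [::]]%SET = finset.set0)//; apply/setP => k; rewrite !inE.
rewrite big_cons -IH ?(path_sorted jr) // cl_basisM.
have jltr k : k \in r -> (j < k)%N.
  have tr : transitive (fun i k : 'I_m => i < k)%N by move=> ? ? ?; exact: ltn_trans.
  by move: k; exact/allP/(order_path_min tr).
rewrite /clsign /clinv big_set1 big1 ?expr0 ?scale1r => [|k]; last first.
  by rewrite inE => /jltr; rewrite ltnNge => /negbTE ->.
congr cl_basis; apply/setP => k; rewrite in_symdiff !inE.
by case: eqP => // ->; case jr': (j \in r) => //; have := jltr _ jr'; rewrite ltnn.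
Qed.

(* e_A is invertible with inverse clsign A A *: e_A, and e_A^dagger is the
   inverse of e_A; see [cl_daggerM] and [cl_dagger_gen]. *)
Definition cl_dagger a : Cl :=
  mkcl (fun A => clsign _ A A * (clcoef a A)^*).

Lemma cl_daggerD a b : cl_dagger (a + b) = cl_dagger a + cl_dagger b.
Proof.
apply/clP => A; rewrite [LHS]clcoefE [RHS]clcoefD clcoefD rmorphD mulrDr.
by rewrite ![in RHS]clcoefE.
Qed.

Lemma cl_daggerZ k a : cl_dagger (k *: a) = k^* *: cl_dagger a.
Proof.
apply/clP => A; rewrite [LHS]clcoefE [RHS]clcoefZ clcoefZ rmorphM mulrCA.
by rewrite [in RHS]clcoefE.
Qed.

Lemma cl_daggerM a b : cl_dagger (a * b) = cl_dagger b * cl_dagger a.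
Proof.
apply/clP => C; rewrite !clcoefE rmorph_sum big_distrr /=.
rewrite (reindex_inj (can_inj (@symdiffK _ C))) /=; apply: eq_bigr => B _.
rewrite [symdiff (symdiff C B) C]symdiffC symdiffK.
rewrite [symdiff C B]symdiffC !clcoefE !rmorphM /= !rmorphXn /= rmorphN1.
rewrite -/(clsign _ (symdiff B C) B).
set D := symdiff B C; have -> : C = symdiff B D by rewrite symdiffK.
rewrite !(clsign_symdiffl, clsign_symdiffr).
set K := (X in clsign X).
have e (u : K) : u = clsign K B B ^+ 2 * clsign K C B ^+ 2 * u.
  by rewrite ![_ ^+ 2]expr2 !clsign_sqr !mul1r.
by rewrite [RHS]e /K; ring.
Qed.

Lemma cl_dagger_gen j : cl_dagger (cl_gen j) = - cl_gen j.
Proof.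
apply/clP => A; rewrite -scaleN1r clcoefZ !clcoefE rmorph_nat.
case: eqP => [->|_]; last by rewrite !mulr0.
by rewrite /clsign /clinv !big_set1 leqnn expr1.
Qed.

End Clifford.
Arguments cl_basis {R m} A.
Arguments cl_gen {R m} j.

Section Vectors.
Variables (R : realType) (m : nat).

(* Row vectors carry the sup norm in the library; this is the Euclidean one. *)
Definition edot (x y : 'rV[R]_m) : R := \sum_(j < m) x 0 j * y 0 j.
Definition enorm (x : 'rV[R]_m) : R := Num.sqrt (edot x x).

Definition cdot (z w : 'rV[R[i]]_m) : R[i] := \sum_(j < m) z 0 j * w 0 j.

Definition cvec (x : 'rV[R]_m) : 'rV[R[i]]_m := \row_j (x 0 j)%:C.

Definition cl_vec (z : 'rV[R[i]]_m) : clifford R m :=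
  \sum_(j < m) z 0 j *: cl_gen j.

Definition tauvec (t s : 'rV[R]_m) : 'rV[R[i]]_m :=
  \row_j (t 0 j +i* s 0 j).

Definition vdagger (z : 'rV[R[i]]_m) : 'rV[R[i]]_m := \row_j - (z 0 j)^*.

Lemma cl_vec_dagger z : cl_vec (vdagger z) = cl_dagger (cl_vec z).
Proof.
rewrite /cl_vec; elim/big_rec2: _ => [|j a b _ ->].
  by apply/clP => A; rewrite [RHS]clcoefE [in RHS]clcoef0 rmorph0 mulr0 clcoef0.
by rewrite cl_daggerD cl_daggerZ cl_dagger_gen scalerN mxE scaleNr.
Qed.

Definition cexp (z : R[i]) : R[i] :=
  (expR (complex.Re z))%:C * (cos (complex.Im z) +i* sin (complex.Im z)).

End Vectors.

(* Analysis in the finite-dimensional real vector space C_m is done on its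
   real coordinates: the real ([b = false]) and imaginary ([b = true]) parts
   of the coefficients. *)
Section Coordinates.
Variables (R : realType) (m : nat).

Definition coord (b : bool) (A : {set 'I_m}) (a : clifford R m) : R :=
  if b then complex.Im (clcoef a A) else complex.Re (clcoef a A).

Definition of_coord (F : bool -> {set 'I_m} -> R) : clifford R m :=
  mkcl (fun A => F false A +i* F true A).

Lemma coordK a : of_coord (fun b A => coord b A a) = a.
Proof. by apply/clP => A; rewrite clcoefE /coord; case: (clcoef a A). Qed.

Lemma of_coordK F b A : coord b A (of_coord F) = F b A.
Proof. by rewrite /coord clcoefE; case: b. Qed.

Definition cl_cvg (u : nat -> clifford R m) (l : clifford R m) : Prop :=
  forall b A, coord b A (u n) @[n --> \oo] --> coord b A l.

Definition cl_lim (u : nat -> clifford R m) : clifford R m :=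
  of_coord (fun b A => lim (coord b A (u n) @[n --> \oo])).

End Coordinates.

Section Monogenic.
Variables (R : realType) (m : nat).
Implicit Types (f : 'rV[R]_m -> clifford R m) (O : set 'rV[R]_m).

Definition cl_partial (j : 'I_m) f (x : 'rV[R]_m) : clifford R m :=
  of_coord (fun b A => 'D_(delta_mx 0 j) (coord b A \o f) x).

Definition cont_diff O f : Prop :=
  forall b A j x, O x ->
    derivable (coord b A \o f) x (delta_mx 0 j) /\
    {for x, continuous ('D_(delta_mx 0 j) (coord b A \o f))}.

Definition dirac_op f (x : 'rV[R]_m) : clifford R m :=
  \sum_(j < m) cl_gen j * cl_partial j f x.

Definition monogenic O f : Prop :=
  [/\ open O, cont_diff O f & forall x, O x -> dirac_op f x = 0].

End Monogenic.

Section LebesgueMeasure.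
Variable R : realType.
Local Notation RT := (measurableTypeR R).

Definition cons_pair n (p : RT * n.-tuple RT) : n.+1.-tuple RT :=
  [tuple of p.1 :: p.2].

Lemma measurable_cons_pair n : measurable_fun setT (@cons_pair n).
Proof. exact: measurable_cons. Qed.

Lemma cons_pair_preimage n (A : 'I_n.+1 -> set RT) :
  @cons_pair n @^-1` [set x | forall i, A i (tnth x i)] =
  A ord0 `*` [set x | forall i, A (lift ord0 i) (tnth x i)].
Proof.
apply/seteqP; split=> -[a x] /=.
  move=> Aax; split=> [|i]; first exact: (Aax ord0).
  by have := Aax (lift ord0 i); rewrite tnthS.
move=> [Aa Ax] i; case: (unliftP ord0 i) => [j|] ->//.
by rewrite tnthS.
Qed.

Lemma measurable_box n (A : 'I_n -> set RT) :
  (forall i, measurable (A i)) ->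
  measurable [set x : n.-tuple RT | forall i, A i (tnth x i)].
Proof.
move=> mA.
have -> : [set x : n.-tuple RT | forall i, A i (tnth x i)] =
    \big[setI/setT]_(i < n) ((fun x : n.-tuple RT => tnth x i) @^-1` A i).
  rewrite -bigcap_seq; apply/seteqP; split=> x /= Ax i; first by move=> _; exact: Ax.
  by apply: (Ax i) => /=; rewrite mem_index_enum.
apply: bigsetI_measurable => i _; rewrite -[X in measurable X]setTI.
exact: measurable_tnth.
Qed.

Section Step.
Variables (n : nat) (mu : {sigma_finite_measure set (n.-tuple RT) -> \bar R}).

Let mf := @measurable_cons_pair n.

Definition lebesgue_step : set (n.+1.-tuple RT) -> \bar R :=
  pushforward (lebesgue_measure \x mu)%E (@cons_pair n).

HB.instance Definition _ := Measure.copy lebesgue_step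
  (measure_function_pushforward__canonical__measure_function_Measure
     (lebesgue_measure \x mu)%E mf).

Let sigma_finite_step : sigma_finite setT lebesgue_step.
Proof.
have /sigma_finiteP[F [TF ndF Foo]] := sigma_finiteT (@lebesgue_measure R).
have /sigma_finiteP[G [TG ndG Goo]] := sigma_finiteT mu.
pose g (x : n.+1.-tuple RT) : RT * n.-tuple RT := (thead x, [tuple of behead x]).
have mg : measurable_fun setT g.
  apply/measurable_fun_pairP; split; last exact: measurable_behead.
  exact: measurable_tnth.
exists (fun k => g @^-1` (F k `*` G k)).
  rewrite -preimage_bigcup -[LHS](preimage_setT g); congr (_ @^-1` _).
  apply/seteqP; split=> // -[x y] _.
  have [i _ Fx] : (\bigcup_k F k) x by rewrite -TF.
  have [j _ Gy] : (\bigcup_k G k) y by rewrite -TG.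
  exists (maxn i j) => //; split.
    by move: x Fx; exact/subsetPset/ndF/leq_maxl.
  by move: y Gy; exact/subsetPset/ndG/leq_maxr.
move=> k; have [? ?] := Foo k; have [? ?] := Goo k; split.
  by rewrite -[X in measurable X]setTI; apply: mg => //; exact: measurableX.
rewrite /lebesgue_step /pushforward -comp_preimage.
rewrite (_ : g \o _ = id); last first.
  by rewrite funeqE => -[a x]; congr pair; apply/val_inj.
by rewrite preimage_id product_measure1E// lte_mul_pinfty// ge0_fin_numE.
Qed.

HB.instance Definition _ :=
  Measure_isSigmaFinite.Build _ _ _ lebesgue_step sigma_finite_step.

End Step.

Fixpoint lebesgue_tuple n : {sigma_finite_measure set (n.-tuple RT) -> \bar R} :=
  match n with
  | 0 => dirac [tuple]
  | n'.+1 => lebesgue_step (lebesgue_tuple n')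
  end.

Lemma lebesgue_tuple_box n (A : 'I_n -> set RT) :
  (forall i, measurable (A i)) ->
  lebesgue_tuple n [set x | forall i, A i (tnth x i)] =
  (\prod_(i < n) lebesgue_measure (A i))%E.
Proof.
elim: n A => [|n IH] A mA.
  by rewrite big_ord0 /= diracE mem_set // => -[].
rewrite big_ord_recl /= /lebesgue_step /pushforward cons_pair_preimage.
rewrite product_measure1E //; last first.
  by apply: (@measurable_box n (fun i => A (lift ord0 i))) => i; exact: mA.
by congr (_ * _)%E; exact: (IH (fun i => A (lift ord0 i))) => i; exact: mA.
Qed.

End LebesgueMeasure.

Section BargmannModule.
Variables (R : realType) (m : nat).
Implicit Types (f g h : 'rV[R]_m -> clifford R m) (x u : 'rV[R]_m).
Local Notation RT := (measurableTypeR R).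

Definition row_of_tuple (p : m.-tuple RT) : 'rV[R]_m := \row_j tnth p j.

Definition cl_integrable f : Prop :=
  forall b A, (lebesgue_tuple R m).-integrable setT
    (fun p => (coord b A (f (row_of_tuple p)))%:E).

Definition cl_integral f : clifford R m :=
  of_coord (fun b A =>
    \int[lebesgue_tuple R m]_p coord b A (f (row_of_tuple p))).

Definition gauss_weight (c : R) f x : clifford R m :=
  (expR (- (enorm x ^+ 2 / c)))%:C *: f x.

Definition gauss_integral f : clifford R m :=
  (((2 * pi) `^ (m%:R / 2))^-1)%:C *: cl_integral (gauss_weight 2 f).

Definition square_integrable f : Prop :=
  forall b A, (fun p => coord b A (f (row_of_tuple p)))
    \in Lfun (lebesgue_tuple R m) 2%:E.

Definition MB f : Prop :=
  monogenic setT f /\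
  square_integrable (gauss_weight 4 f).

Definition MB_inner f g : clifford R m :=
  gauss_integral (fun x => cl_dagger (f x) * g x).

Definition MB_norm f : R :=
  Num.sqrt (complex.Re (clcoef (MB_inner f f) finset.set0)).

Definition tau_comb (tau : 'rV[R[i]]_m) (n : nat)
    (a : 'I_n -> clifford R m) (x : 'rV[R]_m) : clifford R m :=
  \sum_(l < n) (cdot (cvec x) tau ^+ l) *: (cl_vec tau * a l).

Definition MB_tau (tau : 'rV[R[i]]_m) f : Prop :=
  MB f /\ forall e : R, 0 < e ->
    exists n (a : 'I_n -> clifford R m),
      MB_norm (f - tau_comb tau a) < e.

Definition is_orth_proj (V : ('rV[R]_m -> clifford R m) -> Prop) f g : Prop :=
  V g /\ forall h, V h -> MB_inner h (f - g) = 0.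

Definition bargmann_radon (tau : 'rV[R[i]]_m) f : 'rV[R]_m -> clifford R m :=
  xget (fun=> 0) [set g | is_orth_proj (MB_tau tau) f g].

Definition B_term (tau : 'rV[R[i]]_m) u x (l : nat) : clifford R m :=
  ((-1) ^+ l / (l`!%:R * (4 * 2 ^+ l)) *
   cdot (cvec u) tau ^+ l * cdot (cvec x) (vdagger tau) ^+ l) *:
    (cl_vec tau * cl_dagger (cl_vec tau)).

Definition B_kernel (tau : 'rV[R[i]]_m) u x : clifford R m :=
  cl_lim (fun n => \sum_(0 <= l < n) B_term tau u x l).

End BargmannModule.

(* Main.v *)
Require Import Defs.
From HB Require Import structures.
From mathcomp Require Import all_boot all_order all_algebra.
From mathcomp Require Import zify ring lra complex.
From mathcomp Require Import all_classical all_reals all_analysis.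
From mathcomp Require Import measurable_realfun.

Set Implicit Arguments.
Unset Strict Implicit.
Unset Printing Implicit Defensive.
Import Order.TTheory GRing.Theory Num.Theory.
Import numFieldNormedType.Exports.
Local Open Scope classical_set_scope.
Local Open Scope ring_scope.
Local Open Scope complex_scope.

(** Write z(x) = <x, tau> and z'(x) for its conjugate; then <x, tau^dagger> is
    - z'(x), and the kernel is (tau tau^dagger / 4) exp (z(u) z'(x) / 2).

    Since <tau, tau> = 0 and <tau, conj tau> = 2, the powers of z are orthogonal
    for the Gaussian weight, the normalised integral of z^k z'^l being
    delta_kl 2^k k!  ([zeta_moment]).  The proof is the Gaussian integration by
    parts E[x_j Q] = E[d_j Q] for polynomials ([stein]), which reduces to the
    moments of the one-dimensional Gaussian.  Because
    tau^dagger tau tau^dagger = 4 tau^dagger, it follows that the orthogonal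
    projection of f on the span of the z^l tau a with l < N is
    S_N(u) = sum_(l < N) z(u)^l tau c_l with
    c_l = tau^dagger E[z'^l f] / (4 2^l l!) ([orth_radon_sum]), and S_N(u) is also
    the integral of f against the N-th partial sum of the kernel ([radon_sumE]).

    Let P(u) be the integral of f against the kernel.  The partial sums of exp
    converge with geometric rate 2^-N up to a factor of exponential growth,
    which is integrable against f, so S_N converges to P at each point
    ([radon_rate]).  In norm, Pythagoras makes ||f - S_N||^2 non-increasing, so
    (S_N) is a Cauchy sequence ([tail_small]); Fatou's lemma transfers its Cauchy
    estimate to the pointwise limit, so that P - S_N tends to 0 in norm
    ([radon_sum_close]).  Hence f - P is orthogonal to all z^l tau a and, by
    Cauchy-Schwarz, to their closure.

    Differentiating under the integral gives d_j P = tau_j Y / 2 with Y a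
    continuous function in the right ideal tau C_m; so P is of class C^1 and its
    Dirac derivative is tau Y / 2 = 0 because tau^2 = 0 ([MB_radon]).  Thus P lies
    in the closed module and is an orthogonal projection of f.

    Two orthogonal projections differ by a function of norm 0, which vanishes
    almost everywhere, hence everywhere by continuity ([orth_proj_unique]). *)

(** * Derivatives in one real variable *)

Section DerivativeRules.
Variable R : realType.
Implicit Types (f g : R -> R) (x a b : R).

(** The usual rules, for functions written as abstractions, so that they apply to
    explicit formulas. *)
Lemma is_derive_mul f g x a b : is_derive x 1 f a -> is_derive x 1 g b ->
  is_derive x 1 (fun y => f y * g y) (a * g x + f x * b).
Proof.
move=> df dg; have := is_deriveM df dg.
by rewrite /GRing.scale/= addrC [g x * a]mulrC.
Qed.

Lemma is_derive_add f g x a b : is_derive x 1 f a -> is_derive x 1 g b ->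
  is_derive x 1 (fun y => f y + g y) (a + b).
Proof. by move=> df dg; exact: is_deriveD. Qed.

Lemma is_derive_sub f g x a b : is_derive x 1 f a -> is_derive x 1 g b ->
  is_derive x 1 (fun y => f y - g y) (a - b).
Proof. by move=> df dg; exact: is_deriveB. Qed.

Lemma is_derive_comp1 (h : R -> R) f x a b : is_derive (f x) 1 h b ->
  is_derive x 1 f a -> is_derive x 1 (fun y => h (f y)) (a * b).
Proof. by move=> dh df; have := @is_derive1_comp R h f x b a dh df; rewrite mulrC. Qed.

End DerivativeRules.

(** * Moments of the one-dimensional Gaussian *)

Section GaussianLine.
Variable R : realType.
Local Notation leb := (@lebesgue_measure R).
Implicit Types x c : R.

Definition gauss1 x : R := expR (- (x ^+ 2 / 2)).

Lemma gauss1_wide_integrable :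
  leb.-integrable setT (fun x => (expR (- (x ^+ 2 / 4)))%:E).
Proof.
(* Up to a constant, this is the normal density of variance 2. *)
pose s := Num.sqrt (2 : R).
have s2 : s ^+ 2 = 2 by rewrite sqr_sqrtr.
have s0 : s != 0 by apply/eqP => s0; move: s2; rewrite s0 expr0n/=; lra.
have := integrable_normal_pdf 0 s.
move=> /(integrableZl measurableT (normal_peak s)^-1).
apply: eq_integrable => // x _.
rewrite normal_pdfE// /= -EFinM mulrA mulVf ?gt_eqF ?normal_peak_gt0// mul1r.
by rewrite /normal_fun subr0 s2 mulNr; congr (expR (- (_ / _)))%:E; lra.
Qed.

Lemma measurable_gauss1 : measurable_fun setT gauss1.
Proof.
apply: measurableT_comp => //; apply: measurableT_comp => //.
by apply: measurable_funM => //; exact: measurable_funX.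
Qed.

(** Exponential growth is absorbed by half of the Gaussian exponent:
    c |x| - x^2 / 2 <= c^2 - x^2 / 4. *)
Lemma gauss1_exp_integrable c :
  leb.-integrable setT (fun x => (expR (c * `|x|) * gauss1 x)%:E).
Proof.
have := integrableZl measurableT (expR (c ^+ 2)) gauss1_wide_integrable.
apply: le_integrable => //.
  apply/measurable_EFinP; apply: measurable_funM; last exact: measurable_gauss1.
  apply: measurableT_comp => //; apply: measurable_funM => //.
move=> x _ /=; rewrite lee_fin /gauss1 -!expRD ![`|expR _|]ger0_norm ?expR_ge0//.
rewrite ler_expR.
have -> : x ^+ 2 = `|x| ^+ 2 by rewrite real_normK// num_real.
by have := sqr_ge0 (c - `|x| / 2); lra.
Qed.

Lemma expr_le_expR x k : 0 <= x -> x ^+ k <= k`!%:R * expR x.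
Proof.
move=> x0; have k0 : (0 : R) < k`!%:R by rewrite ltr0n fact_gt0.
rewrite -ler_pdivrMl// mulrC.
case: k k0 => [|k] k0; first by rewrite expr0 fact0 divr1 -expR0 ler_expR.
by apply: le_trans (expR_ge1Dxn k x0); rewrite lerDr.
Qed.

Lemma gauss1_mono_integrable k :
  leb.-integrable setT (fun x => (x ^+ k * gauss1 x)%:E).
Proof.
have := integrableZl measurableT (k`!%:R) (gauss1_exp_integrable 1).
apply: le_integrable => //.
  apply/measurable_EFinP; apply: measurable_funM; last exact: measurable_gauss1.
  exact: measurable_funX.
move=> x _ /=; rewrite lee_fin mul1r normrM [leRHS]ger0_norm; last first.
  by rewrite !mulr_ge0// ?expR_ge0.
rewrite [`|gauss1 x|]ger0_norm ?expR_ge0// mulrA ler_wpM2r ?expR_ge0//.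
by rewrite normrX expr_le_expR.
Qed.

Definition gauss_moment k : R := \int[leb]_x (x ^+ k * gauss1 x).

Lemma gauss_moment0 : gauss_moment 0 = Num.sqrt (2 * pi).
Proof.
have s0 : (1 : R) != 0 by rewrite oner_eq0.
have E := integral_normal_pdf (0 : R) (1 : R).
have p0 := normal_peak_gt0 s0.
rewrite /gauss_moment /Rintegral.
transitivity (fine (\int[leb]_x ((normal_peak (1 : R))^-1%:E * (normal_pdf 0 1 x)%:E))%E).
  congr fine; apply: eq_integral => x _;
    rewrite normal_pdfE//= -EFinM mulrA mulVf ?gt_eqF//.
  rewrite !mul1r /gauss1 /normal_fun subr0 expr1n mulNr.
  by congr (expR (- (_ / _)))%:E.
rewrite integralZl//; last exact: integrable_normal_pdf.
by rewrite E mule1/= /normal_peak invrK expr1n mul1r mulr2n; congr Num.sqrt; lra.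
Qed.

(** The integral of the derivative over [-n, n] is F n - F (- n), which tends to
    0; dominated convergence passes to the whole line. *)
Lemma integral_derivative_eq0 (f F : R -> R) :
  continuous f -> leb.-integrable setT (EFin \o f) ->
  (forall x, is_derive x 1 F (f x)) ->
  F (n%:R) @[n --> \oo] --> (0 : R) -> F (- n%:R) @[n --> \oo] --> (0 : R) ->
  \int[leb]_x f x = 0.
Proof.
move=> cf intf dF F1 F2.
have cF : continuous F.
  by move=> x; apply/differentiable_continuous/derivable1_diffP; have [] := dF x.
pose g n x : \bar R := ((f x)%:E * (\1_(`[- n%:R, n%:R] : set R) x)%:E)%E.
have mf : measurable_fun setT f by exact: continuous_measurable_fun.
have mg n : measurable_fun setT (g n).
  apply: emeasurable_funM; first exact/measurable_EFinP.
  by apply/measurable_EFinP; exact: measurable_indic.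
have [] := @dominated_convergence _ _ _ leb setT measurableT g (EFin \o f) (abse \o (EFin \o f)).
- exact: mg.
- exact/measurable_EFinP.
- apply: aeW => x _; apply: cvg_near_cst.
  near=> n; rewrite /g indicE mem_set ?mule1//= in_itv/= -ler_norml.
  by near: n; exact: nbhs_infty_ger.
- exact: integrable_abse.
- apply: aeW => x n _; rewrite /g indicE /=; case: (_ \in _);
  rewrite ?mulr1 ?mulr0 ?normr0//.
  by rewrite lee_fin.
move=> _ _ H.
have H0 : [sequence (\int[leb]_x g n x)%E]_n @ \oo --> (0 : \bar R).
  have : EFin (F n%:R - F (- n%:R)) @[n --> \oo] --> (0 : R)%:E.
    by apply: cvg_EFin; [exact: nearW|rewrite -(subr0 0); exact: cvgB].
  apply: cvg_trans; apply: near_eq_cvg.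
  near=> n; rewrite /=.
  have -> : (\int[leb]_x g n x = \int[leb]_(x in (`[(- n%:R)%R, n%:R%R] :
    set R)) (f x)%:E)%E.
    by rewrite [RHS]integral_mkcond epatch_indic.
  rewrite (@continuous_FTC2 _ f F)//.
  - have n0 : (0 < n)%N by near: n; exists 1%N.
    by rewrite gtrN ?ltr0n.
  - exact: continuous_subspaceT.
  - split; first by move=> x _; have [] := dF x.
    + exact: cvg_at_right_filter (cF _).
    + exact: cvg_at_left_filter (cF _).
  - by move=> x _; rewrite derive1E; exact: derive_val.
rewrite /Rintegral (_ : (\int[leb]_x (f x)%:E)%E = 0%E)//.
exact: (cvg_unique _ H H0).
Unshelve. all: by end_near. Qed.

Lemma mono_gauss1_tail k x : `|x ^+ k * gauss1 x| <= k`!%:R * expR 2 * expR (- `|x|).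
Proof.
rewrite normrM normrX [`|gauss1 x|]ger0_norm ?expR_ge0//.
apply: le_trans (ler_wpM2r (expR_ge0 _) (expr_le_expR k (normr_ge0 x))) _.
rewrite -[leRHS]mulrA -[leLHS]mulrA ler_wpM2l// /gauss1 -!expRD ler_expR.
have -> : x ^+ 2 = `|x| ^+ 2 by rewrite real_normK// num_real.
by have := sqr_ge0 (`|x| - 2); lra.
Qed.

(** Integrate the derivative of x^k e^(-x^2/2), which is
    k x^(k-1) e^(-x^2/2) - x^(k+1) e^(-x^2/2).  For k = 0 the
    right-hand side is 0: the first moment vanishes. *)
Lemma gauss_momentS k : gauss_moment k.+1 = k%:R * gauss_moment k.-1.
Proof.
pose f x := k%:R * (x ^+ k.-1 * gauss1 x) - x ^+ k.+1 * gauss1 x.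
pose F x := x ^+ k * gauss1 x.
have F0 (u : nat -> R) : (forall n, `|u n| = n%:R) -> F (u n) @[n --> \oo] --> (0 : R).
  move=> un; apply/norm_cvg0P.
  have B : k`!%:R * expR 2 * expR (- n%:R) @[n --> \oo] --> (0 : R).
    by rewrite -[X in _ --> X](mulr0 (k`!%:R * expR 2)); apply: cvgMr; exact: cvgn_expR.
  apply: (squeeze_cvgr _ (cvg_cst 0) B); apply: nearW => n.
  by have := mono_gauss1_tail k (u n); rewrite un normr_ge0.
have H : \int[leb]_x f x = 0.
  apply: (@integral_derivative_eq0 f F).
  - move=> x; rewrite /f; apply: cvgB; first apply: cvgM; first exact: cvg_cst.
      apply: cvgM; first exact: exprn_continuous.
      apply: continuous_comp; last exact: continuous_expR.
      by apply: cvgN; apply: cvgM; [exact: exprn_continuous|exact: cvg_cst].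
    apply: cvgM; first exact: exprn_continuous.
    apply: continuous_comp; last exact: continuous_expR.
    by apply: cvgN; apply: cvgM; [exact: exprn_continuous|exact: cvg_cst].
  - have := integrableB measurableT (integrableZl measurableT k%:R (gauss1_mono_integrable k.-1)) (gauss1_mono_integrable k.+1).
    by apply: eq_integrable => // x _.
  - move=> x.
    have d1 : is_derive x 1 (fun y : R => y ^+ k) (k%:R * x ^+ k.-1).
      have := @is_deriveX R R id k x 1 1 (is_derive_id x 1).
      by rewrite exprfctE/= /GRing.scale/= mulr1.
    have d2 : is_derive x 1 (fun y : R => - (y ^+ 2 / 2)) (- x).
      have -> : (fun y : R => - (y ^+ 2 / 2)) = (fun y => (- 2^-1 * y) * y).
        by apply/funext => y; field.
      apply: is_derive_eq.
      by rewrite /GRing.scale/=; field.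
    have dF := is_derive_mul d1 (is_derive_comp1 (is_derive_expR _) d2).
    apply: (is_derive_eq (f:=F) dF).
    by rewrite /f [x ^+ k.+1]exprS /gauss1; ring.
  - exact: F0 (fun n => normr_nat _ n).
  - by apply: F0 => n; rewrite normrN normr_nat.
move: H; rewrite /f RintegralB//; last 2 first.
- have := integrableZl measurableT k%:R (gauss1_mono_integrable k.-1).
  by apply: eq_integrable.
- exact: gauss1_mono_integrable.
by rewrite RintegralZl//; [move=> /eqP;
  rewrite subr_eq0 => /eqP|exact: gauss1_mono_integrable].
Qed.

End GaussianLine.

(** * Integrals of products of functions of one coordinate *)

Section TupleProducts.
Variable R : realType.
Local Notation leb := (@lebesgue_measure R).
Local Notation RT := (measurableTypeR R).

Lemma measurable_tuple_prod n (g : 'I_n -> R -> R) :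
  (forall i, measurable_fun setT (g i)) ->
  measurable_fun setT (fun p : n.-tuple RT => \prod_(i < n) g i (tnth p i)).
Proof.
move=> mg; apply: measurable_prod => i _.
exact: (measurableT_comp (mg i) (measurable_tnth i)).
Qed.

(** Induction on the number of coordinates, with Fubini's theorem for the first
    one. *)
Lemma tuple_prod_integral n (g : 'I_n -> R -> R) :
  (forall i, leb.-integrable setT (EFin \o g i)) ->
  (lebesgue_tuple R n).-integrable setT
    (fun p => (\prod_(i < n) g i (tnth p i))%:E) /\
  \int[lebesgue_tuple R n]_p (\prod_(i < n) g i (tnth p i)) =
  \prod_(i < n) \int[leb]_x g i x.
Proof.
elim: n g => [|n IH] g ig.
  split.
    apply: (eq_integrable _ (cst 1%:E)) => //=.
      by move=> p _; rewrite big_ord0.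
    by apply/finite_measure_integrable_cst.
  rewrite big_ord0; under eq_Rintegral do rewrite big_ord0.
  by rewrite /= Rintegral_cst//= indicT mulr1.
have mg i : measurable_fun setT (g i).
  by apply/measurable_EFinP; exact: measurable_int (ig i).
have [iI eI] := IH (fun i => g (lift ord0 i)) (fun i => ig (lift ord0 i)).
pose h (p : n.-tuple RT) := \prod_(i < n) g (lift ord0 i) (tnth p i).
have hE (z : RT * n.-tuple RT) :
    \prod_(i < n.+1) g i (tnth (cons_pair z) i) = g ord0 z.1 * h z.2.
  rewrite big_ord_recl /h; congr (_ * _); apply: eq_bigr => i _.
  by rewrite tnthS.
have mh : measurable_fun setT h.
  by apply/measurable_EFinP; exact: measurable_int iI.
pose f (z : RT * n.-tuple RT) := (g ord0 z.1 * h z.2)%:E.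
have mf : measurable_fun setT f.
  apply/measurable_EFinP; apply: measurable_funM.
    exact: (measurableT_comp (mg ord0) measurable_fst).
  exact: (measurableT_comp mh measurable_snd).
have intf : (leb \x lebesgue_tuple R n)%E.-integrable setT f.
  apply/integrable12ltyP => //.
  have -> : (fun x => \int[lebesgue_tuple R n]_y `|f (x, y)|)%E =
      (fun x => `|(g ord0 x)%:E| * \int[lebesgue_tuple R n]_y `|(h y)%:E|)%E.
    apply/funext => x; rewrite -ge0_integralZl//=.
      by apply: eq_integral => y _; rewrite /f/= normrM EFinM.
    by apply/measurable_EFinP; exact: measurableT_comp.
  have [_ h1] := integrableP _ _ _ iI.
  have [_ g1] := integrableP _ _ _ (ig ord0).
  rewrite ge0_integralZr//=.
  - by rewrite lte_mul_pinfty// ?integral_ge0// ge0_fin_numE// integral_ge0.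
  - by apply/measurable_EFinP;
    exact: (measurableT_comp (@normr_measurable R setT) (mg ord0)).
  - exact: integral_ge0.
have mG : measurable_fun setT (fun p :
  n.+1.-tuple RT => (\prod_(i < n.+1) g i (tnth p i))%:E).
  by apply/measurable_EFinP; exact: measurable_tuple_prod.
have fE : (fun p : n.+1.-tuple RT => (\prod_(i < n.+1) g i (tnth p i))%:E) \o @cons_pair R n = f.
  by apply/funext => z /=; rewrite hE.
split.
  apply: (@integrable_pushforward _ _ _ _ R _ (@measurable_cons_pair R n)) => //.
  by rewrite preimage_setT fE.
rewrite /Rintegral (@integral_pushforward _ _ _ _ R _ (@measurable_cons_pair R n))//;
  last first.
  by rewrite preimage_setT fE.
rewrite preimage_setT fE -integral12_prod_meas1//.
rewrite big_ord_recl -eI.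
have hfin := integrable_fin_num measurableT iI.
rewrite /fubini_F /Rintegral -fineM ?(integrable_fin_num measurableT (ig ord0))//.
rewrite -(fineK hfin) -integralZr//; last exact: ig.
apply: (congr1 fine); apply: eq_integral => x _.
by rewrite fineK// -integralZl.
Qed.

End TupleProducts.

(** * Gaussian integrals of real functions *)

Section GaussianSpace.
Variables (R : realType) (m : nat).
Local Notation RT := (measurableTypeR R).
Local Notation mu := (lebesgue_tuple R m).
Local Notation rw := (@row_of_tuple R m).
Implicit Types (phi psi : 'rV[R]_m -> R) (x : 'rV[R]_m).

Definition gweight x : R := expR (- (enorm x ^+ 2 / 2)).

(** Functions live on row vectors, while the measure lives on tuples. *)
Definition vmeasurable phi := measurable_fun setT (fun p : m.-tuple RT => phi (rw p)).

Definition gauss_integrable phi : Prop :=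
  mu.-integrable setT (fun p => (gweight (rw p) * phi (rw p))%:E).

Definition gauss_int phi : R := \int[mu]_p (gweight (rw p) * phi (rw p)).

Lemma enorm_sqr x : enorm x ^+ 2 = \sum_(j < m) x 0 j ^+ 2.
Proof.
rewrite /enorm sqr_sqrtr /edot; first by apply: eq_bigr => j _; rewrite expr2.
by apply: sumr_ge0 => j _; rewrite -expr2 sqr_ge0.
Qed.

Lemma gweight_prod (p : m.-tuple RT) : gweight (rw p) = \prod_(j < m) gauss1 (tnth p j).
Proof.
rewrite /gweight enorm_sqr mulr_suml -sumrN expR_sum.
by apply: eq_bigr => j _; rewrite mxE.
Qed.

Lemma gweight_gt0 x : 0 < gweight x. Proof. exact: expR_gt0. Qed.

Lemma vmeasurable_gweight : vmeasurable gweight.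
Proof.
rewrite /vmeasurable (funext gweight_prod).
by apply: (@measurable_tuple_prod R m (fun=> @gauss1 R)) => i; exact: measurable_gauss1.
Qed.

Lemma vmeasurable_coord j : vmeasurable (fun x => x 0 j).
Proof.
rewrite /vmeasurable (_ : (fun p => _) = (fun p => tnth p j));
  first exact: measurable_tnth.
by apply/funext => p; rewrite mxE.
Qed.

Lemma vmeasurable_cst c : vmeasurable (fun=> c).
Proof. exact: measurable_cst. Qed.

Lemma vmeasurableD phi psi : vmeasurable phi -> vmeasurable psi ->
  vmeasurable (fun x => phi x + psi x).
Proof. by move=> ? ?; exact: measurable_funD. Qed.

Lemma vmeasurableM phi psi : vmeasurable phi -> vmeasurable psi ->
  vmeasurable (fun x => phi x * psi x).
Proof. by move=> ? ?; exact: measurable_funM. Qed.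

Lemma vmeasurable_sum I (r : seq I) (P : pred I) (F : I -> 'rV[R]_m -> R) :
  (forall i, vmeasurable (F i)) -> vmeasurable (fun x => \sum_(i <- r | P i) F i x).
Proof.
move=> mF; elim: r => [|i r IH].
  by under [X in vmeasurable X]eq_fun do rewrite big_nil; exact: vmeasurable_cst.
under [X in vmeasurable X]eq_fun do rewrite big_cons.
by case: (P i) => //; exact: vmeasurableD (mF i) IH.
Qed.

Lemma vmeasurable_comp (h : R -> R) phi : measurable_fun setT h -> vmeasurable phi ->
  vmeasurable (fun x => h (phi x)).
Proof. by move=> mh mphi; exact: (measurableT_comp mh mphi). Qed.

Lemma vmeasurable_exp_enorm (c : R) : vmeasurable (fun x => expR (enorm x ^+ 2 * c)).
Proof.
apply: (@vmeasurable_comp expR (fun x => enorm x ^+ 2 * c)) => //.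
under [X in vmeasurable X]eq_fun do rewrite enorm_sqr mulr_suml.
apply: (@vmeasurable_sum _ _ _ (fun j x => x 0 j ^+ 2 * c)) => i;
  refine (vmeasurableM _ (vmeasurable_cst _)).
by under [X in vmeasurable X]eq_fun do rewrite expr2;
  exact: (vmeasurableM (vmeasurable_coord i) (vmeasurable_coord i)).
Qed.

Lemma gauss_integrable_le phi psi : vmeasurable phi -> (forall x, `|phi x| <= psi x) ->
  gauss_integrable psi -> gauss_integrable phi.
Proof.
move=> mphi le; apply: le_integrable => //.
  by apply/measurable_EFinP; exact: (vmeasurableM vmeasurable_gweight mphi).
move=> p _ /=; rewrite lee_fin !normrM ler_wpM2l//.
exact: le_trans (le _) (ler_norm _).
Qed.

Lemma gauss_integrableD phi psi : gauss_integrable phi -> gauss_integrable psi ->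
  gauss_integrable (fun x => phi x + psi x).
Proof.
move=> ip iq; have := integrableD measurableT ip iq.
by apply: eq_integrable => // p _; rewrite mulrDr EFinD.
Qed.

Lemma gauss_integrableZ c phi : gauss_integrable phi ->
  gauss_integrable (fun x => c * phi x).
Proof.
move=> ip; have := integrableZl measurableT c ip.
by apply: eq_integrable => // p _; rewrite mulrCA EFinM.
Qed.

Lemma gauss_integrable0 : gauss_integrable (fun=> 0).
Proof.
rewrite /gauss_integrable; under eq_fun do rewrite mulr0.
exact: integrable0.
Qed.

Lemma gauss_integrable_sum I (r : seq I) (P : pred I) (F : I -> 'rV[R]_m -> R) :
  (forall i, gauss_integrable (F i)) ->
    gauss_integrable (fun x => \sum_(i <- r | P i) F i x).
Proof.
move=> iF; elim: r => [|i r IH].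
  by under [X in gauss_integrable X]eq_fun do rewrite big_nil; exact: gauss_integrable0.
under [X in gauss_integrable X]eq_fun do rewrite big_cons.
by case: (P i) => //; exact: gauss_integrableD (iF i) IH.
Qed.

Lemma gauss_intD phi psi : gauss_integrable phi -> gauss_integrable psi ->
  gauss_int (fun x => phi x + psi x) = gauss_int phi + gauss_int psi.
Proof.
move=> ip iq; rewrite /gauss_int -RintegralD//.
by under eq_Rintegral do rewrite mulrDr.
Qed.

Lemma gauss_intZ c phi : gauss_integrable phi ->
  gauss_int (fun x => c * phi x) = c * gauss_int phi.
Proof.
move=> ip; rewrite /gauss_int -RintegralZl//.
by under eq_Rintegral do rewrite mulrCA.
Qed.

Lemma gauss_int0 : gauss_int (fun=> 0) = 0.
Proof. by rewrite /gauss_int; under eq_Rintegral do rewrite mulr0;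
  rewrite /Rintegral integral0. Qed.

Lemma gauss_int_sum I (r : seq I) (P : pred I) (F : I -> 'rV[R]_m -> R) :
  (forall i, gauss_integrable (F i)) ->
  gauss_int (fun x => \sum_(i <- r | P i) F i x) = \sum_(i <- r | P i) gauss_int (F i).
Proof.
move=> iF; elim: r => [|i r IH].
  by under [X in gauss_int X]eq_fun do rewrite big_nil; rewrite big_nil gauss_int0.
under [X in gauss_int X]eq_fun do rewrite big_cons.
rewrite big_cons; case: (P i) => //; rewrite gauss_intD ?IH//.
exact: gauss_integrable_sum.
Qed.

Lemma gauss_int_ge0 phi : (forall x, 0 <= phi x) -> 0 <= gauss_int phi.
Proof. by move=> p0; apply: Rintegral_ge0 => p _;
  rewrite mulr_ge0// ltW// gweight_gt0. Qed.

Lemma le_gauss_int phi psi : gauss_integrable phi -> gauss_integrable psi ->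
  (forall x, phi x <= psi x) -> gauss_int phi <= gauss_int psi.
Proof.
move=> ip iq le; apply: le_Rintegral => // p _.
by rewrite ler_wpM2l// ltW// gweight_gt0.
Qed.

Lemma norm_gauss_int_le phi psi : vmeasurable phi -> (forall x, `|phi x| <= psi x) ->
  gauss_integrable psi -> `|gauss_int phi| <= gauss_int psi.
Proof.
move=> mphi le ip; have iq := gauss_integrable_le mphi le ip.
apply: le_trans (le_normr_Rintegral _ iq) _ => //.
apply: le_Rintegral => //; first exact: integrable_norm.
by move=> p _; rewrite normrM (ger0_norm (ltW (gweight_gt0 _))) ler_wpM2l// ltW// gweight_gt0.
Qed.

Definition l1norm x : R := \sum_(j < m) `|x 0 j|.

Lemma vmeasurable_l1norm : vmeasurable l1norm.
Proof.
apply: vmeasurable_sum => j; apply: vmeasurable_comp (vmeasurable_coord j).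
exact: normr_measurable.
Qed.

(** Every function of exponential growth has a Gaussian integral: all the
    dominations below are of this form. *)
Lemma gauss_integrable_exp c : gauss_integrable (fun x => expR (c * l1norm x)).
Proof.
have [] := @tuple_prod_integral R m (fun _ y => expR (c * `|y|) * gauss1 y).
  by move=> i; exact: gauss1_exp_integrable.
move=> + _; apply: eq_integrable => // p _.
rewrite gweight_prod mulr_sumr expR_sum -big_split/=; congr (_%:E).
by apply: eq_bigr => j _; rewrite mxE mulrC.
Qed.

Lemma gauss_int_mono (k : 'I_m -> nat) :
  gauss_integrable (fun x => \prod_(j < m) x 0 j ^+ k j) /\
  gauss_int (fun x => \prod_(j < m) x 0 j ^+ k j) = \prod_(j < m) gauss_moment R (k j).
Proof.
have [] := @tuple_prod_integral R m (fun j y => y ^+ k j * gauss1 y).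
  by move=> i; exact: gauss1_mono_integrable.
have E (p : m.-tuple RT) : \prod_(j < m) (tnth p j ^+ k j * gauss1 (tnth p j)) =
    gweight (rw p) * \prod_(j < m) rw p 0 j ^+ k j.
  rewrite gweight_prod -big_split/=.
  by apply: eq_bigr => j _; rewrite mxE mulrC.
move=> iP eP; split.
  by move: iP; apply: eq_integrable => // p _; rewrite E.
by rewrite -eP; apply: eq_Rintegral => p _; rewrite E.
Qed.

Definition gauss_L2 phi := vmeasurable phi /\ gauss_integrable (fun x => phi x ^+ 2).

(** |a b| <= a^2 + b^2. *)
Lemma gauss_L2M phi psi : gauss_L2 phi -> gauss_L2 psi ->
  gauss_integrable (fun x => phi x * psi x).
Proof.
move=> [mp ip] [mq iq].
apply: gauss_integrable_le (gauss_integrableD ip iq); first exact: (vmeasurableM mp mq).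
move=> x; rewrite normrM -(real_normK (num_real (phi x))) -(real_normK (num_real (psi x))).
have := sqr_ge0 (`|phi x| - `|psi x|).
have : 0 <= `|phi x| * `|psi x| by rewrite mulr_ge0.
set a := `|_|; set b := `|_|; nra.
Qed.

Lemma gauss_L2D phi psi : gauss_L2 phi -> gauss_L2 psi ->
  gauss_L2 (fun x => phi x + psi x).
Proof.
move=> p2 q2; split; first exact: vmeasurableD p2.1 q2.1.
under [X in gauss_integrable X]eq_fun do rewrite sqrrD -mulr_natl.
apply: gauss_integrableD q2.2; apply: gauss_integrableD p2.2 _.
exact/gauss_integrableZ/gauss_L2M.
Qed.

Lemma gauss_L2Z c phi : gauss_L2 phi -> gauss_L2 (fun x => c * phi x).
Proof.
move=> p2; split; first exact: (vmeasurableM (vmeasurable_cst c) p2.1).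
under [X in gauss_integrable X]eq_fun do rewrite exprMn.
exact: gauss_integrableZ p2.2.
Qed.

Lemma gauss_L2_sum I (r : seq I) (F : I -> 'rV[R]_m -> R) :
  (forall i, gauss_L2 (F i)) -> gauss_L2 (fun x => \sum_(i <- r) F i x).
Proof.
move=> iF; elim: r => [|i r IH].
  under [X in gauss_L2 X]eq_fun do rewrite big_nil; split; first exact: vmeasurable_cst.
  under [X in gauss_integrable X]eq_fun do rewrite expr0n/=.
  exact: gauss_integrable0.
by under [X in gauss_L2 X]eq_fun do rewrite big_cons; exact: gauss_L2D (iF i) IH.
Qed.

Lemma gauss_L2_exp c : gauss_L2 (fun x => expR (c * l1norm x)).
Proof.
split.
  apply: vmeasurable_comp => //;
    exact: (vmeasurableM (vmeasurable_cst c) vmeasurable_l1norm).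
under [X in gauss_integrable X]eq_fun do rewrite expr2 -expRD -mulrDl.
exact: gauss_integrable_exp.
Qed.

Lemma gauss_L2_le phi psi : vmeasurable phi -> (forall x, `|phi x| <= psi x) ->
  gauss_L2 psi -> gauss_L2 phi.
Proof.
move=> mp le [mq iq]; split=> //.
apply: gauss_integrable_le iq;
  first by under [X in vmeasurable X]eq_fun do rewrite expr2; exact: (vmeasurableM mp mp).
by move=> x; rewrite normrX lerXn2r// nnegrE// (le_trans _ (le x)).
Qed.

(** Fatou's lemma for the squares: an L2 bound along a sequence passes to its
    pointwise limit, which thereby is in L2. *)
Lemma gauss_L2_fatou (F : nat -> 'rV[R]_m -> R) phi (C : R) :
  (forall n, gauss_L2 (F n)) -> (forall x, F n x @[n --> \oo] --> phi x) ->
  (forall n, gauss_int (fun x => F n x ^+ 2) <= C) ->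
  gauss_L2 phi /\ gauss_int (fun x => phi x ^+ 2) <= C.
Proof.
move=> F2 Fphi FC.
pose G n (p : m.-tuple RT) := (gweight (rw p) * F n (rw p) ^+ 2)%:E.
have mG n : measurable_fun setT (G n) by exact: measurable_int (F2 n).2.
have G0 n p : (0 <= G n p)%E by rewrite lee_fin mulr_ge0 ?sqr_ge0// ltW// gweight_gt0.
have := @fatou _ _ _ mu setT measurableT G mG (fun n p _ => G0 n p).
have Gphi p : G n p @[n --> \oo] --> (gweight (rw p) * phi (rw p) ^+ 2)%:E.
  apply: cvg_EFin; first exact: nearW.
  by apply: cvgMr; under eq_fun do rewrite /= expr2; rewrite expr2; apply: cvgM.
under eq_integral => p _ do rewrite (cvg_limn_einf_sup (Gphi p)).1.
move=> H.
have iG n : (\int[mu]_x G n x <= C%:E)%E.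
  rewrite -(fineK (integrable_fin_num measurableT (F2 n).2)) lee_fin.
  exact: FC.
have {}H : (\int[mu]_x (gweight (rw x) * phi (rw x) ^+ 2)%:E <= C%:E)%E.
  apply: le_trans H _; rewrite limn_einf_lim; apply: lime_le; first exact: is_cvg_einfs.
  apply: nearW => n; apply: le_trans (iG n).
  by apply: ereal_inf_lbound; exists n => /=.
have mphi : vmeasurable phi.
  apply: (measurable_fun_cvg (h := fun n p => F n (rw p))) => [n|p _];
    [exact: (F2 n).1|exact: Fphi].
have ip : gauss_integrable (fun x => phi x ^+ 2).
  apply/integrableP; split.
    have mphi2 : vmeasurable (fun x => phi x ^+ 2).
      by under [X in vmeasurable X]eq_fun do rewrite expr2;
        exact: (vmeasurableM mphi mphi).
    by apply/measurable_EFinP; exact: (vmeasurableM vmeasurable_gweight mphi2).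
  rewrite (eq_integral (fun p => (gweight (rw p) * phi (rw p) ^+ 2)%:E)); last first.
    by move=> p _; rewrite gee0_abs// lee_fin mulr_ge0 ?sqr_ge0// ltW// gweight_gt0.
  by apply: le_lt_trans H _; rewrite ltry.
split=> //.
by rewrite -lee_fin /gauss_int /Rintegral fineK// integrable_fin_num.
Qed.

(** Where phi is nonzero, continuity makes it nonzero on a box, and boxes have
    positive measure. *)
Lemma gauss_int_sqr_eq0 phi : gauss_L2 phi -> gauss_int (fun x => phi x ^+ 2) = 0 ->
  continuous phi -> forall x, phi x = 0.
Proof.
move=> [mphi ip] i0 cphi x0; apply/eqP; apply/negP => /negP px0.
have : (\int[mu]_p `|(gweight (rw p) * phi (rw p) ^+ 2)%:E| = 0)%E.
  rewrite (eq_integral (fun p => (gweight (rw p) * phi (rw p) ^+ 2)%:E)); last first.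
    by move=> p _; rewrite gee0_abs// lee_fin mulr_ge0 ?sqr_ge0// ltW// gweight_gt0.
  rewrite -(fineK (integrable_fin_num measurableT ip)).
  by congr EFin.
move=> /(ae_eq_integral_abs mu measurableT (measurable_int _ ip)) [N [mN N0 sN]].
have /nbhs_ballP [e /= e0 be] : \forall y \near x0, phi y != 0.
  have := cphi x0; move/cvgr_neq0; exact.
pose A (i : 'I_m) : set R := ball (x0 0 i) e.
have mA i : measurable (A i) by exact: measurable_ball.
have := lebesgue_tuple_box mA.
set B := [set _ | _] => muB.
have : (mu B <= mu N)%E.
  apply: le_measure; rewrite ?inE//; first exact: measurable_box mA.
  move=> p Bp; apply: sN => /= /(_ I) /eqP.
  rewrite eqe mulf_eq0 expf_eq0/= gt_eqF ?gweight_gt0//=; apply/negP/be.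
  by split=> // i j; rewrite ord1 mxE; exact: Bp.
rewrite N0 muB.
under eq_bigr => i _ do rewrite lebesgue_measure_ball ?(ltW e0)//.
rewrite leNgt (_ : (0 < _)%E)//; elim/big_ind: _ => //.
  by move=> a b; exact: mule_gt0.
by move=> i _; rewrite lte_fin mulrn_wgt0.
Qed.

End GaussianSpace.

(** * The complex exponential *)

Section Complex.
Variable R : realType.
Local Notation C := R[i].
Local Notation Re := (@complex.Re R).
Local Notation Im := (@complex.Im R).
Implicit Types (z w : C) (r x h : R).

(** The modulus as a real number; the canonical norm of R[i] takes values in
    R[i]. *)
Definition cnorm z : R := Normc.normc z.

Lemma cReD z w : Re (z + w) = Re z + Re w. Proof. by case: z w => [a b] [c d]. Qed.
Lemma cImD z w : Im (z + w) = Im z + Im w. Proof. by case: z w => [a b] [c d]. Qed.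
Lemma cReN z : Re (- z) = - Re z. Proof. by case: z. Qed.
Lemma cImN z : Im (- z) = - Im z. Proof. by case: z. Qed.
Lemma cReM z w : Re (z * w) = Re z * Re w - Im z * Im w.
Proof. by case: z w => [a b] [c d]. Qed.
Lemma cImM z w : Im (z * w) = Re z * Im w + Im z * Re w.
Proof. by case: z w => [a b] [c d]. Qed.

(** The definitions of vectors and of [cl_dagger] use both conjugations of R[i]. *)
Lemma conjcE z : (z^*)%R = z^*%C. Proof. by []. Qed.
Lemma cJM z w : (z * w)^*%C = z^*%C * w^*%C. Proof. exact: rmorphM. Qed.
Lemma cJD z w : (z + w)^*%C = z^*%C + w^*%C. Proof. exact: rmorphD. Qed.
Lemma cJX z n : (z ^+ n)^*%C = z^*%C ^+ n. Proof. exact: rmorphXn. Qed.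

Lemma cJ_sum I (r : seq I) (P : pred I) (F : I -> C) :
  (\sum_(i <- r | P i) F i)^*%C = \sum_(i <- r | P i) (F i)^*%C.
Proof. exact: (big_morph (@conjc R) cJD (conjc0 R)). Qed.

Lemma complex_ext z w : Re z = Re w -> Im z = Im w -> z = w.
Proof. by case: z w => [a b] [c d] /= -> ->. Qed.

Lemma cnorm_ge0 z : 0 <= cnorm z.
Proof. by case: z => a b; rewrite sqrtr_ge0. Qed.

Lemma cnormM z w : cnorm (z * w) = cnorm z * cnorm w. Proof. exact: Normc.normcM. Qed.
Lemma cnormD z w : cnorm (z + w) <= cnorm z + cnorm w. Proof. exact: le_normcD. Qed.
Lemma cnorm0 : cnorm 0 = 0. Proof. exact: Normc.normc0. Qed.
Lemma cnorm1 : cnorm 1 = 1. Proof. exact: Normc.normc1. Qed.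
Lemma cnormN z : cnorm (- z) = cnorm z.
Proof. by case: z => a b; rewrite /cnorm/= !sqrrN. Qed.
Lemma cnormX z n : cnorm (z ^+ n) = cnorm z ^+ n.
Proof. by elim: n => [|n IH]; rewrite ?expr0 ?cnorm1// !exprS cnormM IH. Qed.
Lemma cnorm_real r : cnorm r%:C = `|r|.
Proof. by rewrite /cnorm/= expr0n addr0 sqrtr_sqr. Qed.
Lemma cnormJ z : cnorm z^*%C = cnorm z.
Proof. by case: z => a b; rewrite /cnorm/= sqrrN. Qed.

Lemma Re_le_cnorm z : `|Re z| <= cnorm z.
Proof.
case: z => a b /=; rewrite -sqrtr_sqr ler_sqrt ?lerDl ?sqr_ge0//.
by rewrite addr_ge0 ?sqr_ge0.
Qed.

Lemma Im_le_cnorm z : `|Im z| <= cnorm z.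
Proof.
case: z => a b /=; rewrite -sqrtr_sqr ler_sqrt ?lerDr ?sqr_ge0//.
by rewrite addr_ge0 ?sqr_ge0.
Qed.

Lemma cnorm_le z : cnorm z <= `|Re z| + `|Im z|.
Proof.
case: z => a b /=.
rewrite -(@ger0_norm _ (`|a| + `|b|)) ?addr_ge0// -sqrtr_sqr ler_sqrt ?sqr_ge0//.
have := real_normK (num_real a); have := real_normK (num_real b).
have : 0 <= `|a| * `|b| by rewrite mulr_ge0.
by nra.
Qed.

Lemma cexpD z w : cexp (z + w) = cexp z * cexp w.
Proof.
case: z w => [a b] [c d]; rewrite /cexp /= expRD cosD sinD.
by apply: complex_ext; rewrite !(cReM, cImM)/=; ring.
Qed.

Lemma cexp0 : cexp 0 = 1 :> C.
Proof.
rewrite /cexp /= expR0 cos0 sin0.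
by apply: complex_ext; rewrite !(cReM, cImM)/=; ring.
Qed.

Lemma cnorm_cexp z : cnorm (cexp z) = expR (Re z).
Proof.
rewrite /cexp cnormM cnorm_real ger0_norm ?expR_ge0//.
by rewrite /cnorm /= cos2Dsin2 sqrtr1 mulr1.
Qed.

Lemma cnorm_cexp_le z : cnorm (cexp z) <= expR (cnorm z).
Proof. by rewrite cnorm_cexp ler_expR (le_trans (ler_norm _))// Re_le_cnorm. Qed.

Definition is_cderive (F : R -> C) r z : Prop :=
  is_derive r 1 (Re \o F) (Re z) /\ is_derive r 1 (Im \o F) (Im z).

Lemma is_cderive_cst w r : is_cderive (fun=> w) r 0.
Proof. by split; exact: is_derive_cst. Qed.

Lemma is_cderive_eq F r z w : is_cderive F r z -> z = w -> is_cderive F r w.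
Proof. by move=> ? <-. Qed.

Lemma is_cderiveM F G r z w : is_cderive F r z -> is_cderive G r w ->
  is_cderive (fun x => F x * G x) r (z * G r + F r * w).
Proof.
move=> [F1 F2] [G1 G2]; split.
  rewrite (_ : Re \o _ = fun x => Re (F x) * Re (G x) - Im (F x) * Im (G x)); last first.
    by apply/funext => x /=; rewrite cReM.
  apply: (is_derive_eq (is_derive_sub (is_derive_mul F1 G1) (is_derive_mul F2 G2))).
  by rewrite cReD !cReM /=; ring.
rewrite (_ : Im \o _ = fun x => Re (F x) * Im (G x) + Im (F x) * Re (G x)); last first.
  by apply/funext => x /=; rewrite cImM.
apply: (is_derive_eq (is_derive_add (is_derive_mul F1 G2) (is_derive_mul F2 G1))).
by rewrite cImD !cImM /=; ring.
Qed.

Lemma is_cderiveD F G r z w : is_cderive F r z -> is_cderive G r w ->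
  is_cderive (fun x => F x + G x) r (z + w).
Proof.
move=> [F1 F2] [G1 G2]; split.
  rewrite (_ : Re \o _ = fun x => Re (F x) + Re (G x)) ?cReD;
    first exact: is_derive_add F1 G1.
  by apply/funext => x /=; rewrite cReD.
rewrite (_ : Im \o _ = fun x => Im (F x) + Im (G x)) ?cImD;
  first exact: is_derive_add F2 G2.
by apply/funext => x /=; rewrite cImD.
Qed.

Lemma is_cderiveX F r z n : is_cderive F r z ->
  is_cderive (fun x => F x ^+ n) r (n%:R * F r ^+ n.-1 * z).
Proof.
move=> dF; elim: n => [|n IH].
  by rewrite !mul0r; exact: is_cderive_cst.
rewrite (_ : (fun x => _) = fun x => F x * F x ^+ n); last first.
  by apply/funext => x; rewrite exprS.
apply: is_cderive_eq (is_cderiveM dF IH) _.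
case: n {IH} => [|n] /=; first by ring.
by rewrite -[n.+2]addn1 natrD exprS; ring.
Qed.

Lemma is_cderive_sum n (F : 'I_n -> R -> C) r (z : 'I_n -> C) :
  (forall i, is_cderive (F i) r (z i)) ->
  is_cderive (fun x => \sum_(i < n) F i x) r (\sum_(i < n) z i).
Proof.
elim: n F z => [|n IH] F z dF.
  rewrite big_ord0 (_ : (fun x => _) = fun=> 0); first exact: is_cderive_cst.
  by apply/funext => x; rewrite big_ord0.
rewrite big_ord_recr (_ : (fun x => _) =
    fun x => \sum_(i < n) F (widen_ord (leqnSn n) i) x + F ord_max x).
  by apply: is_cderiveD => //; exact: IH.
by apply/funext => x; rewrite big_ord_recr.
Qed.

Lemma is_cderive_line z r : is_cderive (fun x => x%:C * z) r z.
Proof.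
split.
  rewrite (_ : Re \o _ = fun x => x * Re z); last by apply/funext => x /=;
    rewrite cReM/= mul0r subr0.
  apply: (is_derive_eq (is_derive_mul (is_derive_id r 1) (is_derive_cst (Re z) r 1))).
  by rewrite mul1r mulr0 addr0.
rewrite (_ : Im \o _ = fun x => x * Im z); last by apply/funext => x /=;
  rewrite cImM/= mul0r addr0.
apply: (is_derive_eq (is_derive_mul (is_derive_id r 1) (is_derive_cst (Im z) r 1))).
by rewrite mul1r mulr0 addr0.
Qed.

Lemma is_cderive_cexp F r z : is_cderive F r z ->
  is_cderive (fun x => cexp (F x)) r (z * cexp (F r)).
Proof.
move=> [F1 F2].
have e := is_derive_comp1 (is_derive_expR (Re (F r))) F1.
have c := is_derive_comp1 (is_derive_cos (Im (F r))) F2.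
have s := is_derive_comp1 (is_derive_sin (Im (F r))) F2.
split.
  rewrite (_ : Re \o _ = fun x => expR (Re (F x)) * cos (Im (F x))); last first.
    by apply/funext => x /=; rewrite /cexp /= mul0r subr0.
  apply: (is_derive_eq (is_derive_mul e c)).
  by rewrite /cexp !(cReM, cImM)/=; ring.
rewrite (_ : Im \o _ = fun x => expR (Re (F x)) * sin (Im (F x))); last first.
  by apply/funext => x /=; rewrite /cexp /= mul0r addr0.
apply: (is_derive_eq (is_derive_mul e s)).
by rewrite /cexp !(cReM, cImM)/=; ring.
Qed.

(** Mean value inequality between 0 and b, whatever the sign of b. *)
Lemma mvt_bound (g g' : R -> R) (M b : R) :
  (forall h, `|h| <= `|b| -> is_derive h 1 g (g' h)) ->
  (forall h, `|h| <= `|b| -> `|g' h| <= M) -> `|g b - g 0| <= M * `|b|.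
Proof.
move=> dg gM.
have mvt a c : a <= c -> `|a| <= `|b| -> `|c| <= `|b| -> `|g c - g a| <= M * (c - a).
  rewrite [`|a| <= _]ler_norml [`|c| <= _]ler_norml => ac /andP[a1 a2] /andP[c1 c2].
  have inb h : h \in `[a, c] -> `|h| <= `|b|.
    by rewrite in_itv/= => /andP[ah hc]; rewrite ler_norml (le_trans a1)// (le_trans hc).
  have d1 h : h \in `]a, c[ -> is_derive h 1 g (g' h).
    by move=> hac; apply/dg/inb; exact: subset_itv_oo_cc hac.
  have d2 : {within `[a, c], continuous g}.
    by apply: derivable_within_continuous => y /inb yb; have [] := dg _ yb.
  have [h hac ->] := MVT_segment ac d1 d2.
  rewrite normrM [`|c - a|]ger0_norm ?subr_ge0// ler_wpM2r ?subr_ge0//.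
  exact/gM/inb.
have [b0|b0] := leP 0 b.
  by have := mvt 0 b b0; rewrite subr0 normr0 normr_ge0 lexx [`|b|]ger0_norm//; exact.
have := mvt b 0 (ltW b0); rewrite sub0r distrC normr0 normr_ge0 lexx [`|b|]ltr0_norm//.
exact.
Qed.

(** The mean value theorem is applied to both components, hence the factor 2. *)
Lemma cmvt_bound (F F' : R -> C) M :
  (forall h, `|h| <= 1 -> is_cderive F h (F' h)) ->
  (forall h, `|h| <= 1 -> cnorm (F' h) <= M) -> cnorm (F 1 - F 0) <= 2 * M.
Proof.
move=> dF bF; apply: le_trans (cnorm_le _) _; rewrite mulr2n mulrDl mul1r lerD//.
  rewrite cReD cReN -[M]mulr1 -[X in _ * X](@normr1 R).
  apply: (@mvt_bound (Re \o F) (Re \o F')) => h; rewrite normr1 => h1;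
    first by have [] := dF h h1.
  by apply: le_trans (bF _ h1); exact: Re_le_cnorm.
rewrite cImD cImN -[M]mulr1 -[X in _ * X](@normr1 R).
apply: (@mvt_bound (Im \o F) (Im \o F')) => h; rewrite normr1 => h1;
  first by have [] := dF h h1.
by apply: le_trans (bF _ h1); exact: Im_le_cnorm.
Qed.

Definition expsum n z : C := \sum_(l < n) z ^+ l / l`!%:R.

(** The derivative of r |-> E_(n+1) (r z) exp (- r z) is
    - z (r z)^n / n! exp (- r z), because all other terms cancel.  The
    function itself is 1 at r = 0, and E_(n+1) (z) exp (- z) at r = 1. *)
Lemma expsum_bound n z :
  cnorm (expsum n.+1 z - cexp z) <= 2 * (cnorm z ^+ n.+1 / n`!%:R) * expR (2 * cnorm z).
Proof.
pose G r := expsum n.+1 (r%:C * z) * cexp (r%:C * - z).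
pose G' r := - (z * (r%:C * z) ^+ n / n`!%:R) * cexp (r%:C * - z).
have fact_neq0 k : (k`!%:R : C) != 0 by rewrite pnatr_eq0 -lt0n fact_gt0.
have dG h : is_cderive G h (G' h).
  apply: is_cderive_eq (is_cderiveM (is_cderive_sum (z := fun l : 'I_n.+1 =>
      l%:R * (h%:C * z) ^+ l.-1 * z * l`!%:R^-1) _) (is_cderive_cexp (is_cderive_line _ _))) _.
    move=> l; apply: is_cderive_eq (is_cderiveM (is_cderiveX l (is_cderive_line z h)) (is_cderive_cst _ _)) _.
    by rewrite mulr0 addr0.
  rewrite /G' mulrA -mulrDl; congr (_ * _).
  rewrite big_ord_recl !mul0r add0r.
  rewrite (eq_bigr (fun l : 'I_n => (h%:C * z) ^+ l / l`!%:R * z)); last first.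
    move=> l _; rewrite lift0 /= factS natrM.
    have := fact_neq0 l; have : (l.+1%:R : C) != 0 by rewrite pnatr_eq0.
    by move=> ? ?; field; apply/andP.
  rewrite -mulr_suml big_ord_recr /=; ring.
have bG h : `|h| <= 1 -> cnorm (G' h) <= cnorm z ^+ n.+1 / n`!%:R * expR (cnorm z).
  move=> h1; rewrite /G' cnormM cnormN exprMn; apply: ler_pM => //; try exact: cnorm_ge0.
    have fR : cnorm (n`!%:R^-1) = n`!%:R^-1.
      rewrite (_ : n`!%:R^-1 = (n`!%:R^-1 : R)%:C); last by rewrite fmorphV/= rmorph_nat.
      by rewrite cnorm_real ger0_norm.
    rewrite !cnormM !cnormX cnorm_real fR ler_wpM2r// exprS ler_wpM2l ?cnorm_ge0//.
    by rewrite ler_piMl ?exprn_ge0 ?cnorm_ge0// exprn_ile1.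
  apply: le_trans (cnorm_cexp_le _) _; rewrite ler_expR cnormM cnormN cnorm_real.
  by rewrite ler_piMl ?cnorm_ge0.
have := cmvt_bound (fun h _ => dG h) bG.
have e0 : expsum n.+1 0 = 1.
  rewrite /expsum big_ord_recl expr0 fact0 divr1 big1 ?addr0// => i _.
  by rewrite lift0 expr0n/= mul0r.
rewrite /G !mul0r !mul1r cexp0 mulr1 e0 => B.
have -> : expsum n.+1 z - cexp z = (expsum n.+1 z * cexp (- z) - 1) * cexp z.
  by rewrite mulrBl -mulrA -cexpD addNr cexp0 mulr1 mul1r.
rewrite cnormM; apply: le_trans (ler_pM (cnorm_ge0 _) (cnorm_ge0 _) B (cnorm_cexp_le z)) _.
have -> : 2 * cnorm z = cnorm z + cnorm z by ring.
by rewrite expRD !mulrA.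
Qed.

(** The factorial in the remainder is traded for a geometric factor by
    (2 |z|)^n / n! <= e^(2 |z|); the bound can then be integrated. *)
Lemma expsum_geom n z :
  cnorm (expsum n.+1 z - cexp z) <= 2 * 2^-1 ^+ n * expR (5 * cnorm z).
Proof.
apply: le_trans (expsum_bound _ _) _.
set a := cnorm z; have a0 : 0 <= a := cnorm_ge0 z.
have f0 : (0 : R) < n`!%:R by rewrite ltr0n fact_gt0.
have e1 : a <= expR a by have := expr_le_expR 1 a0; rewrite expr1 mul1r.
have e2 : a ^+ n / n`!%:R <= 2^-1 ^+ n * expR (2 * a).
  rewrite ler_pdivrMr// (_ : a ^+ n = 2^-1 ^+ n * (2 * a) ^+ n).
    rewrite -mulrA ler_wpM2l ?exprn_ge0// [leRHS]mulrC.
    by apply: expr_le_expR; rewrite mulr_ge0.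
  by rewrite -exprMn mulKf.
rewrite -mulrA -[leRHS]mulrA ler_wpM2l// exprS -mulrA -[leLHS]mulrA.
have -> : expR (5 * a) = expR a * expR (2 * a) * expR (2 * a).
  by rewrite -!expRD; congr expR; ring.
have -> : 2^-1 ^+ n * (expR a * expR (2 * a) * expR (2 * a)) =
  expR a * ((2^-1 ^+ n * expR (2 * a)) * expR (2 * a)) by ring.
apply: ler_pM => //.
  by rewrite !mulr_ge0 ?expR_ge0 ?exprn_ge0// invr_ge0 ltW.
by rewrite mulrA ler_wpM2r ?expR_ge0.
Qed.

Lemma cexp_taylor0 z : cnorm (cexp z - 1) <= 2 * cnorm z * expR (2 * cnorm z).
Proof.
have := expsum_bound 0 z; rewrite /expsum big_ord1 expr0 expr1 fact0 !divr1.
by rewrite -cnormN opprB.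
Qed.

Lemma cexp_taylor1 z : cnorm (cexp z - 1 - z) <= 2 * cnorm z ^+ 2 * expR (2 * cnorm z).
Proof.
have := expsum_bound 1 z; rewrite /expsum !big_ord_recl big_ord0 /= expr0 expr1 fact0 !divr1 addr0.
by rewrite -cnormN opprB opprD addrA.
Qed.

End Complex.

(** * Gaussian integrals of complex functions and Stein's identity *)

Section ComplexGaussian.
Variables (R : realType) (m : nat).
Local Notation C := R[i].
Local Notation Re := (@complex.Re R).
Local Notation Im := (@complex.Im R).
Implicit Types (phi psi : 'rV[R]_m -> C) (g : 'rV[R]_m -> R) (x : 'rV[R]_m) (c : C).

Definition cmeasurable phi := vmeasurable (fun x => Re (phi x)) /\ vmeasurable (fun x => Im (phi x)).
Definition cgauss_integrable phi :=
  gauss_integrable (fun x => Re (phi x)) /\ gauss_integrable (fun x => Im (phi x)).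
Definition cgauss_int phi : C :=
  gauss_int (fun x => Re (phi x)) +i* gauss_int (fun x => Im (phi x)).

Lemma eq_cgauss_int phi psi : phi =1 psi -> cgauss_int phi = cgauss_int psi.
Proof. by move=> /funext ->. Qed.

Lemma eq_cgauss_integrable phi psi : phi =1 psi -> cgauss_integrable phi ->
  cgauss_integrable psi.
Proof. by move=> /funext ->. Qed.

Lemma cmeasurable_cst c : cmeasurable (fun=> c).
Proof. by split; exact: vmeasurable_cst. Qed.

Lemma cmeasurableD phi psi : cmeasurable phi -> cmeasurable psi ->
  cmeasurable (fun x => phi x + psi x).
Proof.
move=> [p1 p2] [q1 q2]; split.
  by under [X in vmeasurable X]eq_fun do rewrite cReD; exact: (vmeasurableD p1 q1).
by under [X in vmeasurable X]eq_fun do rewrite cImD; exact: (vmeasurableD p2 q2).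
Qed.

Lemma vmeasurableN (g : 'rV[R]_m -> R) : vmeasurable g -> vmeasurable (fun x => - g x).
Proof.
by move=> mg; under [X in vmeasurable X]eq_fun do rewrite -mulN1r;
  exact: (vmeasurableM (vmeasurable_cst _) mg).
Qed.

Lemma cmeasurableM phi psi : cmeasurable phi -> cmeasurable psi ->
  cmeasurable (fun x => phi x * psi x).
Proof.
move=> [p1 p2] [q1 q2]; split.
  under [X in vmeasurable X]eq_fun do rewrite cReM.
  exact: (vmeasurableD (vmeasurableM p1 q1) (vmeasurableN (vmeasurableM p2 q2))).
under [X in vmeasurable X]eq_fun do rewrite cImM.
exact: (vmeasurableD (vmeasurableM p1 q2) (vmeasurableM p2 q1)).
Qed.

Lemma cmeasurableX phi n : cmeasurable phi -> cmeasurable (fun x => phi x ^+ n).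
Proof.
move=> mp; elim: n => [|n IH]; first exact: cmeasurable_cst.
by under [X in cmeasurable X]eq_fun do rewrite exprS; exact: cmeasurableM.
Qed.

Lemma cmeasurable_sum n (F : 'I_n -> 'rV[R]_m -> C) :
  (forall i, cmeasurable (F i)) -> cmeasurable (fun x => \sum_(i < n) F i x).
Proof.
elim: n F => [|n IH] F mF.
  by under [X in cmeasurable X]eq_fun do rewrite big_ord0; exact: cmeasurable_cst.
under [X in cmeasurable X]eq_fun do rewrite big_ord_recr.
by apply: cmeasurableD => //; apply: IH.
Qed.

Lemma cmeasurable_real g : vmeasurable g -> cmeasurable (fun x => (g x)%:C).
Proof. by move=> mg; split => //=; exact: vmeasurable_cst. Qed.

Lemma cmeasurable_conj phi : cmeasurable phi -> cmeasurable (fun x => (phi x)^*%C).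
Proof.
move=> [p1 p2]; split.
  by rewrite (_ : (fun x => _) = fun x => Re (phi x))//; apply/funext => x; case: (phi x).
rewrite (_ : (fun x => _) = fun x => - Im (phi x)); first exact: vmeasurableN.
by apply/funext => x; case: (phi x).
Qed.

Lemma measurable_cos_sin :
  measurable_fun setT (@cos R) /\ measurable_fun setT (@sin R).
Proof.
split; apply: continuous_measurable_fun; [exact: continuous_cos|exact: continuous_sin].
Qed.

Lemma cmeasurable_cexp phi : cmeasurable phi -> cmeasurable (fun x => cexp (phi x)).
Proof.
move=> [p1 p2]; apply: cmeasurableM.
  by apply: cmeasurable_real; exact: vmeasurable_comp.
by split; apply: vmeasurable_comp => //; case: measurable_cos_sin.
Qed.

Lemma cgauss_integrableD phi psi : cgauss_integrable phi -> cgauss_integrable psi ->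
  cgauss_integrable (fun x => phi x + psi x).
Proof.
move=> [p1 p2] [q1 q2]; split.
  by under [X in gauss_integrable X]eq_fun do rewrite cReD; exact: gauss_integrableD.
by under [X in gauss_integrable X]eq_fun do rewrite cImD; exact: gauss_integrableD.
Qed.

Lemma cgauss_integrableZ c phi : cgauss_integrable phi ->
  cgauss_integrable (fun x => c * phi x).
Proof.
move=> [p1 p2]; split.
  under [X in gauss_integrable X]eq_fun do rewrite cReM -mulNr.
  by apply: gauss_integrableD; exact: gauss_integrableZ.
under [X in gauss_integrable X]eq_fun do rewrite cImM.
by apply: gauss_integrableD; exact: gauss_integrableZ.
Qed.

Lemma cgauss_integrable0 : cgauss_integrable (fun=> 0).
Proof. by split; exact: gauss_integrable0. Qed.

Lemma cgauss_integrable_sum I (r : seq I) (F : I -> 'rV[R]_m -> C) :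
  (forall i, cgauss_integrable (F i)) -> cgauss_integrable (fun x => \sum_(i <- r) F i x).
Proof.
move=> iF; elim: r => [|i r IH].
  by under [X in cgauss_integrable X]eq_fun do rewrite big_nil; exact: cgauss_integrable0.
by under [X in cgauss_integrable X]eq_fun do rewrite big_cons; exact: cgauss_integrableD.
Qed.

Lemma cgauss_intD phi psi : cgauss_integrable phi -> cgauss_integrable psi ->
  cgauss_int (fun x => phi x + psi x) = cgauss_int phi + cgauss_int psi.
Proof.
move=> [p1 p2] [q1 q2]; rewrite /cgauss_int; apply: complex_ext => /=.
  by under [X in gauss_int X]eq_fun do rewrite cReD; exact: gauss_intD.
by under [X in gauss_int X]eq_fun do rewrite cImD; exact: gauss_intD.
Qed.

Lemma cgauss_intZ c phi : cgauss_integrable phi ->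
  cgauss_int (fun x => c * phi x) = c * cgauss_int phi.
Proof.
move=> [p1 p2]; rewrite /cgauss_int; apply: complex_ext; rewrite ?cReM ?cImM /=.
  under [X in gauss_int X]eq_fun do rewrite cReM -mulNr.
  by rewrite gauss_intD ?gauss_intZ ?mulNr//; exact: gauss_integrableZ.
under [X in gauss_int X]eq_fun do rewrite cImM.
by rewrite gauss_intD ?gauss_intZ//; exact: gauss_integrableZ.
Qed.

Lemma cgauss_int0 : cgauss_int (fun=> 0) = 0.
Proof. by rewrite /cgauss_int/= gauss_int0. Qed.

Lemma cgauss_int_sum I (r : seq I) (F : I -> 'rV[R]_m -> C) :
  (forall i, cgauss_integrable (F i)) ->
  cgauss_int (fun x => \sum_(i <- r) F i x) = \sum_(i <- r) cgauss_int (F i).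
Proof.
move=> iF; elim: r => [|i r IH].
  by under [X in cgauss_int X]eq_fun do rewrite big_nil; rewrite big_nil cgauss_int0.
under [X in cgauss_int X]eq_fun do rewrite big_cons.
by rewrite big_cons cgauss_intD ?IH//; exact: cgauss_integrable_sum.
Qed.

Lemma cgauss_int_real g : cgauss_int (fun x => (g x)%:C) = (gauss_int g)%:C.
Proof. by rewrite /cgauss_int /= gauss_int0. Qed.

Definition mono (k : 'I_m -> nat) x : R := \prod_(j < m) x 0 j ^+ k j.
Definition incr (k : 'I_m -> nat) i : 'I_m -> nat := fun l => (k l + (l == i))%N.
Definition decr (k : 'I_m -> nat) i : 'I_m -> nat := fun l => (k l - (l == i))%N.

(** [poly_grad Q D]: Q is a polynomial function with gradient D.  The class is
    spanned by the monomials because the integral of a monomial factorises. *)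
Inductive poly_grad : ('rV[R]_m -> C) -> ('I_m -> 'rV[R]_m -> C) -> Prop :=
| poly_grad_mono k c : poly_grad (fun x => c * (mono k x)%:C)
    (fun j x => c * ((k j)%:R * mono (decr k j) x)%:C)
| poly_gradD Q D Q' D' : poly_grad Q D -> poly_grad Q' D' ->
    poly_grad (fun x => Q x + Q' x) (fun j x => D j x + D' j x).

Lemma mono_incr k i x : mono (incr k i) x = x 0 i * mono k x.
Proof.
rewrite /mono (bigD1 i)//= [in RHS](bigD1 i)//= /incr eqxx addn1 exprS -mulrA.
congr (_ * (_ * _)); apply: eq_bigr => j /negbTE ->; by rewrite addn0.
Qed.

Lemma incr_decr k i : (0 < k i)%N -> incr (decr k i) i = k.
Proof. by move=> ki; apply/funext => l; rewrite /incr /decr; case: eqP => [->|]; lia. Qed.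

Lemma decr_incr k i : decr (incr k i) i = k.
Proof. by apply/funext => l; rewrite /incr /decr addnK. Qed.

Lemma decr_incrC k i j : i != j -> decr (incr k i) j = incr (decr k j) i.
Proof.
move=> ij; apply/funext => l; rewrite /incr /decr.
by case: (eqVneq l j) => [->|]; rewrite ?[j == i]eq_sym ?(negbTE ij) ?subn0 ?addn0.
Qed.

(** The integral is a product of one-dimensional moments, and only the factor of
    index j changes, by the recurrence of the moments. *)
Lemma mono_stein k j : gauss_int (fun x => x 0 j * mono k x) =
  (k j)%:R * gauss_int (mono (decr k j)).
Proof.
have -> : (fun x => x 0 j * mono k x) = mono (incr k j).
  by apply/funext => x; rewrite mono_incr.
rewrite (gauss_int_mono R (incr k j)).2 (gauss_int_mono R (decr k j)).2.
rewrite (bigD1 j)//= [in RHS](bigD1 j)//= /incr /decr eqxx addn1 gauss_momentS subn1 mulrA.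
congr (_ * _); apply: eq_bigr => i /negbTE ->; by rewrite addn0 subn0.
Qed.

Lemma cgauss_integrable_mono k c : cgauss_integrable (fun x => c * (mono k x)%:C).
Proof.
apply: cgauss_integrableZ; split => /=; first exact: (gauss_int_mono R k).1.
exact: gauss_integrable0.
Qed.

Lemma poly_grad_integrable Q D : poly_grad Q D ->
  cgauss_integrable Q /\ (forall j, cgauss_integrable (D j)).
Proof.
elim=> [k c|Q1 D1 Q2 D2 _ [IH1 IH1'] _ [IH2 IH2']].
  split; first exact: cgauss_integrable_mono.
  move=> j; apply: eq_cgauss_integrable (cgauss_integrable_mono (decr k j) (c * (k j)%:R)) => x.
  by rewrite -mulrA rmorphM rmorph_nat.
by split; [exact: cgauss_integrableD|move=> j; exact: cgauss_integrableD].
Qed.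

Lemma poly_grad_eq Q D Q' D' : Q =1 Q' -> (forall j, D j =1 D' j) -> poly_grad Q D ->
  poly_grad Q' D'.
Proof.
move=> /funext -> e; rewrite (_ : D = D')//; apply/funext => j; exact/funext.
Qed.

(** Closure under multiplication by a coordinate, with Leibniz' rule; it makes
    every polynomial expression a member of the class. *)
Lemma poly_grad_mulX i Q D : poly_grad Q D ->
  poly_grad (fun x => (x 0 i)%:C * Q x) (fun j x => (i == j)%:R * Q x + (x 0 i)%:C * D j x).
Proof.
elim=> [k c|Q1 D1 Q2 D2 _ IH1 _ IH2].
  apply: poly_grad_eq (poly_grad_mono (incr k i) c) => [x|j x].
    by rewrite mono_incr rmorphM; ring.
  case: (eqVneq i j) => [<-|ij].
    rewrite decr_incr mul1r /incr eqxx addn1 -natr1 mulrDl mul1r rmorphD mulrDr addrC.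
    congr (_ + _); case: (posnP (k i)) => ki.
      by rewrite ki !mul0r rmorph0 !mulr0.
    by rewrite -{2}(incr_decr ki) mono_incr !rmorphM; ring.
  rewrite mul0r add0r decr_incrC// mono_incr /incr eq_sym (negbTE ij) addn0.
  by rewrite !rmorphM; ring.
by apply: poly_grad_eq (poly_gradD IH1 IH2) => [x|j x]; ring.
Qed.

Lemma poly_gradZ c Q D : poly_grad Q D ->
  poly_grad (fun x => c * Q x) (fun j x => c * D j x).
Proof.
elim=> [k c'|Q1 D1 Q2 D2 _ IH1 _ IH2].
  by apply: poly_grad_eq (poly_grad_mono k (c * c')) => [x|j x]; rewrite mulrA.
by apply: poly_grad_eq (poly_gradD IH1 IH2) => [x|j x]; rewrite mulrDr.
Qed.

Lemma poly_grad_cst c : poly_grad (fun=> c) (fun _ _ => 0).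
Proof.
apply: poly_grad_eq (poly_grad_mono (fun=> 0%N) c) => [x|j x].
  by rewrite /mono big1 ?mulr1// => i _; rewrite expr0.
by rewrite mul0r rmorph0 mulr0.
Qed.

Lemma poly_grad_sum n (Q : 'I_n -> 'rV[R]_m -> C) D : (forall i, poly_grad (Q i) (D i)) ->
  poly_grad (fun x => \sum_(i < n) Q i x) (fun j x => \sum_(i < n) D i j x).
Proof.
elim: n Q D => [|n IH] Q D pQ.
  by apply: poly_grad_eq (poly_grad_cst 0) => [x|j x]; rewrite big_ord0.
apply: poly_grad_eq (poly_gradD (IH _ _ (fun i => pQ (widen_ord (leqnSn n) i))) (pQ ord_max)) => [x|j x];
by rewrite big_ord_recr.
Qed.

(** Gaussian integration by parts. *)
Lemma stein j Q D : poly_grad Q D ->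
  cgauss_int (fun x => (x 0 j)%:C * Q x) = cgauss_int (D j).
Proof.
elim=> [k c|Q1 D1 Q2 D2 p1 IH1 p2 IH2].
  transitivity (c * (gauss_int (fun x => x 0 j * mono k x))%:C).
    rewrite -cgauss_int_real -cgauss_intZ; last first.
      by apply: eq_cgauss_integrable (cgauss_integrable_mono (incr k j) 1) => x;
        rewrite mul1r mono_incr.
    by apply: eq_cgauss_int => x; rewrite rmorphM; ring.
  have E : ((k j)%:R * gauss_int (mono (decr k j)))%:C =
    (k j)%:R * cgauss_int (fun x => (mono (decr k j) x)%:C).
    by rewrite cgauss_int_real rmorphM rmorph_nat.
  rewrite mono_stein E mulrA -cgauss_intZ; last first.
    by apply: eq_cgauss_integrable (cgauss_integrable_mono (decr k j) 1) => x;
      rewrite mul1r.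
  by apply: eq_cgauss_int => x; rewrite rmorphM rmorph_nat; ring.
have [i1 _] := poly_grad_integrable (poly_grad_mulX j p1).
have [i2 _] := poly_grad_integrable (poly_grad_mulX j p2).
have [_ d1] := poly_grad_integrable p1.
have [_ d2] := poly_grad_integrable p2.
rewrite cgauss_intD// -IH1 -IH2 -cgauss_intD//.
by apply: eq_cgauss_int => x; rewrite mulrDr.
Qed.

Local Notation lin := (fun a x => cdot (cvec x) a).

Lemma poly_grad_lin (a : 'rV[C]_m) Q D : poly_grad Q D ->
  poly_grad (fun x => lin a x * Q x) (fun j x => a 0 j * Q x + lin a x * D j x).
Proof.
move=> pQ.
apply: poly_grad_eq (poly_grad_sum (fun i => poly_gradZ (a 0 i) (poly_grad_mulX i pQ))) => [x|j x].
  by rewrite /cdot mulr_suml; apply: eq_bigr => i _; rewrite mxE; ring.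
under eq_bigr do rewrite mulrDr.
rewrite big_split/= (bigD1 j)//= eqxx mul1r [X in _ + X + _]big1 ?addr0.
  congr (_ + _); rewrite /cdot mulr_suml; apply: eq_bigr => i _; rewrite mxE; ring.
by move=> i /negbTE ->; rewrite mul0r mulr0.
Qed.

Lemma stein_lin (a : 'rV[C]_m) Q D : poly_grad Q D ->
  cgauss_int (fun x => lin a x * Q x) = \sum_(j < m) a 0 j * cgauss_int (D j).
Proof.
move=> pQ; have [_ iD] := poly_grad_integrable pQ.
rewrite (eq_bigr (fun j => cgauss_int (fun x => a 0 j * ((x 0 j)%:C * Q x)))); last first.
  move=> j _; rewrite cgauss_intZ ?(stein j pQ)//.
  by have [] := poly_grad_integrable (poly_grad_mulX j pQ).
rewrite -cgauss_int_sum => [|j]; last first.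
  by apply: cgauss_integrableZ; have [] := poly_grad_integrable (poly_grad_mulX j pQ).
apply: eq_cgauss_int => x; rewrite /cdot mulr_suml; apply: eq_bigr => j _.
by rewrite mxE; ring.
Qed.

Section Isotropic.
Variable tau : 'rV[C]_m.
Let taub : 'rV[C]_m := \row_j (tau 0 j)^*%C.
Hypothesis tau0 : cdot tau tau = 0.
Hypothesis tau2 : cdot tau taub = 2.

Lemma cdot_conj x : (cdot (cvec x) tau)^*%C = cdot (cvec x) taub.
Proof.
rewrite /cdot cJ_sum; apply: eq_bigr => j _.
by rewrite !mxE cJM conjc_real.
Qed.

Lemma taub0 : cdot taub taub = 0.
Proof.
transitivity (cdot tau tau)^*%C; last by rewrite tau0 conjc0.
by rewrite /cdot cJ_sum; apply: eq_bigr => j _; rewrite !mxE cJM.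
Qed.

Lemma poly_grad_zeta k l :
  poly_grad (fun x => lin tau x ^+ k * lin taub x ^+ l)
    (fun j x => tau 0 j * (k%:R * lin tau x ^+ k.-1 * lin taub x ^+ l) +
                taub 0 j * (l%:R * lin tau x ^+ k * lin taub x ^+ l.-1)).
Proof.
elim: k => [|k IH].
  elim: l => [|l IH].
    by apply: poly_grad_eq (poly_grad_cst 1) => [x|j x]; ring.
  apply: poly_grad_eq (poly_grad_lin taub IH) => [x|j x]; first by rewrite exprS; ring.
  by case: l {IH} => [|l] /=; rewrite ?[_ ^+ l.+1]exprS; ring.
apply: poly_grad_eq (poly_grad_lin tau IH) => [x|j x];
  first by rewrite [_ ^+ k.+1]exprS; ring.
by case: k {IH} => [|k] /=; rewrite ?[_ ^+ k.+2]exprS ?[_ ^+ k.+1]exprS; ring.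
Qed.

Let moment k l := cgauss_int (fun x => lin tau x ^+ k * lin taub x ^+ l).

Lemma zeta_integrable k l : cgauss_integrable (fun x => lin tau x ^+ k * lin taub x ^+ l).
Proof. by have [] := poly_grad_integrable (poly_grad_zeta k l). Qed.

Let moment_rec (a : 'rV[C]_m) k l : 
  cgauss_int (fun x => lin a x * (lin tau x ^+ k * lin taub x ^+ l)) =
  k%:R * cdot tau a * moment k.-1 l + l%:R * cdot taub a * moment k l.-1.
Proof.
rewrite (stein_lin a (poly_grad_zeta k l)).
transitivity (\sum_(j < m) (a 0 j * tau 0 j * (k%:R * moment k.-1 l) + a 0 j * taub 0 j * (l%:R * moment k l.-1))).
  apply: eq_bigr => j _.
  have iz (c n : C) k' l' : cgauss_integrable (fun x => c * (n * (lin tau x ^+ k' * lin taub x ^+ l'))).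
    by do 2! apply: cgauss_integrableZ; exact: zeta_integrable.
  transitivity (a 0 j * (tau 0 j * (k%:R * moment k.-1 l) + taub 0 j * (l%:R * moment k l.-1))); last by ring.
  congr (_ * _); rewrite /moment -!cgauss_intZ; try exact: zeta_integrable.
  - by rewrite -cgauss_intD//; apply: eq_cgauss_int => x; rewrite !mulrA.
  - by apply: cgauss_integrableZ; exact: zeta_integrable.
  - by apply: cgauss_integrableZ; exact: zeta_integrable.
rewrite big_split/= -!mulr_suml.
have cdotC (b : 'rV[C]_m) : \sum_(j < m) a 0 j * b 0 j = cdot b a.
  by apply: eq_bigr => j _; rewrite mulrC.
by rewrite !cdotC; ring.
Qed.

(** Stein's identity removes a factor z: the derivative of z^k in the direction
    tau is k <tau, tau> z^(k-1) = 0, and that of z'^l is 2 l z'^(l-1).  Hence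
    M(k+1, l) = 2 l M(k, l-1), and M(0, l+1) = 0 in the same way. *)
Lemma zeta_moment k l : cgauss_int (fun x => lin tau x ^+ k * lin taub x ^+ l) =
  (k == l)%:R * (2 ^+ k * k`!%:R) * ((Num.sqrt (2 * pi) ^+ m : R))%:C.
Proof.
have E0 l' : moment 0 l' = (0 == l')%:R * ((Num.sqrt (2 * pi) ^+ m : R))%:C.
  case: l' => [|l'].
    rewrite mul1r /moment.
    transitivity (cgauss_int (fun x => (mono (fun=> 0%N) x)%:C)).
      apply: eq_cgauss_int => x; rewrite !expr0 mulr1 /mono big1 ?rmorph1// => i _.
    rewrite cgauss_int_real (gauss_int_mono R (fun=> 0%N)).2; congr (_%:C).
    by rewrite -gauss_moment0 prodr_const card_ord.
  have := moment_rec taub 0 l'; rewrite taub0 !mul0r mulr0 mul0r addr0 => E.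
  rewrite -[RHS]E.
  by apply: eq_cgauss_int => x; rewrite expr0 !mul1r exprS.
rewrite -/(moment k l); elim: k l => [|k IH] l.
  by rewrite E0 expr0 fact0 !mulr1.
have -> : moment k.+1 l = l%:R * 2 * moment k l.-1.
  have := moment_rec tau k l; rewrite tau0 mulr0 mul0r add0r.
  rewrite (_ : cdot taub tau = 2) => [<-|].
    by apply: eq_cgauss_int => x; rewrite exprS mulrA.
  by rewrite -tau2 /cdot; apply: eq_bigr => j _; rewrite mulrC.
rewrite IH; case: l => [|l]; first by rewrite !mul0r.
rewrite eqSS; case: eqVneq => [->|_]; last by rewrite /= !mul0r mulr0.
by rewrite factS natrM exprS; ring.
Qed.

End Isotropic.
End ComplexGaussian.

(** * Real coordinates of the Clifford algebra *)

Section CliffordCoordinates.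
Variables (R : realType) (m : nat).
Local Notation C := R[i].
Local Notation Cl := (clifford R m).
Local Notation Q := (bool * {set 'I_m})%type.
Local Notation Re := (@complex.Re R).
Local Notation Im := (@complex.Im R).
Implicit Types (a b : Cl) (q : Q).

(** The index pairs the flag of the real or imaginary part with the basis
    element, so that one sum runs over all real coordinates. *)
Definition crd q a : R := Defs.coord q.1 q.2 a.
Definition clunit q : Cl := of_coord (fun c A => ((c, A) == q)%:R).

Lemma crdD q a b : crd q (a + b) = crd q a + crd q b.
Proof. by rewrite /crd /Defs.coord clcoefD; case: q.1; rewrite ?cReD ?cImD. Qed.

Lemma crdZ q (r : R) a : crd q (r%:C *: a) = r * crd q a.
Proof.
by rewrite /crd /Defs.coord clcoefZ; case: q.1;
  rewrite ?cReM ?cImM /= mul0r ?subr0 ?addr0.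
Qed.

Lemma crd0 q : crd q 0 = 0.
Proof. by rewrite /crd /Defs.coord clcoef0; case: q.1. Qed.

Lemma crdN q a : crd q (- a) = - crd q a.
Proof. by apply/eqP; rewrite -subr_eq0 opprK -crdD addNr crd0. Qed.

Lemma crdB q a b : crd q (a - b) = crd q a - crd q b.
Proof. by rewrite crdD crdN. Qed.

Lemma crd_sum I (r : seq I) (P : pred I) (F : I -> Cl) q :
  crd q (\sum_(i <- r | P i) F i) = \sum_(i <- r | P i) crd q (F i).
Proof. exact: (big_morph (crd q) (crdD q) (crd0 q)). Qed.

Lemma crd_ext a b : (forall q, crd q a = crd q b) -> a = b.
Proof.
move=> ab; rewrite -(coordK a) -(coordK b); apply/clP => A; rewrite !clcoefE.
by have := ab (false, A); have := ab (true, A); rewrite /crd /= => -> ->.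
Qed.

Lemma crd_unit q q' : crd q (clunit q') = (q == q')%:R.
Proof. by rewrite /crd of_coordK; case: q. Qed.

Lemma clunit_decomp a : a = \sum_q (crd q a)%:C *: clunit q.
Proof.
apply: crd_ext => q; rewrite crd_sum (bigD1 q)//= big1 => [|q' q'q].
  by rewrite crdZ crd_unit eqxx mulr1 addr0.
by rewrite crdZ crd_unit eq_sym (negbTE q'q) mulr0.
Qed.

(** Multiplications by constants, complex scaling and the conjugation [cl_dagger]
    are all real-linear: integrals, bounds and L2 membership pass through them
    by the single argument of [crd_real_linear]. *)
Definition real_linear (T : Cl -> Cl) : Prop :=
  (forall a b, T (a + b) = T a + T b) /\
  (forall (r : R) a, T (r%:C *: a) = r%:C *: T a).

Lemma real_linear_mull c : real_linear (fun a => c * a).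
Proof. by split=> [a b|r a]; rewrite ?mulrDr// scalerAr. Qed.

Lemma real_linear_mulr c : real_linear (fun a => a * c).
Proof. by split=> [a b|r a]; rewrite ?mulrDl// scalerAl. Qed.

Lemma real_linear_scale (k : C) : real_linear (fun a => k *: a).
Proof.
split=> [a b|r a]; first exact: scalerDr.
by rewrite 2!scalerA [k * _]mulrC.
Qed.

Lemma real_linear_dagger : real_linear (@cl_dagger R m).
Proof.
split=> [a b|r a]; first exact: cl_daggerD.
by rewrite cl_daggerZ; congr (_ *: _); exact: conjc_real.
Qed.

Lemma real_linear0 T : real_linear T -> T 0 = 0.
Proof. by move=> [_ TZ]; have := TZ 0 0; rewrite !scale0r. Qed.

Lemma real_linear_sum T I (r : seq I) (F : I -> Cl) : real_linear T ->
  T (\sum_(i <- r) F i) = \sum_(i <- r) T (F i).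
Proof. by move=> lT; exact: (big_morph T lT.1 (real_linear0 lT)). Qed.

Lemma crd_real_linear T q a : real_linear T ->
  crd q (T a) = \sum_q' crd q (T (clunit q')) * crd q' a.
Proof.
move=> lT; rewrite {1}(clunit_decomp a) real_linear_sum// crd_sum.
by apply: eq_bigr => q' _; rewrite lT.2 crdZ mulrC.
Qed.

Definition clnorm a : R := \sum_q `|crd q a|.

Lemma clcoef_le_clnorm A a : cnorm (clcoef a A) <= clnorm a.
Proof.
apply: le_trans (cnorm_le _) _;
  rewrite /clnorm (bigD1 (false, A))//= (bigD1 (true, A))//=.
by rewrite addrA; apply: ler_wpDr => //; exact: sumr_ge0.
Qed.

Lemma crd_scale_le q (k : C) a : `|crd q (k *: a)| <= cnorm k * clnorm a.
Proof.
apply: (@le_trans _ _ (cnorm (clcoef (k *: a) q.2))).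
  by rewrite /crd /Defs.coord; case: q.1; [exact: Im_le_cnorm|exact: Re_le_cnorm].
by rewrite clcoefZ cnormM ler_wpM2l ?cnorm_ge0// clcoef_le_clnorm.
Qed.

Definition coord_dot a b : R := \sum_q crd q a * crd q b.

Lemma coord_dotC a b : coord_dot a b = coord_dot b a.
Proof. by apply: eq_bigr => q _; rewrite mulrC. Qed.
Lemma coord_dotDl a b c : coord_dot (a + b) c = coord_dot a c + coord_dot b c.
Proof. by rewrite /coord_dot -big_split; apply: eq_bigr => q _; rewrite crdD mulrDl. Qed.
Lemma coord_dotZl (r : R) a c : coord_dot (r%:C *: a) c = r * coord_dot a c.
Proof. by rewrite /coord_dot mulr_sumr; apply: eq_bigr => q _; rewrite crdZ mulrA. Qed.
Lemma coord_dot_ge0 a : 0 <= coord_dot a a.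
Proof. by apply: sumr_ge0 => q _; rewrite -expr2 sqr_ge0. Qed.
Lemma crd_coord_dot q a : crd q a = coord_dot (clunit q) a.
Proof.
rewrite /coord_dot (bigD1 q)//= big1 => [|q' q'q];
  first by rewrite crd_unit eqxx mul1r addr0.
by rewrite crd_unit (negbTE q'q) mul0r.
Qed.

(** e_A^dagger e_A = 1, so only products of coefficients of the same basis
    element reach the scalar part. *)
Lemma coord_dot_dagger a b : Re (clcoef (cl_dagger a * b) finset.set0) = coord_dot a b.
Proof.
rewrite clcoefE /coord_dot.
rewrite (big_morph Re (@cReD R) (erefl : Re 0 = 0)).
rewrite -(pair_big xpredT xpredT (fun c A => crd (c, A) a * crd (c, A) b))/=.
rewrite exchange_big/=; apply: eq_bigr => A _.
rewrite symdiff0 clcoefE mulrA mulrA clsign_sqr mul1r conjcE.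
rewrite big_bool /crd /Defs.coord /=; case: (clcoef a A) (clcoef b A) => [x y] [z w] /=.
by ring.
Qed.

Lemma coord_dot_real_linear T : real_linear T ->
  exists K : R, 0 <= K /\ forall a, coord_dot (T a) (T a) <= K * coord_dot a a.
Proof.
move=> lT.
exists (\sum_q (\sum_q' `|crd q (T (clunit q'))|) ^+ 2); split.
  by apply: sumr_ge0 => q _; exact: sqr_ge0.
move=> a; rewrite mulr_suml; apply: ler_sum => q _.
have sa : `|crd q (T a)| <= (\sum_q' `|crd q (T (clunit q'))|) * Num.sqrt (coord_dot a a).
  rewrite crd_real_linear// mulr_suml; apply: le_trans (ler_norm_sum _ _ _) _.
  apply: ler_sum => q' _; rewrite normrM ler_wpM2l// -sqrtr_sqr ler_sqrt ?coord_dot_ge0//.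
  rewrite /coord_dot (bigD1 q')//= -expr2 lerDl sumr_ge0// => i _.
  by rewrite -expr2 sqr_ge0.
have -> : coord_dot a a = Num.sqrt (coord_dot a a) ^+ 2 by rewrite sqr_sqrtr// coord_dot_ge0.
rewrite -exprMn -expr2 -[crd q (T a) ^+ 2]real_normK ?num_real//.
by rewrite lerXn2r// nnegrE (le_trans _ sa).
Qed.

End CliffordCoordinates.

Arguments clunit {R m} q.

(** * The Gaussian inner product *)

Section GaussInner.
Variables (R : realType) (m : nat).
Local Notation C := R[i].
Local Notation Cl := (clifford R m).
Local Notation Q := (bool * {set 'I_m})%type.
Local Notation Re := (@complex.Re R).
Implicit Types (f g h : 'rV[R]_m -> Cl) (q : Q) (x : 'rV[R]_m).

Definition cl_gauss_integrable f :
  Prop := forall q, gauss_integrable (fun x => crd q (f x)).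
Definition cl_L2 f : Prop := forall q, gauss_L2 (fun x => crd q (f x)).
Definition gauss_const : R := ((2 * pi) `^ (m%:R / 2))^-1.

Lemma gauss_const_gt0 : 0 < gauss_const.
Proof. by rewrite invr_gt0 powR_gt0// mulr_gt0// pi_gt0. Qed.

(** The total mass is the m-th power of the one-dimensional one. *)
Lemma gauss_const_mass : gauss_const * Num.sqrt (2 * pi) ^+ m = 1.
Proof.
have p0 : 0 <= 2 * pi :> R by rewrite mulr_ge0// pi_ge0.
rewrite -powR12_sqrt// -powR_mulrn ?powR_ge0// -powRrM mulrC.
by rewrite [X in _ `^ X * _]mulrC mulfV// gt_eqF// powR_gt0// mulr_gt0// pi_gt0.
Qed.

Lemma crd_gauss_weight2 f q x : crd q (gauss_weight 2 f x) = gweight x * crd q (f x).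
Proof. by rewrite /gauss_weight crdZ. Qed.

Lemma cl_gauss_integrableP f : cl_gauss_integrable f <-> cl_integrable (gauss_weight 2 f).
Proof.
split=> [ff b A|ff q].
  by apply: eq_integrable (ff (b, A)) => // p _; rewrite -crd_gauss_weight2.
by apply: eq_integrable (ff q.1 q.2) => // p _; rewrite -crd_gauss_weight2.
Qed.

Lemma crd_gauss_integral f q :
  crd q (Defs.gauss_integral f) = gauss_const * gauss_int (fun x => crd q (f x)).
Proof.
rewrite /Defs.gauss_integral crdZ; congr (_ * _).
rewrite {1}/crd of_coordK /gauss_int; apply: eq_Rintegral => p _.
by rewrite -crd_gauss_weight2.
Qed.

Lemma gauss_integral_ext f g : f =1 g -> Defs.gauss_integral f = Defs.gauss_integral g.
Proof. by move=> /funext ->. Qed.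

Lemma cl_gauss_integrable_ext f g : f =1 g -> cl_gauss_integrable f ->
  cl_gauss_integrable g.
Proof. by move=> /funext ->. Qed.

Lemma cl_gauss_integrable_real_linear T f : real_linear T -> cl_gauss_integrable f ->
  cl_gauss_integrable (fun x => T (f x)).
Proof.
move=> lT ff q; under [X in gauss_integrable X]eq_fun do rewrite crd_real_linear//.
by apply: gauss_integrable_sum => q'; exact: gauss_integrableZ.
Qed.

Lemma gauss_integral_real_linear T f : real_linear T -> cl_gauss_integrable f ->
  Defs.gauss_integral (fun x => T (f x)) = T (Defs.gauss_integral f).
Proof.
move=> lT ff; apply: crd_ext => q; rewrite crd_gauss_integral [in RHS]crd_real_linear//.
under [X in gauss_int X]eq_fun do rewrite crd_real_linear//.
rewrite gauss_int_sum => [|q']; last exact: gauss_integrableZ.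
rewrite mulr_sumr; apply: eq_bigr => q' _.
by rewrite gauss_intZ// crd_gauss_integral mulrCA.
Qed.

Lemma cl_gauss_integrableD f g : cl_gauss_integrable f -> cl_gauss_integrable g ->
  cl_gauss_integrable (fun x => f x + g x).
Proof.
by move=> ff fg q; under [X in gauss_integrable X]eq_fun do rewrite crdD;
  exact: gauss_integrableD.
Qed.

Lemma gauss_integralD f g : cl_gauss_integrable f -> cl_gauss_integrable g ->
  Defs.gauss_integral (fun x => f x + g x) =
    Defs.gauss_integral f + Defs.gauss_integral g.
Proof.
move=> ff fg; apply: crd_ext => q.
rewrite crd_gauss_integral [RHS](crdD q (Defs.gauss_integral f)).
transitivity (gauss_const * gauss_int (fun x => crd q (f x)) + gauss_const * gauss_int (fun x => crd q (g x))).
  rewrite -mulrDr -gauss_intD//.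
  by congr (_ * gauss_int _); apply/funext => x; rewrite crdD.
by congr (_ + _); rewrite crd_gauss_integral.
Qed.

Lemma cl_L2D f g : cl_L2 f -> cl_L2 g -> cl_L2 (fun x => f x + g x).
Proof. by move=> ff fg q; under [X in gauss_L2 X]eq_fun do rewrite crdD;
  exact: gauss_L2D. Qed.

Lemma cl_L2_real_linear T f : real_linear T -> cl_L2 f -> cl_L2 (fun x => T (f x)).
Proof.
move=> lT ff q; under [X in gauss_L2 X]eq_fun do rewrite crd_real_linear//.
by apply: gauss_L2_sum => q'; exact: gauss_L2Z.
Qed.

Lemma cl_L2N f : cl_L2 f -> cl_L2 (fun x => - f x).
Proof.
move=> /(cl_L2_real_linear (real_linear_scale m (-1))) ff q.
by have := ff q; under [X in gauss_L2 X]eq_fun do rewrite scaleN1r.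
Qed.

Lemma cl_L2B f g : cl_L2 f -> cl_L2 g -> cl_L2 (fun x => f x - g x).
Proof. by move=> ff fg; apply: cl_L2D => //; exact: cl_L2N. Qed.

Lemma cl_gauss_integrableM f g : cl_L2 f -> cl_L2 g ->
  cl_gauss_integrable (fun x => f x * g x).
Proof.
move=> ff fg q.
under [X in gauss_integrable X]eq_fun => x do rewrite (crd_real_linear q _ (real_linear_mulr (g x))).
under [X in gauss_integrable X]eq_fun => x do
  under eq_bigr => q' _ do rewrite (crd_real_linear q _ (real_linear_mull (clunit q'))) mulr_suml.
apply: gauss_integrable_sum => q'; apply: gauss_integrable_sum => q''.
under [X in gauss_integrable X]eq_fun => x do rewrite -mulrA.
by apply: gauss_integrableZ; exact: gauss_L2M.
Qed.

Definition real_inner f g : R := gauss_const * gauss_int (fun x => coord_dot (f x) (g x)).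

Lemma Re_MB_inner f g : Re (clcoef (MB_inner f g) finset.set0) = real_inner f g.
Proof.
transitivity (crd (false, finset.set0) (Defs.gauss_integral (fun x => cl_dagger (f x) * g x))) => //.
rewrite crd_gauss_integral /real_inner.
by congr (_ * gauss_int _); apply/funext => x; rewrite -coord_dot_dagger.
Qed.

(** The coordinate of index q of an element v is the scalar part of
    e_q^dagger v; so the Clifford-valued inner product is recovered from the real
    one by multiplying f on the right by e_q. *)
Lemma crd_MB_inner f g q : cl_L2 f -> cl_L2 g ->
  crd q (MB_inner f g) = real_inner (fun x => f x * clunit q) g.
Proof.
move=> ff fg; pose F x := cl_dagger (f x) * g x.
have iF : cl_gauss_integrable F by apply: cl_gauss_integrableM => //;
  exact: cl_L2_real_linear (real_linear_dagger R m) ff.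
rewrite -Re_MB_inner crd_coord_dot -coord_dot_dagger.
rewrite -[LHS]/(Re (clcoef (cl_dagger (clunit q) * Defs.gauss_integral F) finset.set0)).
rewrite -(gauss_integral_real_linear (real_linear_mull (cl_dagger (clunit q))) iF).
rewrite (gauss_integral_ext (g := fun x => cl_dagger (f x * clunit q) * g x))// => x.
by rewrite cl_daggerM -mulrA.
Qed.

Lemma gauss_int_coord_dot f g : cl_L2 f -> cl_L2 g ->
  gauss_integrable (fun x => coord_dot (f x) (g x)).
Proof. by move=> ff fg; apply: gauss_integrable_sum => q; exact: gauss_L2M. Qed.

Lemma real_innerC f g : real_inner f g = real_inner g f.
Proof. by congr (_ * gauss_int _); apply/funext => x; rewrite coord_dotC. Qed.

Lemma real_innerDl f g h : cl_L2 f -> cl_L2 g -> cl_L2 h ->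
  real_inner (fun x => f x + g x) h = real_inner f h + real_inner g h.
Proof.
move=> ff fg fh; rewrite /real_inner -mulrDr -gauss_intD; [|exact: gauss_int_coord_dot..].
by congr (_ * gauss_int _); apply/funext => x; rewrite coord_dotDl.
Qed.

Lemma real_innerZl (r : R) f h : cl_L2 f -> cl_L2 h ->
  real_inner (fun x => r%:C *: f x) h = r * real_inner f h.
Proof.
move=> ff fh; rewrite /real_inner [RHS]mulrCA; congr (_ * _).
rewrite -gauss_intZ; last exact: gauss_int_coord_dot.
by congr gauss_int; apply/funext => x; rewrite coord_dotZl.
Qed.

Lemma real_innerNl f h : cl_L2 f -> cl_L2 h ->
  real_inner (fun x => - f x) h = - real_inner f h.
Proof.
move=> ff fh; rewrite -mulN1r -real_innerZl//;
  apply: (congr1 (fun k => gauss_const * gauss_int k)); apply/funext => x.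
have E : (-1)%:C = -1 :> C by apply: complex_ext => /=; rewrite ?oppr0.
by rewrite E (scaleN1r (f x)).
Qed.

Lemma real_innerBl f g h : cl_L2 f -> cl_L2 g -> cl_L2 h ->
  real_inner (fun x => f x - g x) h = real_inner f h - real_inner g h.
Proof. by move=> ff fg fh; rewrite real_innerDl//;
  [rewrite real_innerNl|exact: cl_L2N]. Qed.

Lemma real_innerBr f g h : cl_L2 f -> cl_L2 g -> cl_L2 h ->
  real_inner h (fun x => f x - g x) = real_inner h f - real_inner h g.
Proof. by move=> ff fg fh; rewrite real_innerC real_innerBl// ![real_inner _ h]real_innerC. Qed.

Lemma real_innerDr f g h : cl_L2 f -> cl_L2 g -> cl_L2 h ->
  real_inner h (fun x => f x + g x) = real_inner h f + real_inner h g.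
Proof. by move=> ff fg fh; rewrite real_innerC real_innerDl// ![real_inner _ h]real_innerC. Qed.

Lemma real_inner_ge0 f : 0 <= real_inner f f.
Proof. by rewrite mulr_ge0 ?(ltW gauss_const_gt0)//; apply: gauss_int_ge0 => x;
  exact: coord_dot_ge0. Qed.

Lemma real_inner_pythagoras f g : cl_L2 f -> cl_L2 g -> real_inner f g = 0 ->
  real_inner (fun x => f x + g x) (fun x => f x + g x) = real_inner f f + real_inner g g.
Proof.
move=> ff fg fg0; rewrite real_innerDl// ?real_innerDr// ?[real_inner g f]real_innerC ?fg0 ?addr0 ?add0r//.
exact: cl_L2D.
Qed.

(** The discriminant of the nonnegative polynomial r |-> ||f + r g||^2. *)
Lemma cauchy_schwarz f g : cl_L2 f -> cl_L2 g ->
  real_inner f g ^+ 2 <= real_inner f f * real_inner g g.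
Proof.
move=> ff fg.
have H (r : R) : 0 <= real_inner f f + 2 * r * real_inner f g + r ^+ 2 * real_inner g g.
  pose G x := r%:C *: g x.
  have fG : cl_L2 G by exact: cl_L2_real_linear (real_linear_scale m r%:C) fg.
  have E1 : real_inner f G = r * real_inner f g by rewrite real_innerC real_innerZl// real_innerC.
  have E2 : real_inner G G = r ^+ 2 * real_inner g g by rewrite real_innerZl// real_innerC real_innerZl// mulrA.
  have := real_inner_ge0 (fun x => f x + G x).
  rewrite real_innerDl//; last exact: cl_L2D.
  rewrite (real_innerDr ff fG ff) (real_innerDr ff fG fG) (real_innerC G f) E1 E2; lra.
have f0 := real_inner_ge0 f; have g0 := real_inner_ge0 g.
have [g00|gn0] := eqVneq (real_inner g g) 0.
  rewrite g00 mulr0; have [->|fgn0] := eqVneq (real_inner f g) 0; first by rewrite expr0n.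
  have := H (- (real_inner f f + 1) / (2 * real_inner f g)); rewrite g00 mulr0 addr0.
  have -> : 2 * (- (real_inner f f + 1) / (2 * real_inner f g)) * real_inner f g =
    - (real_inner f f + 1) by field.
  lra.
have gp : 0 < real_inner g g by rewrite lt_def gn0.
have := H (- real_inner f g / real_inner g g).
have -> : real_inner f f + 2 * (- real_inner f g / real_inner g g) * real_inner f g + (- real_inner f g / real_inner g g) ^+ 2 * real_inner g g =
  (real_inner f f * real_inner g g - real_inner f g ^+ 2) / real_inner g g by field.
by rewrite pmulr_lge0 ?invr_gt0// subr_ge0.
Qed.

Lemma real_inner_real_linear T : real_linear T -> exists K : R, 0 <= K /\
  forall f, cl_L2 f -> real_inner (fun x => T (f x)) (fun x => T (f x)) <=
    K * real_inner f f.
Proof.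
move=> lT; have [K [K0 HK]] := coord_dot_real_linear lT; exists K; split=> // f' ff.
rewrite /real_inner mulrCA ler_wpM2l ?(ltW gauss_const_gt0)// -gauss_intZ;
  last exact: gauss_int_coord_dot.
apply: le_gauss_int => //; last exact: gauss_integrableZ (gauss_int_coord_dot ff ff).
by apply: gauss_int_coord_dot; exact: cl_L2_real_linear.
Qed.

Lemma MB_normE f : MB_norm f = Num.sqrt (real_inner f f).
Proof. by rewrite /MB_norm Re_MB_inner. Qed.

(** e^(-|x|^2/4) is the square root of the Gaussian weight e^(-|x|^2/2). *)
Lemma square_integrableP f : square_integrable (gauss_weight 4 f) <-> cl_L2 f.
Proof.
have E q x : crd q (gauss_weight 4 f x) = expR (- (enorm x ^+ 2 / 4)) * crd q (f x).
  by rewrite /gauss_weight crdZ.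
have W x : expR (- (enorm x ^+ 2 / 4)) ^+ 2 = gweight x.
  by rewrite expr2 -expRD; congr expR; field.
have mw (c : R) := @vmeasurable_exp_enorm R m c.
split=> [ff q|ff b A].
  have fq := ff q.1 q.2; have sq := Lfun2_integrable_sqr fq.
  have mf : measurable_fun setT (fun p => crd q (gauss_weight 4 f (row_of_tuple p))).
    by move: fq => /[!inE] /andP[/[!inE]/=].
  split; last first.
    apply: eq_integrable sq => // p _ /=; congr (_%:E).
    by rewrite -/(crd q (gauss_weight 4 f (row_of_tuple p))) E exprMn W.
  rewrite /vmeasurable (_ : (fun p => _) =
    fun p => expR (enorm (row_of_tuple p) ^+ 2 * 4^-1) *
      crd q (gauss_weight 4 f (row_of_tuple p)));
        first exact: (measurable_funM (mw _) mf).
  by apply/funext => p; rewrite E mulrA -expRD addrN expR0 mul1r.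
have [mf sf] := ff (b, A).
have mu2 : measurable_fun setT (fun p => Defs.coord b A (gauss_weight 4 f (row_of_tuple p))).
  rewrite (_ : (fun p => _) = fun p => expR (enorm (row_of_tuple p) ^+ 2 * - 4^-1) *
      crd (b, A) (f (row_of_tuple p))); first exact: (measurable_funM (mw _) mf).
  by apply/funext => p; have := E (b, A) (row_of_tuple p); rewrite /crd /= => ->;
    rewrite mulrN.
rewrite inE; apply/andP; split; rewrite inE//=.
rewrite /finite_norm unlock poweR_lty//.
have [_] := integrableP _ _ _ sf.
apply: le_lt_trans; rewrite le_eqVlt; apply/orP; left; apply/eqP.
apply: eq_integral => p _ /=.
congr EFin; have := E (b, A) (row_of_tuple p); rewrite /crd /= => ->.
rewrite powR_mulrn// real_normK ?num_real// exprMn W ger0_norm// mulr_ge0 ?sqr_ge0//.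
exact: ltW (gweight_gt0 _).
Qed.

End GaussInner.

(** * Partial derivatives *)

Section Derivatives.
Variables (R : realType) (m : nat).
Implicit Types (phi : 'rV[R]_m -> R) (x v : 'rV[R]_m).

(** A quadratic remainder gives the derivative, and spares differentiation
    theorems for integrals. *)
Lemma is_derive_of_bound phi x v (d C : R) :
  (forall h : R, `|h| <= 1 -> `|phi (x + h *: v) - phi x - h * d| <= C * h ^+ 2) ->
  is_derive x v phi d.
Proof.
move=> H.
have C0 : 0 <= C by have := H 1; rewrite normr1 expr1n mulr1 lexx => /(_ isT);
  apply: le_trans.
have lim : h^-1 *: (phi (h *: v + x) - phi x) @[h --> (0 : R)^'] --> d.
  apply/cvgrPdist_le => e e0.
  near=> h.
  have h0 : h != 0 by near: h; exact: nbhs_dnbhs_neq.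
  have h1 : `|h| <= 1 by near: h; apply: dnbhs0_le.
  have hC : `|h| <= e / (C + 1) by near: h; apply: dnbhs0_le; rewrite divr_gt0// ltr_wpDl.
  rewrite distrC [h *: v + x]addrC.
  have -> : h^-1 *: (phi (x + h *: v) - phi x) - d =
    h^-1 * (phi (x + h *: v) - phi x - h * d).
    by rewrite [RHS]mulrBr mulKf.
  rewrite normrM normfV ler_pdivrMl ?normr_gt0//; apply: le_trans (H h h1) _.
  rewrite -real_normK ?num_real// expr2 mulrCA ler_wpM2l//.
  move: hC; rewrite ler_pdivlMr ?ltr_wpDl//; apply: le_trans.
  by rewrite mulrC mulrDr lerDl mulr1.
by split; [apply: cvgP lim|exact: cvg_lim lim].
Unshelve. all: by end_near. Qed.

Lemma is_derive_line phi x v (h : R) : derivable phi (x + h *: v) v ->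
  is_derive h 1 (fun r : R => phi (x + r *: v)) ('D_v phi (x + h *: v)).
Proof.
move=> dphi.
have E : (fun r : R => r^-1 *: (phi (x + (r *: 1 + h) *: v) - phi (x + h *: v))) =
    (fun r : R => r^-1 *: (phi (r *: v + (x + h *: v)) - phi (x + h *: v))).
  apply/funext => r; congr (_ *: (phi _ - _)).
  by rewrite [r *: 1]mulr1 scalerDl addrCA.
by split; rewrite /derivable /derive /= E.
Qed.

(** Go from x0 to x by changing one coordinate at a time; on each step the mean
    value inequality applies, with a common bound on the partial derivatives
    near x0. *)
Lemma continuous_of_partials phi :
  (forall x (j : 'I_m), derivable phi x (delta_mx 0 j)) ->
  (forall x (j : 'I_m), {for x, continuous ('D_(delta_mx 0 j) phi)}) ->
  continuous phi.
Proof.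
move=> dphi cphi x0.
have [M [M0 [e [e0 HM]]]] : exists M : R, 0 <= M /\ exists e : R, 0 < e /\
    forall j y, ball x0 e y -> `|'D_(delta_mx 0 j) phi y| <= M.
  have /fin_all_exists [e He] (j : 'I_m) : exists e : R, 0 < e /\
      forall y, ball x0 e y ->
        `|'D_(delta_mx 0 j) phi y| <= `|'D_(delta_mx 0 j) phi x0| + 1.
    have : \forall y \near x0, `|'D_(delta_mx 0 j) phi y| <=
      `|'D_(delta_mx 0 j) phi x0| + 1.
      have := cphi x0 j => /cvgrPdist_le /(_ 1 ltr01); apply: filterS => y y1.
      rewrite -lerBlDl; apply: le_trans (lerB_dist _ _) _.
      by rewrite distrC.
    by move=> /nbhs_ballP[e /= e0 He]; exists e; split.
  exists (\sum_j (`|'D_(delta_mx 0 j) phi x0| + 1)); split.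
    by apply: sumr_ge0 => j _; rewrite addr_ge0.
  exists (\big[Order.min/1]_j e j); split.
    by rewrite lt_bigmin// => j _; exact: (He j).1.
  move=> j y xy; apply: le_trans ((He j).2 y _) _.
    by apply: le_ball xy; exact: bigmin_le_cond.
  by rewrite (bigD1 j)//= lerDl sumr_ge0// => i _; rewrite addr_ge0.
pose path (x : 'rV[R]_m) k := \row_(j < m) (if (j < k)%N then x 0 j else x0 0 j).
have step x (d : R) : d <= e -> ball x0 d x -> forall k, (k <= m)%N ->
    `|phi (path x k) - phi x0| <= k%:R * (M * d).
  move=> de [d0 xd]; elim=> [_|k IH km].
    rewrite (_ : path x 0 = x0) ?subrr ?normr0 ?mul0r//.
    by apply/rowP => j; rewrite mxE ltn0.
  pose j := Ordinal km; pose y := path x k; pose b := x 0 j - x0 0 j.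
  have pE : path x k.+1 = y + b *: delta_mx 0 j.
    apply/rowP => i; rewrite !mxE eqxx /= ltnS leq_eqVlt.
    have [->|ij] := eqVneq i j; first by rewrite eqxx ltnn mulr1 addrC subrK.
    rewrite (_ : (val i == k) = false) ?mulr0 ?addr0//.
    by apply/negbTE; apply: contra_neq ij => ik; exact/val_inj.
  have bd : `|b| <= d by have := xd 0 j; rewrite /ball/= distrC => /ltW.
  have yB (r : R) : `|r| <= `|b| -> ball x0 e (y + r *: delta_mx 0 j).
    move=> rb; split; first exact: lt_le_trans d0 de.
    move=> i0 i; rewrite ord1 !mxE eqxx /=.
    have [->|ij] := eqVneq i j.
      rewrite ltnn mulr1 /ball/= opprD addNKr normrN.
      apply: le_lt_trans rb _; apply: lt_le_trans de.
      by have := xd 0 j; rewrite /ball/= distrC.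
    rewrite mulr0 addr0; case: ifP => _.
      by apply: le_ball de _ _; exact: xd.
    by apply: ballxx; exact: lt_le_trans d0 de.
  have B : `|phi (y + b *: delta_mx 0 j) - phi (y + 0 *: delta_mx 0 j)| <= M * `|b|.
    apply: (@mvt_bound R (fun r => phi (y + r *: delta_mx 0 j))
      (fun r => 'D_(delta_mx 0 j) phi (y + r *: delta_mx 0 j))) => r rb.
      exact: is_derive_line (dphi _ _).
    exact/HM/yB.
  rewrite pE -(subrK (phi y) (phi _)) -addrA; apply: le_trans (ler_normD _ _) _.
  rewrite -natr1 mulrDl mul1r [leRHS]addrC lerD ?IH// ?(ltnW km)//.
  by apply: le_trans (ler_wpM2l M0 bd); move: B; rewrite scale0r addr0.
apply/(@cvgrPdist_le _ _ _ (nbhs x0) (nbhs_filter x0) phi (phi x0)) => r r0;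
  apply/nbhs_ballP.
have K0 : 0 < m%:R * M + 1 by rewrite ltr_wpDl// mulr_ge0.
pose d := Num.min e (r / (m%:R * M + 1)).
have d0 : 0 < d by rewrite lt_min e0 divr_gt0.
exists d => // x xd; rewrite /= distrC.
have -> : x = path x m by apply/rowP => j; rewrite mxE ltn_ord.
apply: le_trans (step x d _ xd m (leqnn m)) _; first by rewrite ge_min lexx.
have dr : d <= r / (m%:R * M + 1) by rewrite ge_min lexx orbT.
move: dr; rewrite ler_pdivlMr//; apply: le_trans.
by rewrite mulrA mulrC ler_wpM2l// ?(ltW d0)// lerDl.
Qed.

End Derivatives.

(** * Integrals of a Clifford-valued function against a scalar kernel *)

Section Weighted.
Variables (R : realType) (m : nat).
Local Notation C := R[i].
Local Notation Cl := (clifford R m).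
Local Notation Re := (@complex.Re R).
Local Notation Im := (@complex.Im R).
Implicit Types (g : 'rV[R]_m -> Cl) (k : 'rV[R]_m -> C) (x : 'rV[R]_m).

Definition kint g k : Cl := Defs.gauss_integral (fun x => k x *: g x).

Lemma crd_kint g k q : crd q (kint g k) =
  gauss_const R m * gauss_int (fun x => crd q (k x *: g x)).
Proof. exact: crd_gauss_integral. Qed.

(** Scalar kernels of exponential growth can be integrated against any L2
    function; the constant c enters the bound [kint_bound] linearly, so pointwise
    estimates of kernels turn into estimates of integrals. *)
Definition dominated (c M : R) k : Prop :=
  cmeasurable k /\ forall x, cnorm (k x) <= c * expR (M * l1norm x).

Definition exp_mass g M : R :=
  gauss_const R m * gauss_int (fun x => expR (M * l1norm x) * clnorm (g x)).

Lemma clnorm_ge0 (a : Cl) : 0 <= clnorm a.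
Proof. exact: sumr_ge0. Qed.

Lemma exp_mass_ge0 g M : 0 <= exp_mass g M.
Proof.
rewrite mulr_ge0 ?(ltW (gauss_const_gt0 _ _))//; apply: gauss_int_ge0 => x.
by rewrite mulr_ge0 ?expR_ge0 ?clnorm_ge0.
Qed.

Lemma gauss_L2_clnorm g : cl_L2 g -> gauss_L2 (fun x => clnorm (g x)).
Proof.
move=> fg; apply: gauss_L2_sum => q; split.
  by apply: (@vmeasurable_comp R m (fun z : R => `|z|) _ _ (fg q).1);
    exact: normr_measurable.
under [X in gauss_integrable X]eq_fun do rewrite real_normK ?num_real//.
exact: (fg q).2.
Qed.

Lemma vmeasurable_crd_scale k g q : cmeasurable k -> cl_L2 g ->
  vmeasurable (fun x => crd q (k x *: g x)).
Proof.
move=> [k1 k2] fg; have g1 := (fg (false, q.2)).1; have g2 := (fg (true, q.2)).1.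
rewrite /vmeasurable; case: q g1 g2 => [[] A] /= g1 g2.
  rewrite (_ : (fun p => _) = fun p => Re (k (row_of_tuple p)) * crd (true, A) (g (row_of_tuple p)) +
      Im (k (row_of_tuple p)) * crd (false, A) (g (row_of_tuple p))).
    exact: (vmeasurableD (vmeasurableM k1 g2) (vmeasurableM k2 g1)).
  by apply/funext => p; rewrite /crd /Defs.coord /= clcoefZ cImM.
rewrite (_ : (fun p => _) = fun p => Re (k (row_of_tuple p)) * crd (false, A) (g (row_of_tuple p)) +
      - (Im (k (row_of_tuple p)) * crd (true, A) (g (row_of_tuple p)))).
  exact: (vmeasurableD (vmeasurableM k1 g1) (vmeasurableN (vmeasurableM k2 g2))).
by apply/funext => p; rewrite /crd /Defs.coord /= clcoefZ cReM.
Qed.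

Let dom_int g c M : cl_L2 g ->
  gauss_integrable (fun x => c * (expR (M * l1norm x) * clnorm (g x))).
Proof.
move=> fg; apply: gauss_integrableZ.
exact: (gauss_L2M (gauss_L2_exp m M) (gauss_L2_clnorm fg)).
Qed.

Let dom_le c M k g q : dominated c M k ->
  forall x, `|crd q (k x *: g x)| <= c * (expR (M * l1norm x) * clnorm (g x)).
Proof.
move=> [_ kb] x; apply: le_trans (crd_scale_le _ _ _) _.
by rewrite mulrA ler_wpM2r ?clnorm_ge0.
Qed.

Lemma cl_gauss_integrable_dominated c M k g : cl_L2 g -> dominated c M k ->
  cl_gauss_integrable (fun x => k x *: g x).
Proof.
move=> fg dk q; have [mk _] := dk; have mkg := vmeasurable_crd_scale q mk fg.
have le := dom_le g q dk; have ig := dom_int c M fg.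
exact: gauss_integrable_le mkg le ig.
Qed.

Lemma kint_bound c M k g q : cl_L2 g -> dominated c M k ->
  `|crd q (kint g k)| <= c * exp_mass g M.
Proof.
move=> fg dk; rewrite crd_kint normrM (ger0_norm (ltW (gauss_const_gt0 _ _))).
rewrite /exp_mass mulrCA ler_wpM2l ?(ltW (gauss_const_gt0 _ _))//.
rewrite -gauss_intZ; last exact: (gauss_L2M (gauss_L2_exp m M) (gauss_L2_clnorm fg)).
have [mk _] := dk; have mkg := vmeasurable_crd_scale q mk fg.
have le := dom_le g q dk; have ig := dom_int c M fg.
exact: norm_gauss_int_le mkg le ig.
Qed.

Lemma kint_ext g k k' : k =1 k' -> kint g k = kint g k'.
Proof. by move=> /funext ->. Qed.

Definition kintegrable g k : Prop := cl_gauss_integrable (fun x => k x *: g x).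

Lemma kintD g k k' : kintegrable g k -> kintegrable g k' ->
  kint g (fun x => k x + k' x) = kint g k + kint g k'.
Proof.
move=> ik ik'; transitivity (Defs.gauss_integral (fun x => k x *: g x + k' x *: g x)).
  by apply: gauss_integral_ext => x; exact: scalerDl.
exact: gauss_integralD ik ik'.
Qed.

Lemma kintegrableD g k k' : kintegrable g k -> kintegrable g k' ->
  kintegrable g (fun x => k x + k' x).
Proof.
move=> ik ik'; have := cl_gauss_integrableD ik ik'; apply: cl_gauss_integrable_ext => x.
by apply: esym; exact: scalerDl.
Qed.

Lemma kintZ g (z : C) k : kintegrable g k -> kint g (fun x => z * k x) = z *: kint g k.
Proof.
move=> ik; transitivity (Defs.gauss_integral (fun x => z *: (k x *: g x))).
  by apply: gauss_integral_ext => x; apply: esym; exact: scalerA.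
exact: (gauss_integral_real_linear (real_linear_scale m z) ik).
Qed.

Lemma kintegrableZ g (z : C) k : kintegrable g k -> kintegrable g (fun x => z * k x).
Proof.
move=> ik; have := cl_gauss_integrable_real_linear (real_linear_scale m z) ik;
  apply: cl_gauss_integrable_ext => x.
exact: scalerA.
Qed.

Lemma kintegrable0 g : kintegrable g (fun=> 0).
Proof.
move=> q; under [X in gauss_integrable X]eq_fun => x do rewrite (scale0r (g x)) crd0.
exact: gauss_integrable0.
Qed.

Lemma kint0 g : kint g (fun=> 0) = 0.
Proof.
apply: crd_ext => q; rewrite crd_kint crd0.
under [X in gauss_int X]eq_fun => x do rewrite (scale0r (g x)) crd0.
by rewrite gauss_int0 mulr0.
Qed.

Lemma kintegrable_sum g n (k : 'I_n -> 'rV[R]_m -> C) : (forall l, kintegrable g (k l)) ->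
  kintegrable g (fun x => \sum_(l < n) k l x).
Proof.
elim: n k => [|n IH] k ik.
  by under [X in kintegrable g X]eq_fun do rewrite big_ord0; exact: kintegrable0.
under [X in kintegrable g X]eq_fun do rewrite big_ord_recr.
by apply: kintegrableD => //; exact: IH.
Qed.

Lemma kint_sum g n (k : 'I_n -> 'rV[R]_m -> C) : (forall l, kintegrable g (k l)) ->
  kint g (fun x => \sum_(l < n) k l x) = \sum_(l < n) kint g (k l).
Proof.
elim: n k => [|n IH] k ik.
  by under [X in kint g X]eq_fun do rewrite big_ord0; rewrite big_ord0 kint0.
under [X in kint g X]eq_fun do rewrite big_ord_recr.
rewrite big_ord_recr kintD//; last exact: kintegrable_sum.
by rewrite IH.
Qed.

End Weighted.

(** * Exponential kernels and differentiation under the integral *)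

Section Kernels.
Variables (R : realType) (m : nat) (tau : 'rV[R[i]]_m).
Local Notation C := R[i].
Local Notation Cl := (clifford R m).
Implicit Types (g : 'rV[R]_m -> Cl) (k : 'rV[R]_m -> C) (x u v w : 'rV[R]_m).

Definition zeta x : C := cdot (cvec x) tau.
Definition zetaJ x : C := (zeta x)^*%C.
Definition tau_l1 : R := \sum_(j < m) cnorm (tau 0 j).

Lemma zetaD x w : zeta (x + w) = zeta x + zeta w.
Proof.
rewrite /zeta /cdot -big_split; apply: eq_bigr => j _ /=.
by rewrite !mxE rmorphD mulrDl.
Qed.

Lemma zetaZ (r : R) x : zeta (r *: x) = r%:C * zeta x.
Proof.
rewrite /zeta /cdot mulr_sumr; apply: eq_bigr => j _ /=.
by rewrite !mxE rmorphM mulrA.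
Qed.

Lemma zeta_delta j : zeta (delta_mx 0 j) = tau 0 j.
Proof.
rewrite /zeta /cdot (bigD1 j)//= big1 => [|i ij].
  by rewrite !mxE !eqxx mul1r addr0.
by rewrite !mxE eqxx (negbTE ij) mul0r.
Qed.

Lemma tau_l1_ge0 : 0 <= tau_l1.
Proof. by apply: sumr_ge0 => j _; exact: cnorm_ge0. Qed.

Lemma l1norm_ge0 x : 0 <= l1norm x.
Proof. exact: sumr_ge0. Qed.

Lemma cnorm_sum n (F : 'I_n -> C) : cnorm (\sum_(i < n) F i) <= \sum_(i < n) cnorm (F i).
Proof.
elim/big_rec2: _ => [|i y z _ yz]; first by rewrite cnorm0.
by apply: le_trans (cnormD _ _) _; rewrite lerD2l.
Qed.

Lemma cnorm_zeta x : cnorm (zeta x) <= tau_l1 * l1norm x.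
Proof.
apply: le_trans (cnorm_sum _) _; rewrite mulr_sumr; apply: ler_sum => j _.
rewrite cnormM mxE cnorm_real mulrC ler_wpM2r//.
by rewrite /tau_l1 (bigD1 j)//= lerDl sumr_ge0// => i _; exact: cnorm_ge0.
Qed.

Lemma cnorm_zetaJ x : cnorm (zetaJ x) <= tau_l1 * l1norm x.
Proof. by rewrite cnormJ cnorm_zeta. Qed.

Lemma cmeasurable_zeta : cmeasurable zeta.
Proof.
apply: (@cmeasurable_sum R m m (fun j x => cvec x 0 j * tau 0 j)) => j.
apply: cmeasurableM; last exact: cmeasurable_cst.
under [X in cmeasurable X]eq_fun do rewrite mxE.
by apply: cmeasurable_real; exact: vmeasurable_coord.
Qed.

Lemma cmeasurable_zetaJ : cmeasurable zetaJ.
Proof. exact: cmeasurable_conj cmeasurable_zeta. Qed.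

Lemma pow_l1norm_le x p : (tau_l1 * l1norm x) ^+ p <= p`!%:R * expR (tau_l1 * l1norm x).
Proof. by apply: expr_le_expR; rewrite mulr_ge0 ?tau_l1_ge0 ?l1norm_ge0. Qed.

Lemma dominated_zetaJ p : dominated p`!%:R tau_l1 (fun x => zetaJ x ^+ p).
Proof.
split=> [|x]; first exact: cmeasurableX cmeasurable_zetaJ.
rewrite cnormX; apply: le_trans _ (pow_l1norm_le x p).
by rewrite lerXn2r ?nnegrE ?cnorm_ge0 ?cnorm_zetaJ// mulr_ge0 ?tau_l1_ge0 ?l1norm_ge0.
Qed.

Definition kernel_arg u x : C := 2^-1 * zeta u * zetaJ x.
(** Differentiating exp (z(u) z'(x) / 2) in u brings down factors z'(x), so the
    family over p is closed under differentiation. *)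
Definition bkernel p u x : C := zetaJ x ^+ p * cexp (kernel_arg u x).

Lemma cmeasurable_kernel_arg u : cmeasurable (kernel_arg u).
Proof. exact: (cmeasurableM (cmeasurable_cst _ _) cmeasurable_zetaJ). Qed.

Lemma cmeasurable_bkernel p u : cmeasurable (bkernel p u).
Proof. exact: (cmeasurableM (cmeasurableX p cmeasurable_zetaJ) (cmeasurable_cexp (cmeasurable_kernel_arg u))). Qed.

Lemma kernel_argD u w x : kernel_arg (u + w) x = kernel_arg u x + kernel_arg w x.
Proof. by rewrite /kernel_arg zetaD; ring. Qed.

Lemma cnorm_half : cnorm (2^-1 : C) = 2^-1.
Proof.
have -> : (2^-1 : C) = (2^-1 : R)%:C by rewrite fmorphV/= rmorph_nat.
by rewrite cnorm_real ger0_norm.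
Qed.

Lemma cnorm_kernel_arg u x : cnorm (kernel_arg u x) <=
  2^-1 * cnorm (zeta u) * (tau_l1 * l1norm x).
Proof.
rewrite /kernel_arg !cnormM cnorm_half ler_wpM2l ?cnorm_zetaJ//.
by rewrite mulr_ge0 ?cnorm_ge0.
Qed.

Lemma dominated_bkernel p u : dominated p`!%:R (tau_l1 + cnorm (zeta u) * tau_l1) (bkernel p u).
Proof.
split=> [|x]; first exact: cmeasurable_bkernel.
rewrite cnormM mulrDl expRD mulrA; apply: ler_pM; rewrite ?cnorm_ge0//.
  exact: (dominated_zetaJ p).2.
apply: le_trans (cnorm_cexp_le _) _; rewrite ler_expR;
  apply: le_trans (cnorm_kernel_arg _ _) _.
rewrite -[leRHS]mulrA ler_wpM2r ?mulr_ge0 ?tau_l1_ge0 ?l1norm_ge0//.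
by rewrite ler_piMl ?cnorm_ge0// invf_le1// ler1n.
Qed.

Definition taylor_rate u : R := tau_l1 + cnorm (zeta u) * tau_l1 + 2 * tau_l1.

(** exp (w + d) - exp w = exp w (exp d - 1), of order |d|. *)
Lemma bkernel_taylor0 p u w : cnorm (zeta w) <= 1 ->
  dominated (2 * p`!%:R * cnorm (zeta w)) (taylor_rate u) (fun x => bkernel p (u + w) x - bkernel p u x).
Proof.
move=> w1; split=> [|x].
  rewrite (_ : (fun x => _) = (fun x => bkernel p (u + w) x + (-1) * bkernel p u x));
    last first.
    by apply/funext => x; rewrite mulN1r.
  by apply: cmeasurableD; [exact: cmeasurable_bkernel|apply: cmeasurableM;
    [exact: cmeasurable_cst|exact: cmeasurable_bkernel]].
have -> : bkernel p (u + w) x - bkernel p u x =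
  bkernel p u x * (cexp (kernel_arg w x) - 1).
  by rewrite /bkernel kernel_argD cexpD; ring.
rewrite cnormM /taylor_rate.
set a := tau_l1 * l1norm x; have a0 : 0 <= a by rewrite mulr_ge0 ?tau_l1_ge0 ?l1norm_ge0.
have d1 : cnorm (kernel_arg w x) <= 2^-1 * cnorm (zeta w) * a := cnorm_kernel_arg w x.
have d2 : cnorm (kernel_arg w x) <= 2^-1 * a by apply: le_trans d1 _;
  rewrite ler_wpM2r// ler_piMr.
have T : cnorm (cexp (kernel_arg w x) - 1) <= 2 * cnorm (zeta w) * expR (2 * a).
  apply: le_trans (cexp_taylor0 _) _.
  rewrite (_ : 2 * cnorm (zeta w) * expR (2 * a) =
    (2 * (cnorm (zeta w) * expR a)) * expR a); last first.
    by rewrite (_ : 2 * a = a + a) ?expRD; ring.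
  apply: ler_pM; rewrite ?mulr_ge0 ?expR_ge0 ?cnorm_ge0//.
    rewrite ler_wpM2l//; apply: le_trans d1 _.
    have z0 := cnorm_ge0 (zeta w).
    have e1 : a <= expR a by have := expr_le_expR 1 a0; rewrite expr1 mul1r.
    by have := ler_wpM2l z0 e1; have : 0 <= cnorm (zeta w) * a by [rewrite mulr_ge0]; lra.
  by rewrite ler_expR; lra.
have B := (dominated_bkernel p u).2 x.
apply: le_trans (ler_pM (cnorm_ge0 _) (cnorm_ge0 _) B T) _.
rewrite [(_ + 2 * tau_l1) * _]mulrDl expRD -[2 * tau_l1 * _]mulrA -/a.
by rewrite le_eqVlt; apply/orP; left; apply/eqP; ring.
Qed.

(** The remainder exp d - 1 - d is of order |d|^2, hence of order h^2. *)
Lemma bkernel_taylor1 p u v (h : R) : `|h| <= 1 ->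
  dominated (2 * p`!%:R * cnorm (zeta v) ^+ 2 * h ^+ 2)
    (tau_l1 + cnorm (zeta u) * tau_l1 + (1 + cnorm (zeta v)) * tau_l1)
    (fun x => bkernel p (u + h *: v) x + ((-1) * bkernel p u x + (- (h%:C * (2^-1 * zeta v))) * bkernel p.+1 u x)).
Proof.
move=> h1; split=> [|x].
  apply: cmeasurableD; first exact: cmeasurable_bkernel.
  by apply: cmeasurableD; (apply: cmeasurableM;
    [exact: cmeasurable_cst|exact: cmeasurable_bkernel]).
have -> : bkernel p (u + h *: v) x + ((-1) * bkernel p u x + (- (h%:C * (2^-1 * zeta v))) * bkernel p.+1 u x)
    = bkernel p u x * (cexp (kernel_arg (h *: v) x) - 1 - kernel_arg (h *: v) x).
  have aE : kernel_arg (h *: v) x =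
    h%:C * (2^-1 * zeta v) * zetaJ x by rewrite /kernel_arg zetaZ; ring.
  by rewrite /bkernel kernel_argD cexpD aE exprS; ring.
rewrite cnormM.
set a := tau_l1 * l1norm x; have a0 : 0 <= a by rewrite mulr_ge0 ?tau_l1_ge0 ?l1norm_ge0.
set z := cnorm (zeta v); have z0 : 0 <= z := cnorm_ge0 _.
have hz : cnorm (zeta (h *: v)) = `|h| * z by rewrite zetaZ cnormM cnorm_real.
have d1 : cnorm (kernel_arg (h *: v) x) <= 2^-1 * (`|h| * z) * a.
  by rewrite -hz; exact: cnorm_kernel_arg.
have d2 : cnorm (kernel_arg (h *: v) x) <= 2^-1 * z * a.
  apply: le_trans d1 _; rewrite ler_wpM2r// ler_wpM2l//.
  by rewrite ler_piMl.
have T : cnorm (cexp (kernel_arg (h *: v) x) - 1 - kernel_arg (h *: v) x) <=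
    2 * z ^+ 2 * h ^+ 2 * expR ((1 + z) * a).
  apply: le_trans (cexp_taylor1 _) _.
  rewrite (_ : expR ((1 + z) * a) = expR a * expR (z * a));
    last by rewrite mulrDl mul1r expRD.
  rewrite [leRHS]mulrA; apply: ler_pM;
    rewrite ?mulr_ge0 ?expR_ge0 ?exprn_ge0 ?cnorm_ge0//.
    have e2 : a ^+ 2 <= 2 * expR a by have := expr_le_expR 2 a0.
    have c2 : cnorm (kernel_arg (h *: v) x) ^+ 2 <= (2^-1 * (`|h| * z) * a) ^+ 2.
      by rewrite lerXn2r ?nnegrE ?cnorm_ge0// (le_trans (cnorm_ge0 _) d1).
    have hh : `|h| ^+ 2 = h ^+ 2 by rewrite real_normK ?num_real.
    have zh : 0 <= z ^+ 2 * h ^+ 2 by rewrite mulr_ge0 ?sqr_ge0.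
    have := ler_wpM2l zh e2.
    have : 0 <= z ^+ 2 * h ^+ 2 * expR a by rewrite mulr_ge0 ?expR_ge0.
    move: c2; rewrite !exprMn hh; lra.
  by rewrite ler_expR; lra.
have B := (dominated_bkernel p u).2 x.
apply: le_trans (ler_pM (cnorm_ge0 _) (cnorm_ge0 _) B T) _.
rewrite [(_ + (1 + _) * tau_l1) * _]mulrDl expRD -[(1 + _) * tau_l1 * _]mulrA -/a -/z.
by rewrite le_eqVlt; apply/orP; left; apply/eqP; ring.
Qed.

Lemma kintegrable_bkernel g p u : cl_L2 g -> kintegrable g (bkernel p u).
Proof. by move=> fg; exact: cl_gauss_integrable_dominated fg (dominated_bkernel p u). Qed.

Lemma kint_bkernel_continuous g p q : cl_L2 g ->
  continuous (fun u => crd q (kint g (bkernel p u))).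
Proof.
move=> fg u; pose F w := crd q (kint g (bkernel p w)).
apply/(@cvgrPdist_le _ _ _ (nbhs u) (nbhs_filter u) F (F u)) => e e0; apply/nbhs_ballP.
pose c := 2 * p`!%:R * exp_mass g (taylor_rate u).
have c0 : 0 <= c by apply: mulr_ge0; [rewrite mulr_ge0|exact: exp_mass_ge0].
pose L := tau_l1 * m%:R; have L0 : 0 <= L by rewrite mulr_ge0 ?tau_l1_ge0.
(* The first bound keeps |z (y - u)| <= 1; the second one makes the increment,
   which is at most c L d, smaller than e. *)
pose d := Num.min (L + 1)^-1 (e / (c * L + 1)).
have cL0 : 0 < c * L + 1 by apply: ltr_wpDl => //; exact: mulr_ge0.
have d0 : 0 < d by rewrite lt_min invr_gt0 divr_gt0// andbT ltr_wpDl.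
exists d => // y [_ yd].
have zy : cnorm (zeta (y - u)) <= L * d.
  apply: le_trans (cnorm_zeta _) _; rewrite -mulrA ler_wpM2l ?tau_l1_ge0//.
  rewrite -[m in m%:R]card_ord -sumr_const mulr_suml; apply: ler_sum => j _.
  by rewrite mul1r !mxE; have := yd 0 j; rewrite /ball/= distrC => /ltW.
have z1 : cnorm (zeta (y - u)) <= 1.
  apply: le_trans zy _; apply: (@le_trans _ _ (L * (L + 1)^-1)).
    by rewrite ler_wpM2l// ge_min lexx.
  by rewrite ler_pdivrMr ?ltr_wpDl// mul1r lerDl.
have -> : y = u + (y - u) by rewrite addrC subrK.
have Ju := kintegrable_bkernel p u fg; have Jy := kintegrable_bkernel p (u + (y - u)) fg.
have E : kint g (bkernel p (u + (y - u))) - kint g (bkernel p u) =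
  kint g (fun x => bkernel p (u + (y - u)) x - bkernel p u x).
  transitivity (kint g (bkernel p (u + (y - u))) + kint g (fun x => (-1) * bkernel p u x)).
    by rewrite (kintZ (-1) Ju) (scaleN1r (kint g (bkernel p u))).
  rewrite -(kintD Jy (kintegrableZ (-1) Ju)); apply: kint_ext => x.
  by rewrite mulN1r.
rewrite /= /F distrC -(crdB q (kint g (bkernel p (u + (y - u)))) (kint g (bkernel p u))) E.
apply: le_trans (kint_bound q fg (bkernel_taylor0 p u z1)) _.
have -> : 2 * p`!%:R * cnorm (zeta (y - u)) * exp_mass g (taylor_rate u) =
  c * cnorm (zeta (y - u)).
  by rewrite /c; ring.
apply: le_trans (ler_wpM2l c0 zy) _; rewrite mulrA.
apply: (@le_trans _ _ (c * L * (e / (c * L + 1)))).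
  by apply: ler_wpM2l; [exact: mulr_ge0|rewrite /d ge_min lexx orbT].
rewrite mulrCA ler_piMr ?(ltW e0)// ler_pdivrMr// mul1r lerDl//.
Qed.

(** The Taylor estimate of the kernel, once integrated, is the hypothesis of
    [is_derive_of_bound]. *)
Lemma kint_bkernel_derive g p q u v : cl_L2 g ->
  is_derive u v (fun u => crd q (kint g (bkernel p u))) (crd q ((2^-1 * zeta v) *: kint g (bkernel p.+1 u))).
Proof.
move=> fg; pose M := tau_l1 + cnorm (zeta u) * tau_l1 + (1 + cnorm (zeta v)) * tau_l1.
apply: (@is_derive_of_bound R m _ u v _ (2 * p`!%:R * cnorm (zeta v) ^+ 2 * exp_mass g M)) => h h1.
have J1 := kintegrable_bkernel p u fg;
  have J2 := kintegrable_bkernel p (u + h *: v) fg;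
    have J3 := kintegrable_bkernel p.+1 u fg.
have J1' := kintegrableZ (-1) J1;
  have J3' := kintegrableZ (- (h%:C * (2^-1 * zeta v))) J3.
have B := kint_bound q fg (bkernel_taylor1 p u v h1).
rewrite (kintD J2 (kintegrableD J1' J3')) (kintD J1' J3') (kintZ _ J1) (kintZ _ J3) in B.
move: B; move: (kint g (bkernel p (u + h *: v))) (kint g (bkernel p u)) (kint g (bkernel p.+1 u)) => X Y Z.
have -> : X + (-1 *: Y + - (h%:C * (2^-1 * zeta v)) *: Z) =
    X - Y - h%:C *: ((2^-1 * zeta v) *: Z).
  by rewrite scaleN1r scaleNr addrA [h%:C *: _]scalerA.
rewrite crdB crdB crdZ => B.
by rewrite [leRHS]mulrAC.
Qed.

End Kernels.

(** * Clifford vectors and geometric convergence *)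

Section CliffordVectors.
Variables (R : realType) (m : nat).
Local Notation C := R[i].
Local Notation Cl := (clifford R m).

(** Bilinear extension of the anticommutation of the generators. *)
Lemma cl_vecM (z w : 'rV[C]_m) :
  cl_vec z * cl_vec w + cl_vec w * cl_vec z = (- 2 * cdot z w)%:A.
Proof.
have E (a b : 'rV[C]_m) : cl_vec a * cl_vec b =
    \sum_i \sum_j (a 0 i * b 0 j) *: (cl_gen i * cl_gen j) :> Cl.
  rewrite /cl_vec mulr_suml; apply: eq_bigr => i _; rewrite mulr_sumr.
  by apply: eq_bigr => j _; rewrite -scalerAl -scalerAr scalerA.
rewrite !E [X in _ + X]exchange_big -big_split /=.
transitivity (\sum_(i < m) (- 2 * (z 0 i * w 0 i)) *: (1 : Cl)).
  apply: eq_bigr => i _; rewrite -big_split /= (bigD1 i)//= big1 => [|j ji].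
    by rewrite [w 0 i * _]mulrC -scalerDr cl_gen_anticomm eqxx scalerA addr0 mulr1 [_ * -2]mulrC.
  rewrite [w 0 j * _]mulrC -scalerDr cl_gen_anticomm eq_sym (negbTE ji) mulr0.
  by rewrite scale0r scaler0.
by rewrite -scaler_suml -mulr_sumr.
Qed.

Lemma gauss_integral_scale (phi : 'rV[R]_m -> C) (b : Cl) : cgauss_integrable phi ->
  Defs.gauss_integral (fun x => phi x *: b) =
    ((gauss_const R m)%:C * cgauss_int phi) *: b.
Proof.
move=> [i1 i2]; apply: crd_ext => q.
rewrite crd_gauss_integral; set c := gauss_const R m; case: q => [[|] A].
  pose B := complex.Im (clcoef b A); pose D := complex.Re (clcoef b A).
  rewrite (_ : (fun x => _) = fun x => B * complex.Re (phi x) + D * complex.Im (phi x)); last first.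
    by apply/funext => x; rewrite /crd /Defs.coord /= clcoefZ cImM /B /D; ring.
  rewrite gauss_intD; [|exact: gauss_integrableZ..].
  rewrite gauss_intZ// gauss_intZ// /crd /Defs.coord /= clcoefZ cImM cImM cReM /cgauss_int /= -/B -/D; ring.
pose B := complex.Re (clcoef b A); pose D := - complex.Im (clcoef b A).
rewrite (_ : (fun x => _) = fun x => B * complex.Re (phi x) + D * complex.Im (phi x));
  last first.
  by apply/funext => x; rewrite /crd /Defs.coord /= clcoefZ cReM /B /D; ring.
rewrite gauss_intD; [|exact: gauss_integrableZ..].
by rewrite gauss_intZ// gauss_intZ// /crd /Defs.coord /= clcoefZ cReM cImM cReM /cgauss_int /= /B /D; ring.
Qed.

Lemma cl_cvgP (u : nat -> Cl) (l : Cl) :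
  cl_cvg u l <-> forall q, crd q (u n) @[n --> \oo] --> crd q l.
Proof. by split=> [H q|H b A]; [exact: H|exact: (H (b, A))]. Qed.

Lemma cl_lim_eq (u : nat -> Cl) (l : Cl) : cl_cvg u l -> cl_lim u = l.
Proof.
move=> ul; apply: crd_ext => q; rewrite /crd of_coordK.
by apply: cvg_lim => //; exact: ul.
Qed.

(** The bound starts at index 1 because the partial sum of index n.+1 is the one
    whose remainder is of order 2^-n. *)
Lemma geom_cvg (u : nat -> R) (l c : R) :
  (forall n, `|u n.+1 - l| <= c * 2^-1 ^+ n) -> u n @[n --> \oo] --> l.
Proof.
move=> H; rewrite -cvg_shiftS; apply/subr_cvg0/norm_cvg0P.
have B : c * 2^-1 ^+ n @[n --> \oo] --> (0 : R).
  rewrite -(mulr0 c); apply: cvgMr; apply: cvg_expr.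
  by rewrite ger0_norm// invf_lt1// ltr1n.
apply: (squeeze_cvgr _ (cvg_cst 0) B); apply: nearW => n.
by rewrite normr_ge0 H.
Qed.

End CliffordVectors.

(** * The integral operator and its partial sums *)

(** With a = tau and b = tau^dagger: tau^dagger tau tau^dagger = 4 tau^dagger. *)
Lemma nilpotent_sandwich (F : comNzRingType) (A : algType F) (a b : A) (c : F) :
  b * b = 0 -> a * b + b * a = c%:A -> b * a * b = c *: b.
Proof.
move=> bb ab; have -> : b * a = c%:A - a * b by rewrite -ab [a * b + _]addrC addrK.
by rewrite mulrBl -mulrA bb mulr0 subr0 -scalerAl mul1r.
Qed.

(** Rearrangement of a term of the kernel series, stated in an abstract algebra. *)
Lemma kernel_coef (F : comNzRingType) (A : algType F) (a b x : A) (z c d e : F) :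
  z * c = e -> z *: (a * (c *: (d *: (b * x)))) = e *: ((d *: (a * b)) * x).
Proof. by move=> <-; rewrite -!scalerAr -!scalerAl !scalerA -[a * b * x]mulrA [z * (c * d)]mulrA. Qed.

(** The cancellation that makes f - S_N orthogonal to z^k tau for k < N. *)
Lemma projection_cancel (F : fieldType) (A : algType F) (a b x : A) (s c : F) :
  s != 0 -> c != 0 -> b * a * b = c *: b ->
  b * (x - s *: (a * (s^-1 *: (c^-1 *: (b * x))))) = 0.
Proof.
move=> s0 c0 E; rewrite mulrBr -!scalerAr scalerA mulfV// scale1r !mulrA E.
by rewrite -scalerAl scalerA mulVf// scale1r subrr.
Qed.

Section Projection.
Variables (R : realType) (m : nat) (tau : 'rV[R[i]]_m).
Local Notation C := R[i].
Local Notation Cl := (clifford R m).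
Hypothesis tau0 : cdot tau tau = 0.
Hypothesis tau2 : cdot tau (\row_j (tau 0 j)^*%C) = 2.
Local Notation zt := (zeta tau).
Local Notation zj := (zetaJ tau).
Local Notation bk := (bkernel tau).
Local Notation karg := (kernel_arg tau).
Let T : Cl := cl_vec tau.
Let Td : Cl := cl_dagger T.
Let QQ : Cl := 4^-1 *: (T * Td).
Implicit Types (f g h : 'rV[R]_m -> Cl) (x u v : 'rV[R]_m) (a b : Cl).

Lemma cdot_vdagger x : cdot (cvec x) (vdagger tau) = - zj x.
Proof.
rewrite -[zj x]/((cdot (cvec x) tau)^*%C) cdot_conj /cdot -sumrN.
by apply: eq_bigr => j _; rewrite !mxE mulrN.
Qed.

Let half_eq0 a : a + a = 0 -> a = 0.
Proof.
move=> aa; have : (2 : C) *: a = 0 by rewrite scaler_nat mulr2n.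
by move=> /eqP; rewrite scaler_eq0 pnatr_eq0 /= => /eqP.
Qed.

Let TT : T * T = 0.
Proof. by apply: half_eq0; rewrite cl_vecM tau0 mulr0 scale0r. Qed.

Let TdTd : Td * Td = 0.
Proof. by rewrite -cl_daggerM TT; exact: real_linear0 (real_linear_dagger R m). Qed.

Let TTd : T * Td + Td * T = 4%:A.
Proof.
rewrite /Td -cl_vec_dagger cl_vecM; congr (_ *: _).
have -> : cdot tau (vdagger tau) = - cdot tau (\row_j (tau 0 j)^*%C).
  by rewrite /cdot -sumrN; apply: eq_bigr => j _; rewrite !mxE mulrN.
by rewrite tau2; ring.
Qed.

Let TdTTd : Td * T * Td = 4 *: Td.
Proof.
exact: nilpotent_sandwich TdTd TTd.
Qed.

Lemma cl_vec_kernel0 : T * QQ = 0.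
Proof. by rewrite /QQ -scalerAr mulrA TT mul0r scaler0. Qed.

Lemma zeta_orthogonal k l (b : Cl) :
  kint (fun x => zt x ^+ l *: b) (fun x => zj x ^+ k) =
    ((k == l)%:R * (2 ^+ k * k`!%:R)) *: b.
Proof.
transitivity (Defs.gauss_integral (fun x => (zt x ^+ l * zj x ^+ k) *: b)).
  by apply: gauss_integral_ext => x; rewrite scalerA mulrC.
have zbE x : zj x = cdot (cvec x) (\row_j (tau 0 j)^*%C) by exact: cdot_conj.
have E : (fun x => zt x ^+ l * zj x ^+ k) =
    (fun x => cdot (cvec x) tau ^+ l * cdot (cvec x) (\row_j (tau 0 j)^*%C) ^+ k).
  by apply/funext => x; rewrite zbE.
rewrite gauss_integral_scale; last by rewrite E; exact: zeta_integrable.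
rewrite E zeta_moment//; congr (_ *: b).
rewrite mulrCA -rmorphM /= gauss_const_mass rmorph1 mulr1 eq_sym.
by case: eqVneq => [->|]; rewrite ?mul0r.
Qed.

Lemma cl_L2_zeta l b : cl_L2 (fun x => zt x ^+ l *: b).
Proof.
move=> q.
have le x : `|crd q (zt x ^+ l *: b)| <=
  (l`!%:R * clnorm b) * expR (tau_l1 tau * l1norm x).
  apply: le_trans (crd_scale_le _ _ _) _.
  rewrite mulrAC ler_wpM2r ?clnorm_ge0// cnormX;
    apply: le_trans _ (pow_l1norm_le tau x l).
  rewrite lerXn2r ?nnegrE ?cnorm_ge0 ?cnorm_zeta//.
  by rewrite mulr_ge0 ?tau_l1_ge0 ?l1norm_ge0.
apply: (gauss_L2_le _ le); last exact: gauss_L2Z (gauss_L2_exp m (tau_l1 tau)).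
have [m1 m2] := cmeasurableX l (cmeasurable_zeta tau).
rewrite /vmeasurable; case: q {le} => [[] A].
  rewrite (_ : (fun p => _) = fun p => complex.Re (zt (row_of_tuple p) ^+ l) * crd (true, A) b +
      complex.Im (zt (row_of_tuple p) ^+ l) * crd (false, A) b).
    exact: (vmeasurableD (vmeasurableM m1 (vmeasurable_cst _)) (vmeasurableM m2 (vmeasurable_cst _))).
  by apply/funext => p; rewrite /crd /Defs.coord /= clcoefZ cImM.
rewrite (_ : (fun p => _) = fun p => complex.Re (zt (row_of_tuple p) ^+ l) * crd (false, A) b +
      - (complex.Im (zt (row_of_tuple p) ^+ l) * crd (true, A) b)).
  exact: (vmeasurableD (vmeasurableM m1 (vmeasurable_cst _)) (vmeasurableN (vmeasurableM m2 (vmeasurable_cst _)))).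
by apply/funext => p; rewrite /crd /Defs.coord /= clcoefZ cReM.
Qed.

Lemma kintegrable_zetaJ g k : cl_L2 g -> kintegrable g (fun x => zj x ^+ k).
Proof. by move=> fg; exact: cl_gauss_integrable_dominated fg (dominated_zetaJ tau k). Qed.

Lemma kintDl g h k : kintegrable g k -> kintegrable h k ->
  kint (fun x => g x + h x) k = kint g k + kint h k.
Proof.
move=> ig ih; transitivity (Defs.gauss_integral (fun x => k x *: g x + k x *: h x)).
  by apply: gauss_integral_ext => x; exact: scalerDr.
exact: gauss_integralD ig ih.
Qed.

Lemma kintBl g h k : kintegrable g k -> kintegrable h k ->
  kint (fun x => g x - h x) k = kint g k - kint h k.
Proof.
move=> ig ih; pose F x := k x *: g x; pose G x := k x *: h x.
transitivity (Defs.gauss_integral (fun x => F x + -1 *: G x)).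
  by apply: gauss_integral_ext => x; rewrite scaleN1r; exact: scalerBr.
have iG : cl_gauss_integrable (fun x => -1 *: G x) by exact: cl_gauss_integrable_real_linear (real_linear_scale m (-1)) ih.
rewrite (gauss_integralD (f := F) ig iG) (gauss_integral_real_linear (f :=
  G) (real_linear_scale m (-1)) ih).
exact: congr1 (scaleN1r _).
Qed.

Lemma kint_real_linear g k a : kintegrable g k ->
  kint (fun x => a * g x) k = a * kint g k.
Proof.
move=> ig; transitivity (Defs.gauss_integral (fun x => a * (k x *: g x))).
  by apply: gauss_integral_ext => x; exact: scalerAr.
exact: (gauss_integral_real_linear (real_linear_mull a) ig).
Qed.

Definition tau_poly (c : nat -> Cl) n x : Cl := \sum_(l < n) zt x ^+ l *: (T * c l).

Lemma cl_L2_sum n (F : 'I_n -> 'rV[R]_m -> Cl) : (forall l, cl_L2 (F l)) ->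
  cl_L2 (fun x => \sum_(l < n) F l x).
Proof.
move=> fF q; under [X in gauss_L2 X]eq_fun do rewrite crd_sum.
by apply: (@gauss_L2_sum R m _ _ (fun l x => crd q (F l x))) => l; exact: fF.
Qed.

Lemma cl_L2_tau_comb n (a : 'I_n -> Cl) : cl_L2 (tau_comb tau a).
Proof. by apply: cl_L2_sum => l; exact: cl_L2_zeta. Qed.

(** Orthogonality of the powers of z extracts one coefficient. *)
Lemma kint_tau_poly c n k : kint (tau_poly c n) (fun x => zj x ^+ k) =
  (k < n)%:R *: ((2 ^+ k * k`!%:R) *: (T * c k)).
Proof.
elim: n => [|n IH].
  rewrite ltn0 scale0r; transitivity (kint (fun x => zt x ^+ 0 *: (0 :
    Cl)) (fun x => zj x ^+ k)).
    by apply: gauss_integral_ext => x; rewrite /tau_poly big_ord0 !scaler0.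
  by rewrite zeta_orthogonal scaler0.
transitivity (kint (fun x => tau_poly c n x + zt x ^+ n *: (T * c n)) (fun x => zj x ^+ k)).
  by apply: gauss_integral_ext => x; rewrite /tau_poly big_ord_recr.
rewrite kintDl; [|exact: kintegrable_zetaJ (cl_L2_tau_comb _)|exact: kintegrable_zetaJ (cl_L2_zeta _ _)].
rewrite IH zeta_orthogonal (_ : (k < n.+1)%N = (k == n) || (k < n)%N);
  last by rewrite ltnS leq_eqVlt.
case: (eqVneq k n) => [->|_] /=; first by rewrite ltnn scale0r add0r scale1r mul1r.
by rewrite mul0r scale0r addr0.
Qed.

(** Orthogonality to z^k tau a for all a is the vanishing of one Clifford number. *)
Lemma MB_inner_zeta k a h : cl_L2 h ->
  MB_inner (fun x => zt x ^+ k *: (T * a)) h =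
    cl_dagger a * (Td * kint h (fun x => zj x ^+ k)).
Proof.
move=> fh; have ih := kintegrable_zetaJ k fh.
transitivity (Defs.gauss_integral (fun x => (cl_dagger a * Td) * (zj x ^+ k *: h x))).
  apply: gauss_integral_ext => x.
  have cE : (zt x ^+ k)^*%C = zj x ^+ k by rewrite cJX.
  rewrite cl_daggerZ conjcE cE cl_daggerM -scalerAl; exact: scalerAr.
by rewrite (gauss_integral_real_linear (real_linear_mull _) ih) mulrA.
Qed.

(** Orthogonality to z^k tau a for all a and all k < N; see [MB_inner_zeta]. *)
Definition orth_below h N := forall k, (k < N)%N -> Td * kint h (fun x => zj x ^+ k) = 0.

Lemma real_inner_sum n (F : 'I_n -> 'rV[R]_m -> Cl) h : (forall l, cl_L2 (F l)) ->
  cl_L2 h ->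
  real_inner (fun x => \sum_(l < n) F l x) h = \sum_(l < n) real_inner (F l) h.
Proof.
move=> fF fh; rewrite /real_inner -mulr_sumr -gauss_int_sum => [|l];
  last exact: gauss_int_coord_dot.
congr (_ * gauss_int _); apply/funext => x; elim/big_rec2: _ => [|l y z _ <-].
  by rewrite /coord_dot big1// => q _; rewrite crd0 mul0r.
by rewrite coord_dotDl.
Qed.

Lemma real_inner_tau_comb h N n (a : 'I_n -> Cl) : cl_L2 h -> orth_below h N ->
  (n <= N)%N ->
  real_inner (tau_comb tau a) h = 0.
Proof.
move=> fh oh nN; rewrite real_inner_sum//; last by move=> l; exact: cl_L2_zeta.
apply: big1 => l _; rewrite -Re_MB_inner.
have -> : MB_inner (fun x => zt x ^+ l *: (T * a l)) h = 0.
  by rewrite MB_inner_zeta// oh ?mulr0// (leq_trans (ltn_ord l)).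
by rewrite clcoef0.
Qed.

Section Fixed.
Variable f : 'rV[R]_m -> Cl.
Hypothesis L2f : cl_L2 f.

(** Multiplying f by tau tau^dagger / 4 first reduces the Clifford-valued
    kernel of the projection to a scalar one. *)
Definition tau_part x : Cl := QQ * f x.
Lemma cl_L2_tau_part : cl_L2 tau_part. Proof. exact: cl_L2_real_linear (real_linear_mull QQ) L2f. Qed.

Definition radon u : Cl := kint tau_part (bk 0 u).
(** The Fourier coefficient of f along z^l tau. *)
Definition radon_coef l : Cl :=
  (2 ^+ l * l`!%:R)^-1 *: (4^-1 *: (Td * kint f (fun x => zj x ^+ l))).
Definition radon_sum := tau_poly radon_coef.

Lemma radon_sumE n u : radon_sum n u = kint tau_part (fun x => expsum n (karg u x)).
Proof.
have i1 l : kintegrable tau_part (fun x => zj x ^+ l) :=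
  kintegrable_zetaJ l cl_L2_tau_part.
have E : (fun x => expsum n (karg u x)) =
    (fun x => \sum_(l < n) ((2^-1 * zt u) ^+ l / l`!%:R) * zj x ^+ l).
  apply/funext => x; apply: eq_bigr => l _; rewrite /kernel_arg exprMn; ring.
rewrite E kint_sum => [|l]; last exact: kintegrableZ.
apply: eq_bigr => l _; rewrite kintZ// kint_real_linear; last exact: kintegrable_zetaJ.
rewrite /radon_coef; move: (kint f _) => X; apply: kernel_coef.
by rewrite exprMn exprVn invfM; ring.
Qed.

Lemma radon_rate q u n : `|crd q (radon_sum n.+1 u) - crd q (radon u)| <=
  2 * exp_mass tau_part (5 * (2^-1 * cnorm (zt u) * tau_l1 tau)) * 2^-1 ^+ n.
Proof.
have i1 k c M : dominated c M k ->
  kintegrable tau_part k by exact: cl_gauss_integrable_dominated cl_L2_tau_part.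
have iP : kintegrable tau_part (fun x => expsum n.+1 (karg u x)).
  apply: (@kintegrable_sum R m tau_part n.+1 (fun l x => karg u x ^+ l / l`!%:R)) => l.
  have := kintegrableZ ((2^-1 * zt u) ^+ l / l`!%:R) (kintegrable_zetaJ l cl_L2_tau_part).
  by congr kintegrable; apply/funext => x; rewrite /kernel_arg [in RHS]exprMn; ring.
have iK := kintegrable_bkernel tau 0 u cl_L2_tau_part.
have dom : dominated (2 * 2^-1 ^+ n) (5 * (2^-1 * cnorm (zt u) * tau_l1 tau))
    (fun x => expsum n.+1 (karg u x) + (-1) * bk 0 u x).
  split=> [|x].
    apply: cmeasurableD.
      apply: (@cmeasurable_sum R m n.+1 (fun l x => karg u x ^+ l / l`!%:R)) => l.
      by apply: cmeasurableM; [apply: cmeasurableX;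
        exact: cmeasurable_kernel_arg|exact: cmeasurable_cst].
    by apply: cmeasurableM; [exact: cmeasurable_cst|exact: cmeasurable_bkernel].
  rewrite mulN1r /bkernel expr0 mul1r; apply: le_trans (expsum_geom _ _) _.
  rewrite ler_wpM2l ?mulr_ge0 ?exprn_ge0// ler_expR -[leRHS]mulrA.
  by rewrite ler_wpM2l// -[leRHS]mulrA cnorm_kernel_arg.
have B := kint_bound q cl_L2_tau_part dom.
rewrite (kintD iP (kintegrableZ (-1) iK)) (kintZ (-1) iK) -radon_sumE -/(radon u) in B.
move: B; move: (radon_sum n.+1 u) (radon u) => X Y.
by rewrite scaleN1r crdB mulrAC.
Qed.

Lemma radon_sum_cvg q u : crd q (radon_sum n u) @[n --> \oo] --> crd q (radon u).
Proof. exact: geom_cvg (radon_rate q u). Qed.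

Lemma orth_radon_sum N : orth_below (fun x => f x - radon_sum N x) N.
Proof.
move=> k kN; have fz := kintegrable_zetaJ k L2f;
  have fp := cl_L2_tau_comb (fun l : 'I_N => radon_coef l).
rewrite (kintBl fz (kintegrable_zetaJ k fp)) kint_tau_poly kN scale1r /radon_coef.
move: (kint f _) => X; apply: projection_cancel TdTTd; last by rewrite pnatr_eq0.
by rewrite mulf_neq0 ?expf_neq0 ?pnatr_eq0// -lt0n fact_gt0.
Qed.

End Fixed.
End Projection.

(** * The integral operator is the orthogonal projection *)

(** Form in which Cauchy-Schwarz estimates are turned into orthogonality. *)
Lemma eq0_of_sqr_le (R : realType) (r c : R) :
  (forall e : R, 0 < e -> r ^+ 2 <= c * e) -> r = 0.
Proof.
move=> H; apply/eqP; apply/negP => /negP r0.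
have r2 : 0 < r ^+ 2 by rewrite exprn_even_gt0.
have c0 : 0 <= c.
  by have := H 1 ltr01; rewrite mulr1; apply: le_trans; exact: ltW.
have c1 : 0 < c + 1 by rewrite ltr_wpDl.
have := H (r ^+ 2 / (c + 1)); rewrite divr_gt0// => /(_ isT).
rewrite mulrCA -[leLHS]mulr1 ler_pM2l// ler_pdivlMr// mul1r.
by rewrite leNgt ltrDl ltr01.
Qed.

Section RadonProjection.
Variables (R : realType) (m : nat) (tau : 'rV[R[i]]_m).
Local Notation C := R[i].
Local Notation Cl := (clifford R m).
Local Notation Q := (bool * {set 'I_m})%type.
Hypothesis tau0 : cdot tau tau = 0.
Hypothesis tau2 : cdot tau (\row_j (tau 0 j)^*%C) = 2.
Variable f : 'rV[R]_m -> Cl.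
Hypothesis L2f : cl_L2 f.
Implicit Types (g h : 'rV[R]_m -> Cl) (x u v : 'rV[R]_m) (a b : Cl).
Local Notation S := (radon_sum tau f).
Local Notation P := (radon tau f).

Let nrm g := real_inner g g.
Let dif g h x := g x - h x.

Let cl_L2_radon_sum n : cl_L2 (S n).
Proof. exact: cl_L2_tau_comb (fun l : 'I_n => radon_coef tau f l). Qed.

(** f - S_N is the orthogonal sum of f - S_M and S_M - S_N. *)
Lemma tail_energy N M : (N <= M)%N ->
  nrm (dif (S M) (S N)) = nrm (dif f (S N)) - nrm (dif f (S M)).
Proof.
move=> NM; have fM := cl_L2B L2f (cl_L2_radon_sum M);
  have fD := cl_L2B (cl_L2_radon_sum M) (cl_L2_radon_sum N).
have oM : orth_below tau (dif f (S M)) M by exact: orth_radon_sum.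
have o : real_inner (dif f (S M)) (dif (S M) (S N)) = 0.
  rewrite real_innerC real_innerBl//; try exact: cl_L2_radon_sum.
  rewrite (real_inner_tau_comb (fun l : 'I_M => radon_coef tau f l) fM oM (leqnn M)).
  by rewrite (real_inner_tau_comb (fun l : 'I_N => radon_coef tau f l) fM oM NM) subrr.
have E : dif f (S N) = fun x => dif f (S M) x + dif (S M) (S N) x.
  by apply/funext => x; rewrite /dif addrA subrK.
by rewrite /nrm E real_inner_pythagoras// addrC addKr.
Qed.

(** ||f - S_n||^2 is non-increasing and bounded below, so it is within e of its
    infimum from some rank on. *)
Lemma tail_small (e : R) : 0 < e ->
  exists N, forall n M, (N <= n)%N -> (n <= M)%N -> nrm (dif (S M) (S n)) <= e.
Proof.
move=> e0; pose E := range (fun n => nrm (dif f (S n))).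
have hE : has_inf E.
  split; first by exists (nrm (dif f (S 0))); exists 0%N.
  by exists 0 => _ [n _ <-]; exact: real_inner_ge0.
have [_ [N _ <-] HN] := inf_adherent e0 hE.
exists N => n M Nn nM; rewrite (tail_energy nM) lerBlDr.
have iM : inf E <= nrm (dif f (S M)) by apply: ge_inf; [exact: hE.2|exists M].
have mono : nrm (dif f (S n)) <= nrm (dif f (S N)).
  by rewrite -subr_ge0 -(tail_energy Nn); exact: real_inner_ge0.
apply: le_trans mono _; apply: le_trans (ltW HN) _.
by rewrite addrC lerD2l.
Qed.

Lemma real_inner_coords g : cl_L2 g ->
  nrm g = \sum_q gauss_const R m * gauss_int (fun x => crd q (g x) ^+ 2).
Proof.
move=> fg; rewrite /nrm /real_inner /coord_dot gauss_int_sum => [|q];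
  last exact: gauss_L2M.
rewrite mulr_sumr; apply: eq_bigr => q _; congr (_ * gauss_int _).
Qed.

(** S_M - S_n tends to P - S_n pointwise as M grows, with uniformly small norm;
    Fatou's lemma, coordinate by coordinate, bounds P - S_n. *)
Lemma radon_sum_close (e : R) : 0 < e ->
  exists N, forall n, (N <= n)%N -> cl_L2 (dif P (S n)) /\ nrm (dif P (S n)) <= e.
Proof.
(* The error e is shared among the real coordinates. *)
move=> e0; pose d := e / (#|{: Q}|%:R + 1).
have d0 : 0 < d by rewrite divr_gt0// ltr_wpDl.
have [N HN] := tail_small d0; exists N => n Nn.
have cg := gauss_const_gt0 R m.
have H q : gauss_L2 (fun x => crd q (dif P (S n) x)) /\
    gauss_int (fun x => crd q (dif P (S n) x) ^+ 2) <= d / gauss_const R m.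
  have fM M := cl_L2B (cl_L2_radon_sum (M + n)) (cl_L2_radon_sum n).
  apply: (@gauss_L2_fatou R m (fun M x => crd q (dif (S (M + n)) (S n) x))).
  - by move=> M; exact: fM.
  - move=> x; rewrite /dif crdB.
    rewrite (_ : (fun M => _) = (fun M => crd q (S (M + n) x) - crd q (S n x)));
      last first.
      by apply/funext => M; rewrite crdB.
    apply: cvgB; last exact: cvg_cst.
    have := @radon_sum_cvg R m tau f L2f q x; rewrite -(cvg_shiftn n).
    by apply.
  - move=> M; rewrite ler_pdivlMr// mulrC.
    apply: le_trans (HN n (M + n)%N Nn (leq_addl _ _)).
    rewrite real_inner_coords; last exact: fM.
    rewrite (bigD1 q)//= lerDl; apply: sumr_ge0 => q' _.
    by rewrite mulr_ge0 ?(ltW cg)//; apply: gauss_int_ge0 => x; exact: sqr_ge0.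
have LD : cl_L2 (dif P (S n)) by move=> q; exact: (H q).1.
split=> //; rewrite real_inner_coords//.
apply: (@le_trans _ _ (\sum_(q : Q) d)).
  by apply: ler_sum => q _; rewrite -ler_pdivlMl// mulrC; exact: (H q).2.
rewrite sumr_const -mulr_natl mulrCA ler_piMr ?(ltW e0)//.
by rewrite ler_pdivrMr ?ltr_wpDl// mul1r lerDl.
Qed.

Lemma cl_L2_radon : cl_L2 P.
Proof.
have [N /(_ N (leqnn N))[LD _]] := radon_sum_close ltr01.
have := cl_L2D LD (cl_L2_radon_sum N); congr cl_L2; apply/funext => x.
by rewrite /dif subrK.
Qed.

(** f - P = (f - S_M) - (P - S_M): for large M the first term is orthogonal to
    the given combination and the second one is small. *)
Lemma tau_comb_orth n (a : 'I_n -> Cl) : real_inner (tau_comb tau a) (dif f P) = 0.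
Proof.
have fa := cl_L2_tau_comb tau a.
apply: (@eq0_of_sqr_le R _ (nrm (tau_comb tau a))) => e e0.
have [N HN] := radon_sum_close e0; pose M := maxn N n.
have [LD nD] := HN M (leq_maxl _ _).
have fM := cl_L2B L2f (cl_L2_radon_sum M).
have E : dif f P = fun x => dif f (S M) x - dif P (S M) x.
  by apply/funext => x; rewrite /dif opprB addrA subrK.
have oM : orth_below tau (dif f (S M)) M by exact: orth_radon_sum.
have o := real_inner_tau_comb a fM oM (leq_maxr _ _).
rewrite E real_innerBr// o sub0r sqrrN; apply: le_trans (cauchy_schwarz fa LD) _.
by rewrite ler_wpM2l// real_inner_ge0.
Qed.

Lemma fun_subE g h : g - h = dif g h. Proof. by []. Qed.

(** Each coordinate of the inner product is a real inner product with h e_q,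
    which is approximated by combinations; right multiplication by e_q is bounded. *)
Lemma MB_tau_orth h : MB_tau tau h -> MB_inner h (f - P) = 0.
Proof.
move=> [[_ /square_integrableP fh] Hh]; rewrite fun_subE.
have fD := cl_L2B L2f cl_L2_radon.
apply: crd_ext => q; rewrite crd0 crd_MB_inner//.
have [c [c0 Hc]] := real_inner_real_linear (real_linear_mulr (clunit q : Cl)).
apply: (@eq0_of_sqr_le R _ (c * nrm (dif f P))) => e e0.
have [|n [a]] := Hh (Num.sqrt e); first by rewrite sqrtr_gt0.
rewrite MB_normE ltr_sqrt// => /ltW He.
have fa := cl_L2_tau_comb tau a; have fha := cl_L2B fh fa.
have fu := cl_L2_real_linear (real_linear_mulr (clunit q)) fha.
have -> : real_inner (fun x => h x * clunit q) (dif f P) =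
  real_inner (fun x => dif h (tau_comb tau a) x * clunit q) (dif f P).
  have E : (fun x => h x * clunit q) =
      fun x => dif h (tau_comb tau a) x * clunit q + tau_comb tau (fun l => a l * clunit q) x.
    apply/funext => x; rewrite /dif mulrBl; apply/eqP;
      rewrite -subr_eq0 opprD opprB addrA.
    rewrite [_ + (_ - _)]addrCA subrr addr0 subr_eq0; apply/eqP.
    rewrite /tau_comb mulr_suml; apply: eq_bigr => l _.
    by rewrite -scalerAl mulrA.
  by rewrite E (real_innerDl fu (cl_L2_tau_comb _ _) fD) tau_comb_orth addr0.
apply: le_trans (cauchy_schwarz fu fD) _.
rewrite [leRHS]mulrAC /nrm; apply: ler_wpM2r; first exact: real_inner_ge0.
by apply: le_trans (Hc _ fha) _; rewrite ler_wpM2l.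
Qed.

Let Y u := kint (tau_part tau f) (bkernel tau 1 u).

Lemma radon_derive q u j : is_derive u (delta_mx 0 j) (fun u => crd q (P u)) (crd q ((2^-1 * tau 0 j) *: Y u)).
Proof.
have := kint_bkernel_derive tau 0 q u (delta_mx 0 j) (cl_L2_tau_part tau L2f).
by rewrite zeta_delta.
Qed.

Lemma radon_gradient_continuous q (z : C) : continuous (fun u => crd q (z *: Y u)).
Proof.
have LZ : cl_L2 (fun x => z *: tau_part tau f x) by exact: cl_L2_real_linear (real_linear_scale m z) (cl_L2_tau_part tau L2f).
have H := @kint_bkernel_continuous R m tau _ 1 q LZ.
have E : (fun u => crd q (kint (fun x => z *: tau_part tau f x) (bkernel tau 1 u))) =
  (fun u => crd q (z *: Y u)).
  apply/funext => u; apply: (congr1 (crd q)).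
  have iK := kintegrable_bkernel tau 1 u (cl_L2_tau_part tau L2f).
  transitivity (Defs.gauss_integral (fun x => z *: (bkernel tau 1 u x *: tau_part tau f x))).
    by apply: gauss_integral_ext => x; rewrite !scalerA [z * _]mulrC.
  exact: (gauss_integral_real_linear (real_linear_scale m z) iK).
exact: (eq_ind _ (fun F : 'rV[R]_m -> R => continuous F) H _ E).
Qed.

(** All partial derivatives are multiples tau_j / 2 of one function, so the Dirac
    operator produces a left factor tau, which kills the kernel as tau^2 = 0. *)
Lemma MB_radon : MB P.
Proof.
split; last by apply/square_integrableP; exact: cl_L2_radon.
have dE (c : bool) A j : 'D_(delta_mx 0 j) (Defs.coord c A \o P) =
  fun u => crd (c, A) ((2^-1 * tau 0 j) *: Y u).
  by apply/funext => u; have [_ D] := radon_derive (c, A) u j; exact: D.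
split; first exact: openT.
  move=> c A j u _; split; first by have [] := radon_derive (c, A) u j.
  by rewrite dE; exact: radon_gradient_continuous.
move=> u _; rewrite /dirac_op.
have pE j : cl_partial j P u = (2^-1 * tau 0 j) *: Y u.
    apply: crd_ext => -[c A]; rewrite {1}/crd of_coordK.
    exact: (congr1 (fun F => F u) (dE c A j)).
under eq_bigr do rewrite pE.
have YE : Y u = (4^-1 *: (cl_vec tau * cl_dagger (cl_vec tau))) * kint f (bkernel tau 1 u).
  by rewrite /Y -kint_real_linear//; exact: kintegrable_bkernel.
transitivity (2^-1 *: (cl_vec tau * Y u)).
  rewrite /cl_vec mulr_suml scaler_sumr; apply: eq_bigr => j _.
  by rewrite -scalerAr -scalerAl scalerA.
by rewrite YE mulrA cl_vec_kernel0// mul0r scaler0.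
Qed.

Lemma MB_tau_radon : MB_tau tau P.
Proof.
split; first exact: MB_radon.
move=> e e0; have e2 : 0 < (e / 2) ^+ 2 by rewrite exprn_gt0// divr_gt0.
have [N /(_ N (leqnn N))[LD nD]] := radon_sum_close e2.
exists N, (fun l : 'I_N => radon_coef tau f l); rewrite MB_normE.
apply: (@le_lt_trans _ _ (Num.sqrt ((e / 2) ^+ 2))); first by rewrite ler_wsqrtr.
by rewrite sqrtr_sqr ger0_norm ?divr_ge0 ?(ltW e0)// ltr_pdivrMr// ltr_pMr// ltr1n.
Qed.

Lemma is_orth_proj_radon : is_orth_proj (MB_tau tau) f P.
Proof. by split; [exact: MB_tau_radon|exact: MB_tau_orth]. Qed.

Lemma MB_continuous h q : MB h -> continuous (fun x => crd q (h x)).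
Proof.
move=> [[_ ch _] _]; apply: continuous_of_partials => x j.
  by have [] := ch q.1 q.2 j x I.
by have [] := ch q.1 q.2 j x I.
Qed.

(** Both functions lie in the module, so their difference is orthogonal to each
    of them, hence to itself. *)
Lemma orth_proj_unique g : is_orth_proj (MB_tau tau) f g -> P = g.
Proof.
move=> [[Mg ag] og]; have [_ /square_integrableP fg] := Mg.
have LD := cl_L2B fg cl_L2_radon.
have o1 h : MB_tau tau h -> real_inner h (dif g P) = 0.
  move=> Mh; have [[_ /square_integrableP fh] _] := Mh.
  have r1 : real_inner h (dif f g) = 0 by rewrite -Re_MB_inner -fun_subE og// clcoef0.
  have r2 : real_inner h (dif f P) =
    0 by rewrite -Re_MB_inner -fun_subE MB_tau_orth// clcoef0.
  have E : dif g P = fun x => dif f P x - dif f g x.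
    by apply/funext => x; rewrite /dif opprB [RHS]addrC addrA subrK.
  by rewrite E real_innerBr//;
    [rewrite r1 r2 subrr|exact: cl_L2B L2f cl_L2_radon|exact: cl_L2B L2f fg].
have n0 : nrm (dif g P) = 0.
  have g0 := o1 g (conj Mg ag); have p0 := o1 P MB_tau_radon.
  have := real_innerBl fg cl_L2_radon LD; rewrite g0 p0 subrr; exact.
apply/funext => x; apply: esym; apply/eqP; rewrite -subr_eq0; apply/eqP.
apply: crd_ext => q; rewrite crd0.
apply: (@gauss_int_sqr_eq0 R m (fun x => crd q (dif g P x))); first exact: LD.
  have cg := gauss_const_gt0 R m; move: n0; rewrite real_inner_coords// => /eqP.
  rewrite psumr_eq0 => [/allP/(_ q)|q' _]; last first.
    by rewrite mulr_ge0 ?(ltW cg)//; apply: gauss_int_ge0 => y; exact: sqr_ge0.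
  by rewrite mem_index_enum mulf_eq0 gt_eqF//= => /(_ isT)/eqP.
move=> y; rewrite (_ : (fun x => _) = fun x => crd q (g x) - crd q (P x)); last first.
  by apply/funext => z; rewrite crdB.
by apply: continuousB; apply: MB_continuous => //; exact: MB_radon.
Qed.

End RadonProjection.

(** * The vector tau of an orthonormal pair *)

Section OrthonormalPair.
Variables (R : realType) (m : nat) (t s : 'rV[R]_m).
Hypotheses (ht : enorm t = 1) (hs : enorm s = 1) (hts : edot t s = 0).

Let edot1 (x : 'rV[R]_m) : enorm x = 1 -> edot x x = 1.
Proof. by move=> x1; have := enorm_sqr x; rewrite x1 expr1n => ->; apply: eq_bigr. Qed.

Lemma tauvec_isotropic : cdot (tauvec t s) (tauvec t s) = 0.
Proof.
apply: complex_ext; rewrite /cdot.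
  rewrite (big_morph _ (@cReD R) (erefl : complex.Re 0 = 0)).
  transitivity (edot t t - edot s s); last by rewrite !edot1// subrr.
  rewrite /edot -sumrB.
  by apply: eq_bigr => j _; rewrite cReM !mxE.
rewrite (big_morph _ (@cImD R) (erefl : complex.Im 0 = 0)).
transitivity (edot t s + edot t s); last by rewrite hts addr0.
rewrite /edot -big_split /=.
by apply: eq_bigr => j _; rewrite cImM !mxE /= [s 0 j * _]mulrC.
Qed.

Lemma tauvec_norm : cdot (tauvec t s) (\row_j (tauvec t s 0 j)^*%C) = 2.
Proof.
apply: complex_ext; rewrite /cdot.
  rewrite (big_morph _ (@cReD R) (erefl : complex.Re 0 = 0)).
  transitivity (edot t t + edot s s); last by rewrite !edot1.
  rewrite /edot -big_split /=.
  by apply: eq_bigr => j _; rewrite cReM !mxE /=; ring.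
rewrite (big_morph _ (@cImD R) (erefl : complex.Im 0 = 0)).
rewrite big1 => [|j _]; first by rewrite /= addr0.
by rewrite cImM !mxE /=; ring.
Qed.

End OrthonormalPair.

(** * The kernel series *)

Section KernelSeries.
Variables (R : realType) (m : nat) (tau : 'rV[R[i]]_m).
Local Notation Cl := (clifford R m).
Local Notation QQ := (4^-1 *: (cl_vec tau * cl_dagger (cl_vec tau)) : Cl).
Implicit Types (u x : 'rV[R]_m).

Lemma B_term_sum u x n :
  \sum_(0 <= l < n) B_term tau u x l = expsum n (kernel_arg tau u x) *: QQ.
Proof.
rewrite big_mkord /expsum scaler_suml; apply: eq_bigr => l _.
rewrite scalerA /B_term cdot_vdagger; congr (_ *: _).
rewrite /kernel_arg -/(zeta tau u) [in RHS]exprMn [in RHS]exprMn [(- zetaJ tau x) ^+ l]exprNn exprVn.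
have e2 : (-1) ^+ l * (-1) ^+ l = 1 :> R[i] by rewrite -expr2 sqrr_sign.
rewrite !invfM.
move: e2; set a := (-1) ^+ l; set b := zeta tau u ^+ l; set c := zetaJ tau x ^+ l => e2.
rewrite (_ : a * _ * b * (a * c) =
  (a * a) * (l`!%:R^-1 * (4^-1 * (2 ^+ l)^-1) * b * c)); last by ring.
by rewrite e2; ring.
Qed.

Lemma B_term_cvg u x :
  cl_cvg (fun n => \sum_(0 <= l < n) B_term tau u x l) (cexp (kernel_arg tau u x) *: QQ).
Proof.
apply/cl_cvgP => q.
apply: (@geom_cvg R _ _ (2 * expR (5 * cnorm (kernel_arg tau u x)) * clnorm QQ)) => n.
rewrite B_term_sum -crdB -scalerBl; apply: le_trans (crd_scale_le _ _ _) _.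
rewrite mulrAC; apply: ler_wpM2r; first exact: clnorm_ge0.
by rewrite mulrAC; exact: expsum_geom.
Qed.

Lemma B_kernelE u x : B_kernel tau u x = cexp (kernel_arg tau u x) *: QQ.
Proof. by rewrite /B_kernel; apply: cl_lim_eq; exact: B_term_cvg. Qed.

End KernelSeries.

Theorem theorem3p10 (R : realType) (m : nat) (hm : (2 <= m)%N)
    (t s : 'rV[R]_m) (ht : enorm t = 1) (hs : enorm s = 1) (hts : edot t s = 0)
    (f : 'rV[R]_m -> clifford R m) (hf : MB f) :
  let tau := tauvec t s in
  [/\ exists! g, is_orth_proj (MB_tau tau) f g,
      forall u x : 'rV[R]_m,
        cl_cvg (fun n => \sum_(0 <= l < n) B_term tau u x l)
               (B_kernel tau u x) /\
        B_kernel tau u x =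
          cexp (- (2^-1) * cdot (cvec u) tau * cdot (cvec x) (vdagger tau)) *:
            (4^-1 *: (cl_vec tau * cl_dagger (cl_vec tau)))
    & forall u : 'rV[R]_m,
        cl_integrable (gauss_weight 2 (fun x => B_kernel tau u x * f x)) /\
        bargmann_radon tau f u =
          gauss_integral (fun x => B_kernel tau u x * f x)].
Proof.
move=> tau.
have tau0 := tauvec_isotropic ht hs hts; have tau2 := tauvec_norm ht hs.
have [_ /square_integrableP L2f] := hf.
have PP := is_orth_proj_radon tau0 tau2 L2f.
have uniq g := @orth_proj_unique R m tau tau0 tau2 f L2f g.
split.
- by exists (radon tau f); split.
- move=> u x; rewrite B_kernelE; split; first exact: B_term_cvg.
  rewrite cdot_vdagger; congr (cexp _ *: _).
  by rewrite /kernel_arg -/(zeta tau u); ring.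
move=> u.
have BE : (fun x => B_kernel tau u x * f x) =
  (fun x => bkernel tau 0 u x *: tau_part tau f x).
  apply/funext => x; rewrite B_kernelE /bkernel expr0 mul1r; apply: esym.
  exact: scalerAl.
rewrite BE; split.
  by apply/cl_gauss_integrableP; exact: kintegrable_bkernel (cl_L2_tau_part tau L2f).
rewrite /bargmann_radon; case: xgetP => [g _ gP|/(_ (radon tau f))//].
by rewrite -(uniq _ gP).
Qed.
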